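(* Every point $x\in\mathbf{H}^2_{\mathbb{C}}$ whose isotropy group in $\Gamma_1$ has $x$ as an isolated fixed point is in the $\Gamma_1$-orbit of exactly one of the following five points $p$. Write $G$ for the isotropy group of $p$, $R_G$ for the subgroup of $G$ generated by complex reflections, and $(j_1,j_2,j_3)$ for the numbers of mirrors of complex reflections of $G$ that lie in the $\Gamma_1$-orbits of the mirrors polar to $(0,1,0)$, $(1,-1,0)$, $(1,0,1)$ respectively. (1) $p=(1+i,-i,-1-i)$: $G=R_G$ has order $6$, is generated by the reflections with polar vectors $(0,1+i,1)$ and $(1,0,1)$, with braid length $3$; $(j_1,j_2,j_3)=(0,0,3)$. (2) $p=(1,0,-1)$: $G=R_G$ has order $8$, is generated by the reflections with polar vectors $(0,1,0)$ and $(1,0,1)$, with braid length $2$; $(j_1,j_2,j_3)=(1,0,1)$. (3) $p=(1,-1,-1)$: $G=R_G$ has order $32$, is generated by the reflections with polar vectors $(0,1,1)$ and $(1,0,1)$, with braid length $4$; $(j_1,j_2,j_3)=(0,2,4)$. (4) $p=(1,i(\zeta_8-1),i(\zeta_8-1))$: $G$ is cyclic of order $8$, generated by $\begin{pmatrix}-i&-i-1&i\\ i-1&i&0\\ i-1&i-1&1\end{pmatrix}$, and $R_G$ has order $4$, generated by the reflection with polar vector $(1,-1,0)$; $(j_1,j_2,j_3)=(0,1,0)$. (5) $p=(1,0,-\zeta_{12})$: $G$ is cyclic of order $12$, generated by $\begin{pmatrix}i&0&1\\0&-1&0\\1&0&0\end{pmatrix}$, and $R_G$ has order $4$, generated by the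 reflection with polar vector $(0,1,0)$; $(j_1,j_2,j_3)=(1,0,0)$.
   Context: On $\mathbb{C}^3$ let $\langle v,w\rangle=w^*Jv$ with $J=\begin{pmatrix}0&0&1\\0&1&0\\1&0&0\end{pmatrix}$, $U(J)=\{A\in GL_3(\mathbb{C}):A^*JA=J\}$, and let $\Gamma_d=PU(J,\mathcal{O}_d)$ be the image in $PU(J)$ of $U(J)\cap GL_3(\mathcal{O}_d)$, with $\mathcal{O}_d$ the ring of integers of $\mathbb{Q}(i\sqrt d)$ ($\mathcal{O}_1=\mathbb{Z}[i]$). It acts on $\mathbf{H}^2_{\mathbb{C}}=\{\mathbb{C}v:\langle v,v\rangle<0\}$; a vector $v$ stands for the point $\mathbb{C}v$, and matrices stand for their classes in $PU(J)$. $\zeta_k=e^{2\pi i/k}$. For $\langle w,w\rangle>0$, the mirror polar to $w$ is $\{\mathbb{C}v\in\mathbf{H}^2_{\mathbb{C}}:\langle v,w\rangle=0\}$; a complex reflection is a nontrivial finite-order element fixing such a mirror pointwise. ''The reflection with polar vector $w$'' means the generator $v\mapsto v+(\zeta_k-1)\frac{\langle v,w\rangle}{\langle w,w\rangle}w$ of the cyclic subgroup of $\Gamma_1$ fixing pointwise the mirror polar to $w$, where $k$ is the order of that subgroup ($k=4$ if $\langle w,w\rangle=1$, $k=2$ if $\langle w,w\rangle=2$ for the vectors above). The braid length of a pair $A,B$ is the smallest $n\ge2$ such that the alternating products $ABA\cdots$ and $BAB\cdots$ with $n$ factors are equal. *)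

(* Defs.v *)
From HB Require Import structures.
From mathcomp Require Export all_boot all_order all_algebra all_field.
From mathcomp Require Export complex.
From mathcomp Require Export mathcomp_extra boolp classical_sets functions.
From mathcomp Require Export cardinality reals topology normedtype trigo.
From mathcomp Require Export finmap.

Set Implicit Arguments.
Unset Strict Implicit.
Unset Printing Implicit Defensive.

Import Order.TTheory GRing.Theory Num.Theory.
Import numFieldNormedType.Exports.

Local Open Scope classical_set_scope.
Local Open Scope sesquilinear_scope.
Local Open Scope card_scope.
Local Open Scope ring_scope.

(* The ascription makes the generic structures on numeric fields, in particular
   the topology, apply to C R. *)
Definition C (R : realType) : numClosedFieldType := R[i].

(* zeta R k = e^(2 pi i / k) *)
Definition zeta (R : realType) (k : nat) : C R :=
  (cos (2 * pi / k%:R) +i* sin (2 * pi / k%:R))%C.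

Definition gaussInt (R : realType) : set (C R) :=
  [set z | exists a b : int, z = a%:~R + b%:~R * 'i].

Definition vec3 (R : realType) (a b c : C R) : 'cV[C R]_3 :=
  \col_(i < 3) [:: a; b; c]`_i.

(* The 3 x 3 matrix with the given list of rows. *)
Definition mx3 (R : realType) (rows : seq (seq (C R))) : 'M[C R]_3 :=
  \matrix_(i < 3, j < 3) (nth [::] rows i)`_j.

Definition J (R : realType) : 'M[C R]_3 :=
  mx3 [:: [:: 0; 0; 1];
          [:: 0; 1; 0];
          [:: 1; 0; 0]].

Definition herm (R : realType) (v w : 'cV[C R]_3) : C R :=
  (w ^t* *m J R *m v) 0 0.

(* The point C v of P(C^3) is encoded by the line <[v]>, and the class of a
   matrix A up to scalars by the line <[A]> of M_3(C).  The group law on such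
   classes is then the product (_ * _)%VS of subspaces of the algebra M_3(C),
   with unit 1%VS = <[1]>: see prodv_line and expv_line. *)
Definition point (R : realType) : Type := {vspace 'cV[C R]_3}.
Definition mxclass (R : realType) : Type := {vspace 'M[C R]_3}.

(* vpick picks a nonzero vector of a nonzero subspace; the line below does not
   depend on the choice, by act_line. *)
Definition act (R : realType) (g : mxclass R) (x : point R) : point R :=
  <[(vpick g : 'M[C R]_3) *m vpick x]>%VS.

Lemma act_line (R : realType) (A : 'M[C R]_3) (v : 'cV[C R]_3) :
  act <[A]>%VS <[v]>%VS = <[A *m v]>%VS.
Proof.
have vpick_line (V : vectType (C R)) (u : V) :
  exists2 c : C R, c != 0 & vpick <[u]>%VS = c *: u.
  have /vlineP[c cE] := memv_pick <[u]>%VS.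
  have [u0|u0] := eqVneq u 0.
    by exists 1; rewrite ?oner_neq0// cE u0 !scaler0.
  exists c => //; apply: contra_neq u0 => c0.
  have : vpick <[u]>%VS == 0 by rewrite cE c0 scale0r.
  rewrite vpick0 => /eqP line0; apply/eqP.
  by rewrite -memv0 -line0 memv_line.
have [a a0 aE] := vpick_line _ A; have [b b0 bE] := vpick_line _ v.
rewrite /act aE bE -scalemxAl -scalemxAr scalerA.
by apply/eqP; rewrite eqEsubv -!memvE; apply/andP; split;
  apply/vlineP; [exists (a * b) | exists (a * b)^-1];
  rewrite // scalerA mulVf ?scale1r// mulf_neq0.
Qed.

Definition UJ (R : realType) : set 'M[C R]_3 :=
  [set A | A ^t* *m J R *m A = J R].

Definition GL3O1 (R : realType) : set 'M[C R]_3 :=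
  [set A | [/\ A \in unitmx, forall i j, gaussInt (A i j)
             & forall i j, gaussInt (invmx A i j)]].

Definition PUJ (R : realType) : set (mxclass R) :=
  [set <[A]>%VS | A in @UJ R].

Definition Gamma1 (R : realType) : set (mxclass R) :=
  [set <[A]>%VS | A in @UJ R `&` @GL3O1 R].

Definition H2C (R : realType) : set (point R) :=
  [set <[v]>%VS | v in [set v | herm v v < 0]].

Definition Gamma1_orbit (R : realType) (x : point R) : set (point R) :=
  [set act g x | g in @Gamma1 R].

Definition isotropy (R : realType) (x : point R) : set (mxclass R) :=
  [set g | Gamma1 g /\ act g x = x].

Definition fixed_points (R : realType) (G : set (mxclass R)) : set (point R) :=
  [set x | H2C x /\ forall g, G g -> act g x = x].

(* Neighbourhoods of a point of P(C^3) for the quotient topology. *)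
Definition point_nbhs (R : realType) (x : point R) : set (set (point R)) :=
  [set U | forall v : 'cV[C R]_3, x = <[v]>%VS ->
             \forall w \near v, U <[w]>%VS].

Definition isolated_fixed_point (R : realType) (G : set (mxclass R))
    (x : point R) : Prop :=
  fixed_points G x /\
  point_nbhs x [set y | fixed_points G y -> y = x].

Definition is_subgroup (R : realType) (H : set (mxclass R)) : Prop :=
  [/\ H `<=` @PUJ R, H 1%VS,
      forall a b, H a -> H b -> H (a * b)%VS
    & forall a, H a -> exists2 b, H b & (a * b)%VS = 1%VS].

Definition generated (R : realType) (S : set (mxclass R)) : set (mxclass R) :=
  smallest (@is_subgroup R) S.

Definition mirror (R : realType) (w : 'cV[C R]_3) : set (point R) :=
  [set <[v]>%VS | v in [set v | herm v v < 0 /\ herm v w = 0]].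

Definition is_mirror (R : realType) (M : set (point R)) : Prop :=
  exists2 w, 0 < herm w w & M = mirror w.

Definition fixes_pointwise (R : realType) (g : mxclass R)
    (M : set (point R)) : Prop :=
  forall x, M x -> act g x = x.

Definition is_reflection_in (R : realType) (M : set (point R))
    (g : mxclass R) : Prop :=
  [/\ PUJ g, g <> 1%VS, exists2 n, (0 < n)%N & (g ^+ n)%VS = 1%VS
    & is_mirror M /\ fixes_pointwise g M].

Definition complex_reflection (R : realType) (g : mxclass R) : Prop :=
  exists M, is_reflection_in M g.

Definition reflection_subgroup (R : realType) (G : set (mxclass R)) :
    set (mxclass R) :=
  generated [set g | G g /\ complex_reflection g].

Definition mirror_fixator (R : realType) (w : 'cV[C R]_3) : set (mxclass R) :=
  [set g | Gamma1 g /\ fixes_pointwise g (mirror w)].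

(* The class of v |-> v + (zeta_k - 1) <v,w> / <w,w> w. *)
Definition polar_reflection (R : realType) (w : 'cV[C R]_3) : mxclass R :=
  let k := #|` fset_set (mirror_fixator w)| in
  <[1%:M + ((zeta R k - 1) / herm w w) *: (w *m w ^t* *m J R)]>%VS.

(* alternating a b n = a b a ... with n factors *)
Fixpoint alternating (R : realType) (a b : mxclass R) (n : nat) : mxclass R :=
  if n is m.+1 then (a * alternating b a m)%VS else 1%VS.

Definition braid_length (R : realType) (a b : mxclass R) (n : nat) : Prop :=
  [/\ (2 <= n)%N, alternating a b n = alternating b a n
    & forall m, (2 <= m < n)%N -> alternating a b m <> alternating b a m].

Definition mirrors_in_orbit (R : realType) (G : set (mxclass R))
    (w : 'cV[C R]_3) : set (set (point R)) :=
  [set M | (exists2 g, G g & is_reflection_in M g) /\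
           exists2 h, Gamma1 h & M = act h @` mirror w].

Definition mirror_counts (R : realType) (G : set (mxclass R))
    (j1 j2 j3 : nat) : Prop :=
  [/\ mirrors_in_orbit G (vec3 0 1 0) #= `I_j1,
      mirrors_in_orbit G (vec3 1 (-1) 0) #= `I_j2
    & mirrors_in_orbit G (vec3 1 0 1) #= `I_j3].

(* Main.v *)
(** Let C v be an isolated fixed point of its isotropy group. Some A in the group has at v an
    eigenvalue l which is not an eigenvalue on the orthogonal complement of v. Normalize det A
    to 1: then tr A is a Gaussian integer with |tr A|^2 <= 9 and the discriminant of the
    characteristic polynomial is <= 0, which leaves eleven polynomials. If l is Gaussian, an
    integral multiple of the projector onto C v shows that v is a multiple of a lattice vector
    of norm -1, -2 or -3, and Heisenberg translations together with the inversion J reduce such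
    vectors to three of them. Otherwise l is, up to a unit, a primitive root of unity of order 3
    or 8, and v is orthogonal to a short lattice vector; in coordinates on the corresponding
    complex line v is a root of a quadratic equation of discriminant -3 or -8, and descent on
    the leading coefficient, as in the reduction of binary quadratic forms, leaves one orbit.

    An element of the isotropy group of one of the five points preserves v and is unitary, so
    its entries are bounded and the group is found by enumeration. Elements fixing a mirror
    have a characteristic polynomial with a repeated root, hence vanishing discriminant. The
    orders 6, 8, 32, 8, 12 separate the orbits except for the second and the fourth, and of
    these two only the second contains a point rational over Q(i). *)
Require Import Defs.
From mathcomp Require Import zify ring lra.

Set Implicit Arguments.
Unset Strict Implicit.
Unset Printing Implicit Defensive.

Import Order.TTheory GRing.Theory Num.Theory.
Import numFieldNormedType.Exports.

Local Open Scope classical_set_scope.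
Local Open Scope sesquilinear_scope.
Local Open Scope card_scope.
Local Open Scope ring_scope.

(** * Gaussian lattice vectors of small norm *)

(** Lattice vectors and matrices are kept as integer pairs, so that descent is integer arithmetic
    and finite checks are computations; [gauss_vec] and [gauss_mx] carry the results to C. Two
    obstacles shape the proof. The norm does not determine the orbit of a lattice vector: norms 1
    and -3 have two orbits each. The parity of the norm on the orthogonal complement ([even_perp])
    tells them apart, and it is forced to be even when A^2 + A + 1 vanishes there, because then
    <z,z> = -2 Re <Az,z>. Moreover J does not preserve the complement of (1,-1,0), so the descent at
    discriminant -8 needs another element, acting as s -> -1/(2s). The norms -1, -2, -3 come from
    the value at 1 of the quadratic factor X^2 - b X + d left once the eigenvalue at v is scaled to
    1. Its squared modulus is 1, 2, 4, 8, 9 or 16 and a multiple of <u,u>^2 for a generator u of the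
    lattice vectors on the line; in the case 16 the operator A + 1 gives 4 instead. *)

(* (a, b) stands for a + b i; matrices are stored by rows *)
Definition gi : Type := (int * int)%type.
Definition gv : Type := (gi * gi * gi)%type.
Definition gm : Type := (gv * gv * gv)%type.

Definition gint (a : int) : gi := (a, 0).
Definition gadd (x y : gi) : gi := (x.1 + y.1, x.2 + y.2).
Definition gopp (x : gi) : gi := (- x.1, - x.2).
Definition gmul (x y : gi) : gi :=
  (x.1 * y.1 - x.2 * y.2, x.1 * y.2 + x.2 * y.1).
Definition gconj (x : gi) : gi := (x.1, - x.2).
Definition gnorm (x : gi) : int := x.1 * x.1 + x.2 * x.2.

Definition gdot (x y : gv) : gi :=
  let: (x1, x2, x3) := x in let: (y1, y2, y3) := y in
  gadd (gadd (gmul x1 y1) (gmul x2 y2)) (gmul x3 y3).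

Definition gherm (v w : gv) : gi :=
  let: (w1, w2, w3) := w in gdot (gconj w3, gconj w2, gconj w1) v.

Definition gsq (v : gv) : int := (gherm v v).1.

Definition gscale (u : gi) (v : gv) : gv :=
  let: (a, b, c) := v in (gmul u a, gmul u b, gmul u c).

Definition gapp (A : gm) (v : gv) : gv :=
  let: (r1, r2, r3) := A in (gdot r1 v, gdot r2 v, gdot r3 v).

Definition gtr (A : gm) : gm :=
  let: ((a1, a2, a3), (b1, b2, b3), (c1, c2, c3)) := A in
  ((a1, b1, c1), (a2, b2, c2), (a3, b3, c3)).

Definition gmm (A B : gm) : gm :=
  let: (r1, r2, r3) := A in
  (gapp (gtr B) r1, gapp (gtr B) r2, gapp (gtr B) r3).

Definition gdiag (a b c : gi) : gm :=
  ((a, gint 0, gint 0), (gint 0, b, gint 0), (gint 0, gint 0, c)).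

Definition gid : gm := gdiag (gint 1) (gint 1) (gint 1).

Definition gJ : gm :=
  ((gint 0, gint 0, gint 1), (gint 0, gint 1, gint 0),
   (gint 1, gint 0, gint 0)).

(* J A^* J, the inverse of A when A is unitary *)
Definition ginv (A : gm) : gm :=
  let: ((a1, a2, a3), (b1, b2, b3), (c1, c2, c3)) := A in
  ((gconj c3, gconj b3, gconj a3), (gconj c2, gconj b2, gconj a2),
   (gconj c1, gconj b1, gconj a1)).

Definition gunit (A : gm) : bool :=
  (gmm (ginv A) A == gid) && (gmm A (ginv A) == gid).

Definition gu (u : gi) : bool := gnorm u == 1.

Lemma gu_cases (u : gi) : gu u ->
  [\/ u = (1, 0), u = (-1, 0), u = (0, 1) | u = (0, -1)].
Proof.
case: u => a b /eqP; rewrite /gnorm /= => e.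
have ha : -1 <= a <= 1 by nia.
have hb : -1 <= b <= 1 by nia.
have [ea|[ea|ea]] : a = 0 \/ a = 1 \/ a = -1 by lia.
- have [eb|eb] : b = 1 \/ b = -1 by nia.
    by apply: Or43; rewrite ea eb.
  by apply: Or44; rewrite ea eb.
- have eb : b = 0 by nia.
  by apply: Or41; rewrite ea eb.
have eb : b = 0 by nia.
by apply: Or42; rewrite ea eb.
Qed.

Lemma round_int (a m : int) : 0 < m -> exists k, - m <= 2 * (a - k * m) <= m.
Proof.
move=> m0; exists ((2 * a + m) %/ (2 * m))%Z.
have := divz_eq (2 * a + m) (2 * m).
have := modz_ge0 (2 * a + m) (_ : 2 * m != 0).
have := @ltz_pmod (2 * a + m) (2 * m) _.
set q := (_ %/ _)%Z; set r := (_ %% _)%Z.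
nia.
Qed.

Lemma gnorm_ge0 x : 0 <= gnorm x.
Proof. by rewrite /gnorm; nia. Qed.

Lemma gnorm0 x : gnorm x = 0 -> x = (0, 0).
Proof.
case: x => a b; rewrite /gnorm /= => e.
by have -> : a = 0 by [nia]; have -> : b = 0 by nia.
Qed.

Lemma gnormM x y : gnorm (gmul x y) = gnorm x * gnorm y.
Proof. by rewrite /gnorm /=; ring. Qed.

(** Both coordinates of x/y are rounded to nearest integers; each error is at most 1/2, whence the
    factor 2 in the bound on the remainder. *)
Lemma ground (x y : gi) : y <> (0, 0) ->
  exists q, 2 * gnorm (gadd x (gmul q y)) <= gnorm y.
Proof.
move=> y0; have N0 : 0 < gnorm y.
  rewrite lt_neqAle gnorm_ge0 andbT eq_sym; apply/eqP => /gnorm0; exact: y0.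
pose t := gmul x (gconj y).
have [k1 h1] := round_int t.1 N0.
have [k2 h2] := round_int t.2 N0.
exists (- k1, - k2).
have : gnorm (gadd x (gmul (- k1, - k2) y)) * gnorm y =
   (t.1 - k1 * gnorm y) * (t.1 - k1 * gnorm y) +
   (t.2 - k2 * gnorm y) * (t.2 - k2 * gnorm y).
  rewrite /t /gnorm /=; ring.
set n := gnorm _ in N0 h1 h2 *; set z := gnorm _; nia.
Qed.

Ltac gcomp := rewrite /gmm /gapp /ginv /gtr /gid /gdiag /gherm /gscale /gdot
  /gconj /gadd /gmul /gint /=; repeat (congr pair); ring.

Lemma gappM (A B : gm) v : gapp (gmm A B) v = gapp A (gapp B v).
Proof.
case: A => [[[[a1 a2] a3] [[b1 b2] b3]] [[c1 c2] c3]].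
case: B => [[[[d1 d2] d3] [[e1 e2] e3]] [[f1 f2] f3]].
case: v => [[v1 v2] v3]; gcomp.
Qed.

Lemma gtrM (A B : gm) : gtr (gmm A B) = gmm (gtr B) (gtr A).
Proof.
case: A => [[[[a1 a2] a3] [[b1 b2] b3]] [[c1 c2] c3]].
case: B => [[[[d1 d2] d3] [[e1 e2] e3]] [[f1 f2] f3]]; gcomp.
Qed.

Lemma gmmA (A B D : gm) : gmm A (gmm B D) = gmm (gmm A B) D.
Proof. by case: A => [[r1 r2] r3]; rewrite /gmm gtrM !gappM. Qed.

Lemma gmm1 (A : gm) : gmm A gid = A.
Proof.
case: A => [[[[[a1 a1'] [a2 a2']] [a3 a3']] [[[b1 b1'] [b2 b2']] [b3 b3']]]
  [[[c1 c1'] [c2 c2']] [c3 c3']]]; gcomp.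
Qed.

Lemma gmm1l (A : gm) : gmm gid A = A.
Proof.
case: A => [[[[[a1 a1'] [a2 a2']] [a3 a3']] [[[b1 b1'] [b2 b2']] [b3 b3']]]
  [[[c1 c1'] [c2 c2']] [c3 c3']]]; gcomp.
Qed.

Lemma gapp1 v : gapp gid v = v.
Proof. by case: v => [[[v1 v1'] [v2 v2']] [v3 v3']]; gcomp. Qed.

Lemma ginvM (A B : gm) : ginv (gmm A B) = gmm (ginv B) (ginv A).
Proof.
case: A => [[[[a1 a2] a3] [[b1 b2] b3]] [[c1 c2] c3]].
case: B => [[[[d1 d2] d3] [[e1 e2] e3]] [[f1 f2] f3]]; gcomp.
Qed.

Lemma ginvK (A : gm) : ginv (ginv A) = A.
Proof.
case: A => [[[[[a1 a1'] [a2 a2']] [a3 a3']] [[[b1 b1'] [b2 b2']] [b3 b3']]]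
  [[[c1 c1'] [c2 c2']] [c3 c3']]]; gcomp.
Qed.

Lemma gunitP A : reflect (gmm (ginv A) A = gid /\ gmm A (ginv A) = gid) (gunit A).
Proof. by apply: (iffP andP) => -[/eqP ? /eqP]. Qed.

Lemma gunitM A B : gunit A -> gunit B -> gunit (gmm A B).
Proof.
move=> /gunitP[a1 a2] /gunitP[b1 b2]; apply/gunitP; split; rewrite ginvM.
  by rewrite gmmA -(gmmA (ginv B)) a1 gmm1 b1.
by rewrite gmmA -(gmmA A) b2 gmm1 a2.
Qed.

Lemma gunitV A : gunit A -> gunit (ginv A).
Proof. by move=> /gunitP[a1 a2]; apply/gunitP; rewrite ginvK. Qed.

Lemma gunit1 : gunit gid.
Proof. by vm_compute. Qed.

Lemma gherm_app A v w : gherm (gapp A v) w = gherm v (gapp (ginv A) w).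
Proof.
case: A => [[[[a1 a2] a3] [[b1 b2] b3]] [[c1 c2] c3]].
case: v => [[v1 v2] v3]; case: w => [[w1 w2] w3]; gcomp.
Qed.

Lemma gherm_unit A v w : gunit A -> gherm (gapp A v) (gapp A w) = gherm v w.
Proof. by move=> /gunitP[a1 _]; rewrite gherm_app -gappM a1 gapp1. Qed.

Lemma gsq_unit A v : gunit A -> gsq (gapp A v) = gsq v.
Proof. by move=> uA; rewrite /gsq gherm_unit. Qed.

Lemma gappK A v : gunit A -> gapp (ginv A) (gapp A v) = v.
Proof. by move=> /gunitP[a1 _]; rewrite -gappM a1 gapp1. Qed.

Lemma gunit_diag u t : gu u -> gu t -> gunit (gdiag u t u).
Proof.
by move=> /gu_cases [] -> /gu_cases [] ->; vm_compute.
Qed.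

Definition geqv (v w : gv) : Prop := exists2 A, gunit A & gapp A v = w.

Lemma geqv_refl v : geqv v v.
Proof. by exists gid; rewrite ?gunit1 ?gapp1. Qed.

Lemma geqv_sym v w : geqv v w -> geqv w v.
Proof.
by move=> [A uA <-]; exists (ginv A); rewrite ?gunitV// gappK.
Qed.

Lemma geqv_trans v w x : geqv v w -> geqv w x -> geqv v x.
Proof.
by move=> [A uA <-] [B uB <-]; exists (gmm B A); rewrite ?gunitM// gappM.
Qed.

Lemma geqv_gsq v w : geqv v w -> gsq v = gsq w.
Proof. by move=> [A uA <-]; rewrite gsq_unit. Qed.

(** The Heisenberg translation with horizontal part tau = (1+i) q and vertical part [m]. The factor
    1+i makes |tau|^2 / 2 = |q|^2 an integer, so that all entries are Gaussian. *)
Definition gtrans (q : gi) (m : int) : gm :=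
  ((gint 1, gopp (gmul (1, -1) (gconj q)), (- gnorm q, m)),
   (gint 0, gint 1, gmul (1, 1) q), (gint 0, gint 0, gint 1)).

Lemma gunit_trans q m : gunit (gtrans q m).
Proof.
case: q => a b; apply/gunitP.
by split; rewrite /gtrans /gopp /gnorm; gcomp.
Qed.

Lemma gunit_J : gunit gJ.
Proof. by vm_compute. Qed.

(** Translations change v2 by multiples of (1+i) v3, which leaves a remainder of norm at most half
    of 2 |v3|^2. Vertical translations then change Im(v1 conj(v3)) by multiples of |v3|^2 and leave
    the middle coordinate alone. *)
Lemma greduce (v : gv) : v.2 <> (0, 0) -> exists w, 
  [/\ geqv v w, w.2 = v.2, gnorm w.1.2 <= gnorm v.2 &
      - gnorm v.2 <= 2 * (gmul w.1.1 (gconj w.2)).2 <= gnorm v.2].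
Proof.
case: v => [[v1 v2] v3] /= v3n0.
have v3n0' : gmul (1, 1) v3 <> (0, 0).
  move=> /(congr1 gnorm); rewrite gnormM => h; apply: v3n0; apply: gnorm0.
  by move: h; rewrite /gnorm /=; lia.
have [q hq] := ground v2 v3n0'.
have N0 : 0 < gnorm v3.
  rewrite lt_neqAle gnorm_ge0 andbT eq_sym; apply/eqP => /gnorm0; exact: v3n0.
pose u := gapp (gtrans q 0) (v1, v2, v3).
have [k hk] := round_int (gmul u.1.1 (gconj v3)).2 N0.
exists (gapp (gtrans q (- k)) (v1, v2, v3)).
have e3 : (gapp (gtrans q (- k)) (v1, v2, v3)).2 = v3.
  by case: v3 {v3n0 v3n0' hq N0 u hk} => a b; rewrite /gtrans; gcomp.
split.
- by exists (gtrans q (- k)); rewrite ?gunit_trans.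
- exact: e3.
- move: hq; rewrite gnormM.
  suff -> : gadd v2 (gmul q (gmul (1, 1) v3)) =
    (gapp (gtrans q (- k)) (v1, v2, v3)).1.2 by rewrite /gnorm /=; lia.
  by case: v2 {u hk e3} => a b; rewrite /gtrans; gcomp.
have e : (gmul (gapp (gtrans q (- k)) (v1, v2, v3)).1.1 (gconj v3)).2 =
  (gmul u.1.1 (gconj v3)).2 - k * gnorm v3.
  rewrite /u /gtrans /gnorm /gopp /gapp /gdot /gadd /gmul /gconj /=; ring.
by rewrite e3; move: hk; rewrite -e.
Qed.

(* |2 v1 conj(v3)|^2 split into real and imaginary parts *)
Lemma gheight (v : gv) :
  4 * gnorm v.1.1 * gnorm v.2 =
  (gsq v - gnorm v.1.2) * (gsq v - gnorm v.1.2) +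
  (2 * (gmul v.1.1 (gconj v.2)).2) * (2 * (gmul v.1.1 (gconj v.2)).2).
Proof.
case: v => [[v1 v2] v3]; rewrite /gsq /gherm /gdot /gnorm /gadd /gmul /gconj /=.
ring.
Qed.

Lemma geqv_swap v1 v2 v3 : geqv (v1, v2, v3) (v3, v2, v1).
Proof.
exists gJ; first exact: gunit_J.
by case: v1 v2 v3 => [? ?] [? ?] [? ?]; rewrite /gJ; gcomp.
Qed.

Lemma gu_conj u : gu u -> gu (gconj u) /\ gmul (gconj u) u = gint 1.
Proof. by move=> /gu_cases [] ->; vm_compute. Qed.

Lemma gunitary_norm1 (x : gi) : gnorm x = 1 -> exists2 t, gu t & gmul t x = (1, 0).
Proof. by move=> /eqP /gu_conj [? e]; exists (gconj x). Qed.

Lemma geqv_scale u v : gu u -> geqv v (gscale u v).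
Proof.
move=> uu; exists (gdiag u u u); first exact: gunit_diag.
case: u v {uu} => [u u'] [[[v1 v1'] [v2 v2']] [v3 v3']]; gcomp.
Qed.

Lemma geqv_mid t v1 v2 v3 : gu t -> geqv (v1, v2, v3) (v1, gmul t v2, v3).
Proof.
move=> uu; exists (gdiag (1, 0) t (1, 0)); first exact: gunit_diag.
case: t v1 v2 v3 {uu} => [u u'] [v1 v1'] [v2 v2'] [v3 v3']; gcomp.
Qed.

Lemma gnorm_le1 x : gnorm x <= 1 -> x = (0, 0) \/ gnorm x = 1.
Proof.
move=> h; have := gnorm_ge0 x => h0.
have [e|e] : gnorm x = 0 \/ gnorm x = 1 by lia.
  by left; apply: gnorm0.
by right.
Qed.

Lemma gnorm2 x : gnorm x = 2 -> exists2 t, gu t & x = gmul (1, 1) t.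
Proof.
case: x => a b; rewrite /gnorm /= => h.
have ha' : -1 <= a <= 1 by nia.
have hb' : -1 <= b <= 1 by nia.
have ha : a = 1 \/ a = -1.
  by have [e|] : a = 0 \/ (a = 1 \/ a = -1) by [lia]; first by rewrite e in h; nia.
have hb : b = 1 \/ b = -1.
  by have [e|] : b = 0 \/ (b = 1 \/ b = -1) by [lia]; first by rewrite e in h; nia.
case: ha hb => -> [] ->.
- by exists (1, 0).
- by exists (0, -1).
- by exists (0, 1).
- by exists (-1, 0).
Qed.

Lemma geqv_lead1 v : gnorm v.2 = 1 -> exists w1 w2,
  [/\ geqv v (w1, w2, (1, 0)), w2 = (0, 0) \/ w2 = (1, 0) & -1 <= 2 * w1.2 <= 1].
Proof.
move=> h; have v3n : v.2 <> (0, 0) by move=> e; rewrite e in h.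
have [[[w1 w2] w3] /= [e1 e2 e3 e4]] := greduce v3n.
rewrite e2 h in e3 e4.
have [t ut et] := gunitary_norm1 h.
have e5 := geqv_scale (w1, w2, v.2) ut.
rewrite /gscale et in e5; rewrite e2 in e1.
have g : gnorm (gmul t w2) <= 1 by rewrite gnormM (eqP ut) mul1r.
(* [t] inverts the unit [v.2], so it is its conjugate, and the bound of [greduce] becomes a bound on
   Im(t w1). *)
have im : (gmul t w1).2 = (gmul w1 (gconj v.2)).2.
  move: ut et h; case: (v.2) => a b; case: t {e5 g} => c d; case: w1 {e1 e4} => x y.
  rewrite /gu /gnorm /gmul /gconj /= => /eqP p [q r] s.
  have h1 : c * (a * a + b * b) = c by rewrite s mulr1.
  have h2 : d * (a * a + b * b) = d by rewrite s mulr1.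
  have h3 : a * (c * a - d * b) = a by rewrite q mulr1.
  have h4 : b * (c * a - d * b) = b by rewrite q mulr1.
  have h5 : a * (c * b + d * a) = 0 by rewrite r mulr0.
  have h6 : b * (c * b + d * a) = 0 by rewrite r mulr0.
  have -> : c = a by lia.
  have -> : d = - b by lia.
  by ring.
have {}e1 := geqv_trans e1 e5.
case: (gnorm_le1 g) => [z|z].
  by exists (gmul t w1), (0, 0); rewrite -{1}z im; split; [|left|].
have [s us es] := gunitary_norm1 z.
exists (gmul t w1), (1, 0); rewrite im; split; [|by right|by []].
by apply: (geqv_trans e1); rewrite -es; apply: geqv_mid.
Qed.

Lemma gnorm_ind (P : gv -> Prop) :
  (forall v, (forall w, gnorm w.2 < gnorm v.2 -> P w) -> P v) -> forall v, P v.
Proof.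
move=> H v; move: {2}(`|gnorm v.2|)%N (leqnn `|gnorm v.2|) => n.
elim: n v => [|n IH] v hv; apply: H => w hw.
  by have := gnorm_ge0 w.2; lia.
by apply: IH; have := gnorm_ge0 w.2; lia.
Qed.

Lemma gneg_lead (v : gv) : gsq v < 0 -> v.2 <> (0, 0).
Proof.
case: v => [[[v1 v1'] [v2 v2']] [v3 v3']] /= h [e1 e2]; move: h.
by rewrite e1 e2 /gsq /gherm /gdot /gadd /gmul /gconj /=; nia.
Qed.

(** Write N = |v3|^2. For a reduced vector [gheight] gives 4 |w1|^2 N <= (N+1)^2 + N^2, which is
    below 4 N^2 for N >= 2, so exchanging the outer coordinates lowers N. *)
Lemma norm_m1 v : gsq v = -1 -> geqv v ((-1, 0), (1, 0), (1, 0)).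
Proof.
elim/gnorm_ind: v => v IH hv.
have v3n : v.2 <> (0, 0) by apply: gneg_lead; lia.
have N0 : 0 < gnorm v.2.
  by rewrite lt_neqAle gnorm_ge0 andbT eq_sym; apply/eqP => /gnorm0.
have [N1|N2] : gnorm v.2 = 1 \/ 2 <= gnorm v.2 by lia.
  have [[a b] [w2 [e e2 e3]]] := geqv_lead1 N1.
  have := geqv_gsq e; rewrite hv.
  rewrite /= in e3; case: e2 e => -> e; rewrite /gsq /gherm /gdot /gadd /gmul /gconj /= => h.
    by lia.
  by apply: (geqv_trans e); have -> : a = -1 by [lia]; have -> : b = 0 by [lia];
     exact: geqv_refl.
have [[[w1 w2] w3] /= [e1 e2 e3 e4]] := greduce v3n.
have e5 := geqv_trans e1 (geqv_swap _ _ _).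
apply: (geqv_trans e5); apply: IH; last by rewrite -(geqv_gsq e5).
have := gheight (w1, w2, w3); rewrite -(geqv_gsq e1) hv /= e2.
move: e3 e4 (gnorm_ge0 w1) (gnorm_ge0 w2) N2; rewrite e2.
move: (w1.1 * - v.2.2 + _) (gnorm w1) (gnorm w2) (gnorm v.2) => y a q N.
by move=> h1 h2 a0 q0 N2 h; nia.
Qed.

(** For N >= 2 the estimate (N+2)^2 + N^2 < 4 N^2 fails only at N = 2. There the descent stalls only
    if all three coordinates have norm 2, hence are divisible by 1+i. *)
Lemma norm_m2 v : gsq v = -2 -> geqv v ((-1, 0), (0, 0), (1, 0)) \/
  exists2 w, v = gscale (1, 1) w & gsq w = -1.
Proof.
elim/gnorm_ind: v => v IH hv.
have v3n : v.2 <> (0, 0) by apply: gneg_lead; lia.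
have N0 : 0 < gnorm v.2.
  by rewrite lt_neqAle gnorm_ge0 andbT eq_sym; apply/eqP => /gnorm0.
have pull (w : gv) (e : geqv v w) : (geqv w ((-1, 0), (0, 0), (1, 0)) \/
    exists2 w', w = gscale (1, 1) w' & gsq w' = -1) ->
  geqv v ((-1, 0), (0, 0), (1, 0)) \/ exists2 w, v = gscale (1, 1) w & gsq w = -1.
  case=> [e'|[w' ew hw]]; [left; exact: geqv_trans e e'|right].
  have [A uA eA] := geqv_sym e; exists (gapp A w').
    rewrite -eA ew; case: A w' {uA eA ew hw} => [[[[a1 a2] a3] [[b1 b2] b3]] [[c1 c2] c3]].
    by move=> [[x y] z]; gcomp.
  by rewrite gsq_unit.
have [N1|N2] : gnorm v.2 = 1 \/ 2 <= gnorm v.2 by lia.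
  have [[a b] [w2 [e e2 e3]]] := geqv_lead1 N1.
  have := geqv_gsq e; rewrite hv.
  rewrite /= in e3; case: e2 e => -> e; rewrite /gsq /gherm /gdot /gadd /gmul /gconj /= => h.
    left; apply: (geqv_trans e); have -> : a = -1 by lia.
    by have -> : b = 0 by [lia]; exact: geqv_refl.
  by lia.
have [[[w1 w2] w3] /= [e1 e2 e3 e4]] := greduce v3n.
have e5 := geqv_trans e1 (geqv_swap _ _ _).
have gh := gheight (w1, w2, w3); rewrite -(geqv_gsq e1) hv /= e2 in gh.
have [lt|ge] := ltP (gnorm w1) (gnorm v.2).
  by apply: (pull _ e5); apply: IH => //=; rewrite -(geqv_gsq e5).
have : gnorm v.2 = 2 /\ gnorm w2 = 2.
  move: e3 e4 (gnorm_ge0 w1) (gnorm_ge0 w2) N2 gh ge; rewrite e2.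
  move: (w1.1 * - v.2.2 + _) (gnorm w1) (gnorm w2) (gnorm v.2) => y a q N.
  move=> h1 h2 a0 q0 N2 h ge; have N3 : N <= 2 by nia.
  by have eN : N = 2 by [lia]; split=> //; subst N; nia.
(* Here 8 |w1|^2 = 16 + 4 y^2 with |y| <= 1, and 20 is not a multiple of 8. *)
case=> N2' q2; have q1 : gnorm w1 = 2.
  move: e4 gh; rewrite e2 N2' q2 /= => e4 gh; set y := _ + _ in e4 gh.
  have hy : -1 <= y <= 1 by lia.
  have [ey|[ey|ey]] : y = 0 \/ y = 1 \/ y = -1 by [lia]; rewrite ey in gh; lia.
rewrite -e2 in N2'.
have [d1 _ f1] := gnorm2 q1; have [d2 _ f2] := gnorm2 q2; have [d3 _ f3] := gnorm2 N2'.
apply: (pull _ e1); right; exists (d1, d2, d3); first by rewrite /gscale -f1 -f2 -f3.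
move: (geqv_gsq e1); rewrite hv f1 f2 f3.
case: d1 d2 d3 {f1 f2 f3} => [? ?] [? ?] [? ?].
rewrite /gsq /gherm /gdot /gadd /gmul /gconj /=; lia.
Qed.

Lemma sum_sq4 (a b : int) : a * a + b * b = 4 -> exists k, a = 2 * k.
Proof.
move=> h; have ha : -2 <= a <= 2 by nia.
have [e|[e|[e|e]]] : a = 2 \/ a = -2 \/ a = 0 \/ (a = 1 \/ a = -1) by lia.
- by exists 1; rewrite e.
- by exists (-1); rewrite e.
- by exists 0; rewrite e.
- have hb : -2 <= b <= 2 by nia.
  have [f|[f|f]] : b * b = 4 \/ b * b = 1 \/ b * b = 0.
    have : b = 0 \/ b = 1 \/ b = -1 \/ b = 2 \/ b = -2 by lia.
    by case=> [->|[->|[->|[->|->]]]]; lia.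
  all: by case: e => e; rewrite e in h; lia.
Qed.

Lemma gnorm_neq3 x : gnorm x <> 3.
Proof.
case: x => a b; rewrite /gnorm /= => h.
have ha : -1 <= a <= 1 by nia.
have hb : -1 <= b <= 1 by nia.
by nia.
Qed.

(** The estimate (N+3)^2 + N^2 < 4 N^2 leaves N = 2, 3, 4 besides N = 1. Norm 3 does not occur. If N
    = 4, the last coordinate is even, so |w2|^2 is 1 modulo 4, hence 1, and the first coordinate is
    shorter. What remains is N = 2 with |w2| = 1, the second orbit. *)
Lemma norm_m3 v : gsq v = -3 -> geqv v ((-2, 0), (1, 0), (1, 0)) \/
  geqv v ((-1, -1), (1, 0), (1, 1)).
Proof.
elim/gnorm_ind: v => v IH hv.
have v3n : v.2 <> (0, 0) by apply: gneg_lead; lia.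
have N0 : 0 < gnorm v.2.
  by rewrite lt_neqAle gnorm_ge0 andbT eq_sym; apply/eqP => /gnorm0.
have pull (w : gv) (e : geqv v w) : (geqv w ((-2, 0), (1, 0), (1, 0)) \/
    geqv w ((-1, -1), (1, 0), (1, 1))) ->
  geqv v ((-2, 0), (1, 0), (1, 0)) \/ geqv v ((-1, -1), (1, 0), (1, 1)).
  by case=> e'; [left|right]; exact: geqv_trans e e'.
have [N1|N2] : gnorm v.2 = 1 \/ 2 <= gnorm v.2 by lia.
  have [[a b] [w2 [e e2 e3]]] := geqv_lead1 N1.
  have := geqv_gsq e; rewrite hv.
  rewrite /= in e3; case: e2 e => -> e; rewrite /gsq /gherm /gdot /gadd /gmul /gconj /= => h.
    by lia.
  left; apply: (geqv_trans e); have -> : a = -2 by lia.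
  by have -> : b = 0 by [lia]; exact: geqv_refl.
have [[[w1 w2] w3] /= [e1 e2 e3 e4]] := greduce v3n.
have e5 := geqv_trans e1 (geqv_swap _ _ _).
have gh := gheight (w1, w2, w3); rewrite -(geqv_gsq e1) hv /= e2 in gh.
have [lt|ge] := ltP (gnorm w1) (gnorm v.2).
  by apply: (pull _ e5); apply: IH => //=; rewrite -(geqv_gsq e5).
have sq := geqv_gsq e1; rewrite hv in sq.
have N4 : gnorm v.2 <= 4.
  move: e3 e4 (gnorm_ge0 w1) (gnorm_ge0 w2) N2 gh ge; rewrite e2.
  move: (w1.1 * - v.2.2 + _) (gnorm w1) (gnorm w2) (gnorm v.2) => y a q N.
  by move=> h1 h2 a0 q0 N2 h ge; nia.
have N2' : gnorm v.2 = 2 /\ gnorm w2 = 1.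
  have : 2 * (gmul w1 (gconj w3)).1 = -3 - gnorm w2.
    move: sq; case: w1 w2 w3 {e1 e2 e3 e4 e5 gh ge} => [? ?] [? ?] [? ?].
    rewrite /gsq /gherm /gnorm /gdot /gadd /gmul /gconj /=; lia.
  have : gnorm v.2 = 4 -> exists k, (gmul w1 (gconj w3)).1 = 2 * k.
    rewrite -e2; case: w3 {e1 e2 e3 e4 e5 gh ge sq} => a b; rewrite /gnorm /= => h.
    have [k ->] := sum_sq4 h.
    have [k' ->] : exists k', b = 2 * k' by apply: (@sum_sq4 b a); lia.
    by exists (w1.1 * k + w1.2 * k'); lia.
  move: (@gnorm_neq3 v.2) e3 e4 (gnorm_ge0 w1) (gnorm_ge0 w2) N2 N4 gh ge; rewrite e2 /=.
  move: (w1.1 * - v.2.2 + _) (w1.1 * _ - _) (gnorm w1) (gnorm w2) (gnorm v.2) => y r a q N.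
  move=> n3 h1 h2 a0 q0 N2 N4 h ge h4 hr.
  have [e|[e|e]] : N = 2 \/ N = 3 \/ N = 4 by [lia]; subst N.
  - by split=> //; nia.
  - by [].
  - have [k hk] := h4 erefl; exfalso.
    have : q = 1 \/ q = 3 \/ q = 0 \/ q = 2 \/ q = 4 by lia.
    by case=> [|[|[|[|]]]] eq; subst q; nia.
case: N2' => N2' q2.
have r0 : (gmul w1 (gconj w3)).1 = -2.
  move: sq q2; case: w1 w2 w3 {e1 e2 e3 e4 e5 gh ge} => [? ?] [? ?] [? ?].
  rewrite /gsq /gherm /gnorm /gdot /gadd /gmul /gconj /=; lia.
have y0 : (gmul w1 (gconj w3)).2 = 0.
  move: e4 gh; rewrite e2 N2' q2 /= => e4 gh; set y := _ + _ in e4 gh *.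
  have hy : -1 <= y <= 1 by lia.
  by have [ey|[ey|ey]] : y = 0 \/ y = 1 \/ y = -1 by [lia]; rewrite ey in gh; lia.
apply: (pull _ e1); right.
rewrite -e2 in N2'; have [d ud f3] := gnorm2 N2'.
have [ud' ed'] := gu_conj ud.
apply: (geqv_trans (geqv_scale _ ud')); rewrite /gscale.
have -> : gmul (gconj d) w3 = (1, 1).
  rewrite f3; move: ed'; case: (d) => x y; rewrite /gmul /gconj /gint /= => -[p q].
  by congr pair; lia.
have -> : gmul (gconj d) w1 = (-1, -1).
  move: r0 y0; rewrite f3; have := gu_cases ud.
  case: (w1) => x y [] ->; rewrite /gmul /gconj /= => p q; congr pair; lia.
have [s us es] : exists2 s, gu s & gmul s (gmul (gconj d) w2) = (1, 0).
  by apply: gunitary_norm1; rewrite gnormM (eqP ud') mul1r.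
by rewrite -es; apply: geqv_mid.
Qed.

(** If v3 = 0, translations move v1 modulo 1-i and leave 0 or a unit: these are the two orbits. If
    not, (1 - |w2|^2)^2 + N^2 < 4 N^2 and the exchange of outer coordinates lowers N. *)
Lemma norm_p1 v : gsq v = 1 -> geqv v ((0, 0), (1, 0), (0, 0)) \/
  geqv v ((1, 0), (-1, 0), (0, 0)).
Proof.
elim/gnorm_ind: v => v IH hv.
have pull (w : gv) (e : geqv v w) : (geqv w ((0, 0), (1, 0), (0, 0)) \/
  geqv w ((1, 0), (-1, 0), (0, 0))) -> geqv v ((0, 0), (1, 0), (0, 0)) \/
  geqv v ((1, 0), (-1, 0), (0, 0)).
  by case=> e'; [left|right]; exact: geqv_trans e e'.
have [v30|/eqP v3n] := eqVneq v.2 (0, 0).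
  case: v {IH} v30 hv pull => [[v1 v2] v3] /= -> hv pull.
  have n2 : gnorm v2 = 1.
    by move: hv; case: v1 v2 {pull} => [? ?] [? ?]; 
       rewrite /gsq /gherm /gdot /gnorm /gadd /gmul /gconj /=; lia.
  have [t ut et] := gunitary_norm1 n2.
  have e1 := geqv_mid v1 v2 (0, 0) ut; rewrite et in e1.
  have [q hq] : exists q, 2 * gnorm (gadd v1 (gmul q (1, -1))) <= gnorm (1, -1).
    by apply: ground.
  pose x := gadd v1 (gmul q (1, -1)).
  have e2 : geqv (v1, (1, 0), (0, 0)) (x, (1, 0), (0, 0)).
    exists (gtrans (gopp (gconj q)) 0); first exact: gunit_trans.
    by rewrite /x; case: v1 q {hq x hv pull e1} => [? ?] [? ?]; rewrite /gtrans /gopp; gcomp.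
  have e3 := geqv_trans e1 e2; apply: (pull _ e3).
  have hx : gnorm x <= 1 by rewrite /x; move: hq; rewrite [X in _ <= X]/gnorm /=; lia.
  case: (gnorm_le1 hx) => [->|nx]; first by left; exact: geqv_refl.
  right; have [s us es] := gunitary_norm1 nx.
  exists (gdiag s (-1, 0) s); first exact: gunit_diag.
  transitivity ((gmul s x, (-1, 0), (0, 0)) : gv); last by rewrite es.
  by case: (s) (x) => [? ?] [? ?]; gcomp.
have N0 : 0 < gnorm v.2.
  by rewrite lt_neqAle gnorm_ge0 andbT eq_sym; apply/eqP => /gnorm0.
have [[[w1 w2] w3] /= [e1 e2 e3 e4]] := greduce v3n.
have e5 := geqv_trans e1 (geqv_swap _ _ _).
apply: (pull _ e5); apply: IH; last by rewrite -(geqv_gsq e5).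
have := gheight (w1, w2, w3); rewrite -(geqv_gsq e1) hv /= e2.
move: e3 e4 (gnorm_ge0 w1) (gnorm_ge0 w2) N0; rewrite e2.
move: (w1.1 * - v.2.2 + _) (gnorm w1) (gnorm w2) (gnorm v.2) => y a q N.
by move=> h1 h2 a0 q0 N2 h; nia.
Qed.

(** If v3 = 0, then |v2|^2 = 3, which is impossible. For N >= 2 the bound (3 - |w2|^2)^2 + N^2 < 4
    N^2 makes the descent work. *)
Lemma norm_p3 v : gsq v = 3 -> geqv v ((1, 0), (1, 0), (1, 0)).
Proof.
elim/gnorm_ind: v => v IH hv.
have v3n : v.2 <> (0, 0).
  case: v {IH} hv => [[[? ?] [a b]] [? ?]] /= hv [e1 e2]; move: hv; rewrite e1 e2.
  rewrite /gsq /gherm /gdot /gnorm /gadd /gmul /gconj /= => h.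
  have h' : a * a + b * b = 3 by lia.
  by apply: (@gnorm_neq3 (a, b)); rewrite /gnorm /=; lia.
have N0 : 0 < gnorm v.2.
  by rewrite lt_neqAle gnorm_ge0 andbT eq_sym; apply/eqP => /gnorm0.
have [N1|N2] : gnorm v.2 = 1 \/ 2 <= gnorm v.2 by lia.
  have [[a b] [w2 [e e2 e3]]] := geqv_lead1 N1.
  have := geqv_gsq e; rewrite hv.
  rewrite /= in e3; case: e2 e => -> e; rewrite /gsq /gherm /gdot /gadd /gmul /gconj /= => h.
    by lia.
  apply: (geqv_trans e); have -> : a = 1 by lia.
  by have -> : b = 0 by [lia]; exact: geqv_refl.
have [[[w1 w2] w3] /= [e1 e2 e3 e4]] := greduce v3n.
have e5 := geqv_trans e1 (geqv_swap _ _ _).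
apply: (geqv_trans e5); apply: IH; last by rewrite -(geqv_gsq e5).
have := gheight (w1, w2, w3); rewrite -(geqv_gsq e1) hv /= e2.
move: e3 e4 (gnorm_ge0 w1) (gnorm_ge0 w2) N2; rewrite e2.
move: (w1.1 * - v.2.2 + _) (gnorm w1) (gnorm w2) (gnorm v.2) => y a q N.
by move=> h1 h2 a0 q0 N2 h; nia.
Qed.

(** An orbit invariant for use where the norm is too coarse: it holds for (0,1,0) and fails for
    (1,-1,0), (1,1,1) and (-2,1,1), whose complements contain vectors of norm 1. *)
Definition even_perp (w : gv) : Prop :=
  forall y, gherm y w = (0, 0) -> exists k, gsq y = 2 * k.

Lemma even_perp_geqv v w : geqv v w -> even_perp v -> even_perp w.
Proof.
move=> [A uA <-] h y hy; rewrite -(gsq_unit y (gunitV uA)); apply: h.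
by rewrite gherm_app ginvK.
Qed.

(** * Complex coordinates *)

Definition i0 : 'I_3 := @Ordinal 3 0 isT.
Definition i1 : 'I_3 := @Ordinal 3 1 isT.
Definition i2 : 'I_3 := @Ordinal 3 2 isT.

Lemma ord3P (P : 'I_3 -> Prop) : P i0 -> P i1 -> P i2 -> forall i, P i.
Proof.
move=> p0 p1 p2 [[|[|[|m]]] h] //; [move: p0|move: p1|move: p2];
 by congr P; apply: val_inj.
Qed.

Lemma sum3 (V : nmodType) (F : 'I_3 -> V) : \sum_(i < 3) F i = F i0 + F i1 + F i2.
Proof.
rewrite !big_ord_recr big_ord0 /= add0r.
by congr (F _ + F _ + F _); apply: val_inj.
Qed.

Section Coordinates.
Variable R : realType.
Local Notation K := (C R).
Local Notation vec := (@vec3 R).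

Lemma vec3E (a b c : K) : (vec a b c i0 0 = a) * (vec a b c i1 0 = b) * (vec a b c i2 0 = c).
Proof. by rewrite /vec3 !mxE. Qed.

Lemma vecP (v w : 'cV[K]_3) :
  v i0 0 = w i0 0 -> v i1 0 = w i1 0 -> v i2 0 = w i2 0 -> v = w.
Proof. by move=> *; apply/matrixP => i j; rewrite ord1; elim/ord3P: i. Qed.

Lemma appE (A : 'M[K]_3) (v : 'cV[K]_3) i :
  (A *m v) i 0 = A i i0 * v i0 0 + A i i1 * v i1 0 + A i i2 * v i2 0.
Proof. by rewrite mxE sum3. Qed.

Lemma hermE (v w : 'cV[K]_3) : herm v w =
  (w i2 0)^* * v i0 0 + (w i1 0)^* * v i1 0 + (w i0 0)^* * v i2 0.
Proof.
by rewrite /herm mxE sum3 !mxE !sum3 !mxE /=; ring.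
Qed.

Lemma hermDl (u v w : 'cV[K]_3) : herm (u + v) w = herm u w + herm v w.
Proof. by rewrite !hermE !mxE; ring. Qed.

Lemma hermZl a (v w : 'cV[K]_3) : herm (a *: v) w = a * herm v w.
Proof. by rewrite !hermE !mxE; ring. Qed.

Lemma hermNl (v w : 'cV[K]_3) : herm (- v) w = - herm v w.
Proof. by rewrite !hermE !mxE; ring. Qed.

Lemma hermC (v w : 'cV[K]_3) : herm w v = (herm v w)^*.
Proof. by rewrite !hermE !rmorphD !rmorphM /= !conjCK; ring. Qed.

Lemma hermDr (u v w : 'cV[K]_3) : herm u (v + w) = herm u v + herm u w.
Proof. by rewrite !hermE !mxE !rmorphD /=; ring. Qed.

Lemma hermZr a (v w : 'cV[K]_3) : herm v (a *: w) = a^* * herm v w.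
Proof. by rewrite !hermE !mxE !rmorphM /=; ring. Qed.

Lemma hermNr (v w : 'cV[K]_3) : herm v (- w) = - herm v w.
Proof. by rewrite !hermE !mxE !rmorphN /=; ring. Qed.

Lemma herm0l (v : 'cV[K]_3) : herm 0 v = 0.
Proof. by rewrite hermE !mxE; ring. Qed.

Lemma herm_real (v : 'cV[K]_3) : herm v v \is Num.real.
Proof. by rewrite CrealE -hermC. Qed.

Lemma herm_sym0 (v w : 'cV[K]_3) : herm v w = 0 -> herm w v = 0.
Proof. by move=> h; rewrite hermC h rmorph0. Qed.

Lemma herm_UJ (A : 'M[K]_3) (v w : 'cV[K]_3) : UJ A -> herm (A *m v) (A *m w) = herm v w.
Proof.
rewrite /UJ /= => h; rewrite /herm.
have -> : (A *m w) ^t* = w ^t* *m A ^t* by rewrite trmx_mul map_mxM.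
by rewrite -(mulmxA (w ^t*)) -(mulmxA (w ^t*)) (mulmxA _ A) h mulmxA.
Qed.

Definition gauss (x : gi) : K := x.1%:~R + x.2%:~R * 'i.
Definition gauss_vec (v : gv) : 'cV[K]_3 := vec (gauss v.1.1) (gauss v.1.2) (gauss v.2).
Definition gauss_mx (A : gm) : 'M[K]_3 :=
  let: ((a1, a2, a3), (b1, b2, b3), (c1, c2, c3)) := A in
  mx3 [:: [:: gauss a1; gauss a2; gauss a3]; [:: gauss b1; gauss b2; gauss b3];
          [:: gauss c1; gauss c2; gauss c3]].

Lemma ii : 'i * 'i = -1 :> K.
Proof. by rewrite -expr2 sqrCi. Qed.

Lemma gCM x y : gauss (gmul x y) = gauss x * gauss y.
Proof.
rewrite /gauss /gmul /= !rmorphD !rmorphN !rmorphM /=.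
have := ii; set I : K := 'i; move=> h.
transitivity (x.1%:~R * y.1%:~R + (x.2%:~R * y.2%:~R) * (I * I) + 
  (x.1%:~R * y.2%:~R + x.2%:~R * y.1%:~R) * I); first by rewrite h; ring.
by ring.
Qed.

Lemma gCD x y : gauss (gadd x y) = gauss x + gauss y.
Proof. by rewrite /gauss /gadd /= !rmorphD /=; ring. Qed.

Lemma gCN x : gauss (gopp x) = - gauss x.
Proof. by rewrite /gauss /gopp /= !rmorphN /=; ring. Qed.

Lemma gC_int n : gauss (gint n) = n%:~R.
Proof. by rewrite /gauss /= mul0r addr0. Qed.

Lemma gC_conj x : gauss (gconj x) = (gauss x)^*.
Proof.
rewrite /gauss /gconj /= rmorphD rmorphM /= !rmorph_int conjCi rmorphN /=; ring.
Qed.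

Lemma gC_re_im x : 'Re (gauss x) = x.1%:~R /\ 'Im (gauss x) = x.2%:~R.
Proof.
have r (n : int) : n%:~R \is @Num.real K by apply: realz.
by rewrite /gauss mulrC Re_rect ?Im_rect.
Qed.

Lemma gC_inj : injective gauss.
Proof.
move=> [a b] [c d] h; have [h1 h2] := gC_re_im (a, b); have [h3 h4] := gC_re_im (c, d).
rewrite h in h1 h2; move: h1 h2; rewrite h3 h4 /= => /intr_inj -> /intr_inj -> //.
Qed.

Lemma gC0 : gauss (0, 0) = 0. Proof. by rewrite (gC_int 0). Qed.
Lemma gC1 : gauss (1, 0) = 1. Proof. by rewrite (gC_int 1). Qed.
Lemma gCi : gauss (0, 1) = 'i. Proof. by rewrite /gauss /= add0r mul1r. Qed.

Lemma gC_norm x : gauss x * (gauss x)^* = (gnorm x)%:~R.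
Proof.
rewrite -gC_conj -gCM -gC_int; congr gauss.
by rewrite /gmul /gconj /gnorm /gint /=; congr pair; ring.
Qed.

Lemma gaussIntP z : @gaussInt R z <-> exists x, z = gauss x.
Proof. by split=> [[a [b ->]]|[[a b] ->]]; [exists (a, b)|exists a, b]. Qed.

Lemma vC_app A v : gauss_vec (gapp A v) = gauss_mx A *m gauss_vec v.
Proof.
case: A v => [[[[a1 a2] a3] [[b1 b2] b3]] [[c1 c2] c3]] [[v1 v2] v3].
by apply: vecP; rewrite appE /gauss_vec !vec3E /gauss_mx /mx3 !mxE /= !gCD !gCM.
Qed.

Lemma mCM A B : gauss_mx (gmm A B) = gauss_mx A *m gauss_mx B.
Proof.
case: A => [[[[a1 a2] a3] [[b1 b2] b3]] [[c1 c2] c3]].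
case: B => [[[[d1 d2] d3] [[e1 e2] e3]] [[f1 f2] f3]].
apply/matrixP => i j; rewrite [RHS]mxE sum3 /gauss_mx /mx3 !mxE.
by elim/ord3P: i; elim/ord3P: j; rewrite /= !gCD !gCM; ring.
Qed.

Lemma mC1 : gauss_mx gid = 1%:M.
Proof.
apply/matrixP => i j; rewrite /gauss_mx /gid /mx3 !mxE.
by elim/ord3P: i; elim/ord3P: j; rewrite /= ?gC0 ?gC1.
Qed.

Lemma mC_inj : injective gauss_mx.
Proof.
move=> [[[[a1 a2] a3] [[b1 b2] b3]] [[c1 c2] c3]].
move=> [[[[d1 d2] d3] [[e1 e2] e3]] [[f1 f2] f3]] /matrixP h.
move: (h i0 i0) (h i0 i1) (h i0 i2) (h i1 i0) (h i1 i1) (h i1 i2) (h i2 i0) (h i2 i1) (h i2 i2).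
by rewrite /gauss_mx /mx3 !mxE /=; do 9 move=> /gC_inj ->.
Qed.

Lemma vC_inj : injective gauss_vec.
Proof.
move=> [[a b] c] [[d e] f] /matrixP h.
move: (h i0 0) (h i1 0) (h i2 0); rewrite /gauss_vec !vec3E /=.
by do 3 move=> /gC_inj ->.
Qed.

Lemma herm_vC v w : herm (gauss_vec v) (gauss_vec w) = gauss (gherm v w).
Proof.
case: v w => [[a b] c] [[d e] f].
by rewrite hermE /gauss_vec !vec3E /= !gCD !gCM !gC_conj.
Qed.

Lemma gherm_real v : (gherm v v).2 = 0.
Proof.
case: v => [[[? ?] [? ?]] [? ?]]; rewrite /gherm /gdot /gadd /gmul /gconj /=; ring.
Qed.

Lemma herm_vCs v : herm (gauss_vec v) (gauss_vec v) = (gsq v)%:~R.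
Proof.
rewrite herm_vC /gauss gherm_real mul0r addr0; by [].
Qed.

Lemma vC_scale u v : gauss_vec (gscale u v) = gauss u *: gauss_vec v.
Proof.
by case: v => [[a b] c]; apply: vecP; rewrite !mxE /= !gCM.
Qed.

Lemma mC_inv A : gauss_mx (ginv A) = J R *m (gauss_mx A) ^t* *m J R.
Proof.
case: A => [[[[a1 a2] a3] [[b1 b2] b3]] [[c1 c2] c3]].
apply/matrixP => i j; rewrite [RHS]mxE sum3 ![in RHS]mxE !sum3 !mxE.
by elim/ord3P: i; elim/ord3P: j; rewrite /= ?gC_conj !(mul0r, mulr0, mul1r, mulr1, add0r, addr0).
Qed.

Lemma JJ : J R *m J R = 1%:M.
Proof.
apply/matrixP => i j; rewrite mxE sum3 !mxE.
by elim/ord3P: i; elim/ord3P: j; rewrite /=; ring.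
Qed.

Lemma gunit_UJ A : gunit A = (UJ (gauss_mx A) : Prop) :> Prop.
Proof.
apply/propext; rewrite /UJ /=; split.
  move=> /gunitP[h _]; move: (congr1 gauss_mx h); rewrite mCM mC1 mC_inv => e.
  have := congr1 (mulmx (J R)) e.
  by rewrite mulmx1 -!mulmxA (mulmxA (J R) (J R)) JJ mul1mx.
move=> h; have e : gauss_mx (ginv A) *m gauss_mx A = 1%:M.
  by rewrite mC_inv -!mulmxA (mulmxA _ (J R)) h JJ.
by apply/gunitP; split; apply: mC_inj; rewrite mCM mC1 // mulmx1C.
Qed.

Lemma gaussMx (A : 'M[K]_3) : (forall i j, gaussInt (A i j)) -> exists B, A = gauss_mx B.
Proof.
move=> h.
have [a1 h1] := (gaussIntP _).1 (h i0 i0); have [a2 h2] := (gaussIntP _).1 (h i0 i1).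
have [a3 h3] := (gaussIntP _).1 (h i0 i2); have [b1 h4] := (gaussIntP _).1 (h i1 i0).
have [b2 h5] := (gaussIntP _).1 (h i1 i1); have [b3 h6] := (gaussIntP _).1 (h i1 i2).
have [c1 h7] := (gaussIntP _).1 (h i2 i0); have [c2 h8] := (gaussIntP _).1 (h i2 i1).
have [c3 h9] := (gaussIntP _).1 (h i2 i2).
exists ((a1, a2, a3), (b1, b2, b3), (c1, c2, c3)).
by apply/matrixP => i j; rewrite /gauss_mx /mx3 !mxE; elim/ord3P: i; elim/ord3P: j.
Qed.

Lemma mC_gauss B i j : @gaussInt R (gauss_mx B i j).
Proof.
case: B => [[[[a1 a2] a3] [[b1 b2] b3]] [[c1 c2] c3]]; rewrite /gauss_mx /mx3 !mxE.
by apply/gaussIntP; elim/ord3P: i; elim/ord3P: j; eexists.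
Qed.

Lemma mC_unitmx B : gunit B -> gauss_mx B \in unitmx /\ invmx (gauss_mx B) = gauss_mx (ginv B).
Proof.
move=> /gunitP[/(congr1 gauss_mx) h _]; rewrite mCM mC1 in h.
have [_ u] := mulmx1_unit h; split=> //.
by rewrite -[LHS]mul1mx -h mulmxK.
Qed.

(** Integrality of the inverse is automatic, since the inverse of a unitary Gaussian matrix is
    [ginv] of it, which has conjugate entries. *)
Lemma UJ_GL3P (A : 'M[K]_3) : (UJ A /\ GL3O1 A) <-> exists2 B, gunit B & A = gauss_mx B.
Proof.
split=> [[uA [_ /gaussMx[B eB] _]]|[B uB ->]].
  by exists B => //; rewrite gunit_UJ -eB.
have [h1 h2] := mC_unitmx uB.
split; first by rewrite -gunit_UJ.
by split=> // i j; rewrite ?h2; apply: mC_gauss.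
Qed.

Lemma Gamma1P g : @Gamma1 R g <-> exists2 B, gunit B & g = <[gauss_mx B]>%VS.
Proof.
split=> [[A /UJ_GL3P[B uB ->] <-]|[B uB ->]]; first by exists B.
by exists (gauss_mx B) => //; apply/UJ_GL3P; exists B.
Qed.

Lemma lineP (V : vectType K) (v w : V) : v != 0 ->
  <[w]>%VS = <[v]>%VS <-> exists2 c : K, c != 0 & w = c *: v.
Proof.
move=> v0; split=> [e|[c c0 ->]].
  have : w \in <[v]>%VS by rewrite -e memv_line.
  move=> /vlineP[c ec]; exists c => //; apply: contra_neq v0 => c0.
  have : v \in <[w]>%VS by rewrite e memv_line.
  by rewrite ec c0 scale0r => /vlineP[k ->]; rewrite scaler0.
apply/eqP; rewrite eqEsubv -!memvE; apply/andP; split; apply/vlineP.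
  by exists c.
by exists c^-1; rewrite scalerA mulVf ?scale1r.
Qed.

Lemma neg_neq0 (v : 'cV[K]_3) : herm v v < 0 -> v != 0.
Proof. by apply: contraTneq => ->; rewrite herm0l ltxx. Qed.

Lemma pos_neq0 (v : 'cV[K]_3) : 0 < herm v v -> v != 0.
Proof. by apply: contraTneq => ->; rewrite herm0l ltxx. Qed.

Lemma H2CP (v : 'cV[K]_3) : H2C <[v]>%VS <-> herm v v < 0.
Proof.
split=> [[w w0 /esym e]|h]; last by exists v.
have [c c0 ->] := (lineP v (neg_neq0 w0)).1 e.
by rewrite hermZl hermZr mulrA nmulr_llt0// -normCK exprn_gt0// normr_gt0.
Qed.

Lemma unit_mx_app (A : 'M[K]_3) (v : 'cV[K]_3) : A \in unitmx -> v != 0 -> A *m v != 0.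
Proof.
move=> uA; apply: contra_neq => h.
by rewrite -[v]mul1mx -(mulVmx uA) -mulmxA h mulmx0.
Qed.

Lemma act_fixP (A : 'M[K]_3) (v : 'cV[K]_3) : A \in unitmx -> v != 0 ->
  act <[A]>%VS <[v]>%VS = <[v]>%VS <-> exists2 c : K, c != 0 & A *m v = c *: v.
Proof. by move=> uA v0; rewrite act_line lineP. Qed.

Lemma unitmx_neq0 (A : 'M[K]_3) : A \in unitmx -> A != 0.
Proof. by apply: contraTneq => ->; rewrite unitmxE det0 unitr0. Qed.

Lemma isotropyP (v : 'cV[K]_3) g : v != 0 ->
  isotropy <[v]>%VS g <->
  exists B c, [/\ gunit B, g = <[gauss_mx B]>%VS & gauss_mx B *m v = c *: v].
Proof.
move=> v0; split=> [[/Gamma1P[B uB ->] /act_fixP h]|[B [c [uB -> e]]]].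
  by have [c _ e] := h (mC_unitmx uB).1 v0; exists B, c.
split; first by apply/Gamma1P; exists B.
apply/act_fixP => //; first exact: (mC_unitmx uB).1.
exists c => //; apply: contra_neq (unit_mx_app (mC_unitmx uB).1 v0) => c0.
by rewrite e c0 scale0r.
Qed.

Lemma herm_gunit B (v w : 'cV[K]_3) : gunit B -> herm (gauss_mx B *m v) (gauss_mx B *m w) = herm v w.
Proof. by move=> uB; apply: herm_UJ; rewrite -gunit_UJ. Qed.

Lemma herm_inv B (v w : 'cV[K]_3) : gunit B -> herm (gauss_mx B *m v) w = herm v (gauss_mx (ginv B) *m w).
Proof.
move=> uB; rewrite -(herm_gunit _ _ (gunitV uB)) mulmxA -mCM.
by have /gunitP[-> _] := uB; rewrite mC1 mul1mx.
Qed.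

Lemma mC_V B (v : 'cV[K]_3) : gunit B -> gauss_mx (ginv B) *m (gauss_mx B *m v) = v.
Proof. by move=> /gunitP[h _]; rewrite mulmxA -mCM h mC1 mul1mx. Qed.

Lemma mC_VV B (v : 'cV[K]_3) : gunit B -> gauss_mx B *m (gauss_mx (ginv B) *m v) = v.
Proof. by move=> /gunitP[_ h]; rewrite mulmxA -mCM h mC1 mul1mx. Qed.

End Coordinates.

(** * Unitary maps and isolated fixed points *)

Section Combinations.
Variables (F : comNzRingType) (V : lmodType F).

Lemma comb2 (a b c d x y : F) (v w : V) :
  x *: (a *: v + b *: w) + y *: (c *: v + d *: w) =
  (a * x + c * y) *: v + (b * x + d * y) *: w.
Proof.
by rewrite !scalerDr !scalerA addrACA -!scalerDl (mulrC a) (mulrC b) (mulrC c) (mulrC d).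
Qed.

Lemma comb_quad (b c p q : F) (v w : V) :
  p *: (b *: (b *: v)) + q *: (c *: (c *: w)) =
  (b + c) *: (p *: (b *: v) + q *: (c *: w)) - (b * c) *: (p *: v + q *: w).
Proof.
rewrite !scalerDr !scalerA opprD addrACA -!scalerBl; congr (_ *: _ + _ *: _); ring.
Qed.

Lemma comb_eig (l p q : F) (v w : V) :
  p *: (l *: v) + q *: (l *: w) = l *: (p *: v + q *: w).
Proof. by rewrite scalerDr !scalerA (mulrC p) (mulrC q). Qed.
End Combinations.

Section Spectral.
Variable R : realType.
Local Notation K := (C R).
Local Notation vec := (@vec3 R).
Local Notation mC := (gauss_mx R).
Local Notation vC := (gauss_vec R).
Local Notation gC := (gauss R).
Implicit Types (v w y z : 'cV[K]_3) (A B : gm) (c : K).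

Lemma mulC_conj_ge0 c : 0 <= c * c^*.
Proof. by rewrite -normCK exprn_ge0. Qed.

Lemma mulC_conj_eq0 c : (c * c^* == 0) = (c == 0).
Proof. by rewrite -normCK expf_eq0 normr_eq0. Qed.

Lemma neg_lead v : herm v v < 0 -> v i2 0 != 0.
Proof.
apply: contraTneq => e; rewrite hermE e rmorph0 !(mul0r, mulr0, add0r, addr0).
by rewrite le_gtF// mulrC mulC_conj_ge0.
Qed.

Lemma herm_lead0 z : z i2 0 = 0 -> herm z z = z i1 0 * (z i1 0)^*.
Proof. by rewrite hermE => ->; rewrite rmorph0; ring. Qed.

(** The combination z = v3 y - y3 v has last coordinate 0, hence norm |z2|^2 >= 0. If <y,y> <= 0,
    its norm is also a sum of two nonpositive terms, so both vanish and y = 0. *)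
Lemma pos_perp v y : herm v v < 0 -> herm y v = 0 -> y != 0 -> 0 < herm y y.
Proof.
move=> v0 yv y0; have v3 := neg_lead v0.
rewrite real_ltNge ?real0 ?herm_real//; apply/negP => h.
pose z := v i2 0 *: y - y i2 0 *: v.
have z3 : z i2 0 = 0 by rewrite !mxE; ring.
have hz : herm z z = v i2 0 * (v i2 0)^* * herm y y + y i2 0 * (y i2 0)^* * herm v v.
  rewrite !(hermDl, hermDr, hermNl, hermNr, hermZl, hermZr) yv (herm_sym0 yv).
  by ring.
have h1 : v i2 0 * (v i2 0)^* * herm y y <= 0 by rewrite mulr_ge0_le0// mulC_conj_ge0.
have h2 : y i2 0 * (y i2 0)^* * herm v v <= 0.
  by rewrite mulr_ge0_le0 ?mulC_conj_ge0// ltW.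
have h3 : 0 <= herm z z by rewrite herm_lead0// mulC_conj_ge0.
have h4 : herm z z = 0 by apply/le_anti; rewrite h3 hz (le_trans (lerD h1 h2))// addr0.
move: h4; rewrite hz => /eqP; rewrite naddr_eq0// mulf_eq0 mulC_conj_eq0 (negPf v3) /=.
rewrite mulf_eq0 mulC_conj_eq0 (lt_eqF v0) orbF => /andP[/eqP yy /eqP y3].
have y2 : y i1 0 = 0.
  by apply/eqP; rewrite -mulC_conj_eq0 -herm_lead0// yy.
have y1 : y i0 0 = 0.
  move: yv; rewrite hermE y2 y3 !mulr0 !addr0 => /eqP; rewrite mulf_eq0 conjC_eq0 (negPf v3).
  by move=> /eqP.
by case/eqP: y0; apply: vecP; rewrite !mxE.
Qed.

Lemma exists_perp v w : exists2 y, y != 0 & herm y v = 0 /\ herm y w = 0.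
Proof.
pose M : 'M[K]_(3, 1 + 1) := row_mx ((v ^t* *m J R)^T) ((w ^t* *m J R)^T).
have r : kermx M != 0.
  rewrite -mxrank_eq0 mxrank_ker -lt0n subn_gt0.
  by apply: leq_ltn_trans (rank_leq_col M) _.
have [u u0 e] : exists2 u : 'rV[K]_3, u != 0 & u *m M = 0.
  by exists (nz_row (kermx M)); [rewrite nz_row_eq0|apply/sub_kermxP/nz_row_sub].
exists u^T; first by rewrite -(inj_eq trmx_inj) trmxK trmx0.
have k (x : 'cV[K]_3) : u *m (x ^t* *m J R)^T = 0 -> herm u^T x = 0.
  by rewrite /herm => /(congr1 trmx); rewrite trmx_mul trmxK trmx0 => ->; rewrite mxE.
move: e; rewrite /M (mul_mx_row u) => h.
have := congr1 (@lsubmx _ 1 1 1) h; have := congr1 (@rsubmx _ 1 1 1) h.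
have -> : @lsubmx K 1 1 1 0 = 0 by apply/matrixP => i j; rewrite !mxE.
have -> : @rsubmx K 1 1 1 0 = 0 by apply/matrixP => i j; rewrite !mxE.
rewrite row_mxKl row_mxKr => h2 h1; split; [exact: (k v h1)|exact: (k w h2)].
Qed.

Definition cols3 (v w y : 'cV[K]_3) : 'M[K]_3 :=
  \matrix_(i, j) (nth 0 [:: v; w; y] j) i 0.

Lemma cols3_herm v w y z : (cols3 v w y) ^t* *m (J R *m z) =
  vec (herm z v) (herm z w) (herm z y).
Proof.
apply: vecP; rewrite vec3E mxE sum3 !mxE !sum3 !mxE hermE /=; ring.
Qed.

Lemma mul_cols3 (A : 'M[K]_3) v w y : A *m cols3 v w y = cols3 (A *m v) (A *m w) (A *m y).
Proof.
by apply/matrixP => i j; rewrite !mxE; elim/ord3P: j => /=; rewrite mxE;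
   apply: eq_bigr => k _; rewrite mxE.
Qed.

Definition diag3 (a b c : K) : 'M[K]_3 := diag_mx (\row_(j < 3) [:: a; b; c]`_j).

Lemma cols3_diag v w y a b c : cols3 v w y *m diag3 a b c = cols3 (a *: v) (b *: w) (c *: y).
Proof.
apply/matrixP => i j; rewrite mul_mx_diag !mxE.
by elim/ord3P: j => /=; rewrite !mxE mulrC.
Qed.

Definition orth3 v w y := [/\ herm w v = 0, herm y v = 0 & herm y w = 0].

(** The Gram matrix of an orthogonal frame is diagonal with nonzero entries. *)
Lemma cols3_unit v w y : orth3 v w y -> herm v v != 0 -> herm w w != 0 -> herm y y != 0 ->
  cols3 v w y \in unitmx.
Proof.
move=> [wv yv yw] v0 w0 y0.
have e : (cols3 v w y) ^t* *m (J R *m cols3 v w y) = diag3 (herm v v) (herm w w) (herm y y).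
  rewrite mul_cols3; apply/matrixP => i j.
  transitivity (((cols3 v w y) ^t* *m (J R *m nth 0 [:: v; w; y] j)) i 0).
    by rewrite !mxE; apply: eq_bigr => k _; congr (_ * _); rewrite mxE; elim/ord3P: j.
  have vw := herm_sym0 wv; have vy := herm_sym0 yv; have wy := herm_sym0 yw.
  rewrite cols3_herm !mxE.
  by elim/ord3P: i; elim/ord3P: j; rewrite /= ?mulr1n ?mulr0n ?wv ?yv ?yw ?vw ?vy ?wy.
have : (cols3 v w y) ^t* *m (J R *m cols3 v w y) \in unitmx.
  rewrite e unitmxE /diag3 det_diag; rewrite unitfE.
  by apply/prodf_neq0 => j _; rewrite mxE; elim/ord3P: j.
by rewrite mulmxA unitmx_mul => /andP[].
Qed.

Lemma orth3_eq0 v w y z : orth3 v w y -> herm v v != 0 -> herm w w != 0 -> herm y y != 0 ->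
  herm z v = 0 -> herm z w = 0 -> herm z y = 0 -> z = 0.
Proof.
move=> o v0 w0 y0 zv zw zy; have u := cols3_unit o v0 w0 y0.
have := cols3_herm v w y z; rewrite zv zw zy.
have -> : vec 0 0 0 = 0 :> 'cV[K]_3 by apply: vecP; rewrite vec3E mxE.
have uc : (cols3 v w y) ^t* \in unitmx by rewrite unitmxE det_map_mx det_tr fmorph_unit; move: u; rewrite unitmxE.
move/(congr1 (mulmx (invmx ((cols3 v w y) ^t*)))); rewrite mulKmx// mulmx0 => h.
by rewrite -[z]mul1mx -(JJ R) -mulmxA h mulmx0.
Qed.

Lemma orth3_decomp v w y z : orth3 v w y -> herm v v != 0 -> herm w w != 0 -> herm y y != 0 ->
  z = (herm z v / herm v v) *: v + (herm z w / herm w w) *: w + (herm z y / herm y y) *: y.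
Proof.
move=> o v0 w0 y0; apply/eqP; rewrite -subr_eq0; apply/eqP.
have [wv yv yw] := o.
have vw := herm_sym0 wv; have vy := herm_sym0 yv; have wy := herm_sym0 yw.
by apply: (orth3_eq0 o) => //; rewrite !(hermDl, hermNl, hermZl) ?wv ?yv ?yw ?vw ?vy ?wy
  !mulr0 ?addr0 ?add0r divfK// subrr.
Qed.

Lemma orth3_decomp2 v w y z : orth3 v w y -> herm v v != 0 -> herm w w != 0 ->
  herm y y != 0 -> herm z v = 0 -> exists p q, z = p *: w + q *: y.
Proof.
move=> o v0 w0 y0 zv; exists (herm z w / herm w w), (herm z y / herm y y).
by rewrite [LHS](orth3_decomp z o v0 w0 y0) zv mul0r scale0r add0r.
Qed.

(* in signature (2,1) the orthogonal complement of two orthogonal vectors, one negative, is a line *)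
Lemma perp_line v d y y' : herm v v < 0 -> d != 0 -> y != 0 ->
  herm d v = 0 -> herm y v = 0 -> herm y' v = 0 -> herm y d = 0 -> herm y' d = 0 ->
  exists c, y' = c *: y.
Proof.
move=> v0 d0 y0 dv yv yv' yd yd'.
have dd := pos_perp v0 dv d0; have yy := pos_perp v0 yv y0.
exists (herm y' y / herm y y).
have o : orth3 v d y by [].
rewrite [LHS](orth3_decomp y' o (ltr0_neq0 v0) (lt0r_neq0 dd) (lt0r_neq0 yy)).
by rewrite yv' yd' !mul0r !scale0r !add0r.
Qed.

Lemma eig_norm (A : 'M[K]_3) v c : UJ A -> A *m v = c *: v -> herm v v != 0 -> c * c^* = 1.
Proof.
move=> uA e v0; have := herm_UJ v v uA; rewrite e hermZl hermZr mulrA => h.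
by apply: (mulIf v0); rewrite h mul1r.
Qed.

Lemma eig_perp (A : 'M[K]_3) v c y : UJ A -> A *m v = c *: v -> c * c^* = 1 ->
  herm y v = 0 -> herm (A *m y) v = 0.
Proof.
move=> uA e cc yv; have := herm_UJ y v uA; rewrite e hermZr yv => /eqP.
rewrite mulf_eq0 => /orP[c0|/eqP //].
by move: cc; rewrite (eqP c0) mulr0 => /eqP; rewrite eq_sym oner_eq0.
Qed.

Lemma eigenvector_2 (a b c d : K) : exists x y t : K, (x, y) != (0, 0) /\
  a * x + c * y = t * x /\ b * x + d * y = t * y.
Proof.
have [c0|c0] := eqVneq c 0.
  exists 0, 1, d; rewrite c0; split; first by rewrite xpair_eqE oner_eq0 andbF.
  by split; ring.
pose s := sqrtC ((a - d) ^+ 2 + 4 * b * c).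
have hs : s ^+ 2 = (a - d) ^+ 2 + 4 * b * c by rewrite sqrtCK.
pose t := (a + d + s) / 2.
(* For a root t of the characteristic polynomial, (c, t - a) satisfies the first equation
   identically and the second because (t - a)(t - d) = b c. *)
exists c, (t - a), t; split; first by rewrite xpair_eqE (negPf c0).
split; first by ring.
have e : (t - a) * (t - d) = b * c.
  transitivity ((s ^+ 2 - (a - d) ^+ 2) / 4); first by rewrite /t; field.
  by rewrite hs; field.
by rewrite -e; ring.
Qed.

(** The complement of v is stable and positive definite. It contains an eigenvector u, and the
    vectors of the complement orthogonal to u form a stable line. *)
Lemma unitary_diag (A : 'M[K]_3) v l : UJ A -> herm v v < 0 -> A *m v = l *: v ->
  exists w y l2 l3, [/\ orth3 v w y, 0 < herm w w, 0 < herm y y, A *m w = l2 *: w &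
   A *m y = l3 *: y].
Proof.
move=> uA v0 e; have v0' := ltr0_neq0 v0; have ll := eig_norm uA e v0'.
have [w w0 [wv _]] := exists_perp v v; have [y y0 [yv yw]] := exists_perp v w.
have ww := pos_perp v0 wv w0; have yy := pos_perp v0 yv y0.
have Awv := eig_perp uA e ll wv; have Ayv := eig_perp uA e ll yv.
have o : orth3 v w y by [].
have [a [b dw]] := orth3_decomp2 o v0' (lt0r_neq0 ww) (lt0r_neq0 yy) Awv.
have [c [d dy]] := orth3_decomp2 o v0' (lt0r_neq0 ww) (lt0r_neq0 yy) Ayv.
have [x1 [x2 [t [x0 [e1 e2]]]]] := eigenvector_2 a b c d.
pose u := x1 *: w + x2 *: y.
have eu : A *m u = t *: u.
  by rewrite mulmxDr -!scalemxAr dw dy comb2 e1 e2 -!scalerA -scalerDr.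
have uv : herm u v = 0 by rewrite hermDl !hermZl wv yv; ring.
have u0 : u != 0.
  apply: contra_neq x0 => u0; congr pair.
    have : herm u w = 0 by rewrite u0 herm0l.
    by rewrite hermDl !hermZl yw mulr0 addr0 => /eqP; rewrite mulf_eq0 (negPf (lt0r_neq0 ww)) orbF => /eqP.
  have : herm u y = 0 by rewrite u0 herm0l.
  by rewrite hermDl !hermZl (herm_sym0 yw) mulr0 add0r => /eqP; rewrite mulf_eq0 (negPf (lt0r_neq0 yy)) orbF => /eqP.
have uu := pos_perp v0 uv u0; have tt := eig_norm uA eu (lt0r_neq0 uu).
have [z z0 [zv zu]] := exists_perp v u; have zz := pos_perp v0 zv z0.
have [k ek] := perp_line v0 u0 z0 uv zv (eig_perp uA e ll zv) zu (eig_perp uA eu tt zu).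
by exists u, z, t, k.
Qed.

Lemma diag_trace (A : 'M[K]_3) v w y a b c : cols3 v w y \in unitmx ->
  A *m v = a *: v -> A *m w = b *: w -> A *m y = c *: y ->
  \tr A = a + b + c /\ \det A = a * b * c.
Proof.
move=> uP ea eb ec; set P := cols3 v w y in uP.
have e : A = P *m diag3 a b c *m invmx P.
  by rewrite cols3_diag -ea -eb -ec -mul_cols3 mulmxK.
split.
  by rewrite e mxtrace_mulC mulKmx// mxtrace_diag sum3 !mxE.
rewrite e !det_mulmx det_diag mulrAC -det_mulmx mulmxV// det1 mul1r.
by rewrite !big_ord_recr big_ord0 /= !mxE /= mul1r.
Qed.

(* v, w, y orthogonal eigenvectors: a vector orthogonal to v is killed by (A - b)(A - c) *)
Lemma quad_kill (A : 'M[K]_3) v w y b c z : orth3 v w y ->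
  herm v v != 0 -> herm w w != 0 -> herm y y != 0 ->
  A *m w = b *: w -> A *m y = c *: y -> herm z v = 0 ->
  A *m (A *m z) = (b + c) *: (A *m z) - (b * c) *: z.
Proof.
move=> o v0 w0 y0 ew ey zv; have [p [q ->]] := orth3_decomp2 o v0 w0 y0 zv.
by rewrite !mulmxDr -!scalemxAr ew ey -!scalemxAr ew ey comb_quad.
Qed.

Lemma UJ_mC A : gunit A -> UJ (mC A).
Proof. by rewrite (gunit_UJ R). Qed.

Lemma near_line (v y : 'cV[K]_3) (P : 'cV[K]_3 -> Prop) : herm v v < 0 ->
  0 < herm y y -> (\forall w \near v, P w) ->
  exists2 e : K, 0 < e & P (v + e *: y) /\ herm v v + e * e * herm y y < 0.
Proof.
move=> v0 yy nP; have /nbhs_ballP[d /= d0 hd] : nbhs v P := nP.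
pose S := `|y i0 0| + `|y i1 0| + `|y i2 0|.
have S0 : 0 <= S by rewrite !addr_ge0.
pose V := - herm v v; have V0 : 0 < V by rewrite oppr_gt0.
(* The displacement is y/D: D > S/d keeps it in the ball of radius d, and D > <y,y>/V together with
   D >= 1 keeps the norm negative. *)
pose D := 1 + S / d + herm y y / V.
have D1 : 1 <= D by rewrite /D -addrA lerDl addr_ge0// divr_ge0// ltW.
have D0 : 0 < D by apply: lt_le_trans D1.
exists D^-1; first by rewrite invr_gt0.
have hS : S / d < D.
  by rewrite /D addrAC ltrDr ltr_pwDl ?ltr01// divr_ge0// ltW.
have hV : herm y y / V < D.
  by rewrite /D ltrDr ltr_pwDl ?ltr01// divr_ge0// ltW.
split.
  apply: hd; split=> // i j; rewrite ord1 /ball /= !mxE opprD addNKr normrN normrM.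
  rewrite ger0_norm ?invr_ge0 ?(ltW D0)// mulrC ltr_pdivrMr//.
  rewrite mulrC -ltr_pdivrMr// (le_lt_trans _ hS)// ler_pM2r ?invr_gt0//.
  rewrite /S; elim/ord3P: i; first by rewrite -addrA lerDl addr_ge0.
    by rewrite addrAC lerDr addr_ge0.
  by rewrite lerDr addr_ge0.
rewrite -[herm v v]opprK addrC subr_lt0 -/V -mulrA -ltr_pdivlMl ?invr_gt0//.
rewrite invrK mulrC -ltr_pdivlMr ?invr_gt0// invrK.
rewrite ltr_pdivrMr// in hV; apply: (lt_le_trans hV).
exact: ler_peMr (ltW (mulr_gt0 D0 V0)) D1.
Qed.

(* Otherwise every element of the isotropy group fixes a direction orthogonal to v with the
   eigenvalue of v; comparing A, B and A B shows that one direction y serves for all, and the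
   points v + e y are fixed. *)
Lemma isolated_selects (v : 'cV[K]_3) : herm v v < 0 ->
  isolated_fixed_point (isotropy <[v]>%VS) <[v]>%VS ->
  exists A l, [/\ gunit A, mC A *m v = l *: v &
    forall y, herm y v = 0 -> mC A *m y = l *: y -> y = 0].
Proof.
move=> v0 [_ iso]; apply: contrapT => no.
have v0' := neg_neq0 v0.
have sel A l : gunit A -> mC A *m v = l *: v ->
    exists y, [/\ y != 0, herm y v = 0 & mC A *m y = l *: y].
  move=> uA eA; apply: contrapT => h; apply: no; exists A, l; split=> // y yv ey.
  by apply: contrapT => /eqP y0; apply: h; exists y.
suff [y [y0 yv hy]] : exists y, [/\ y != 0, herm y v = 0 &
    forall A l, gunit A -> mC A *m v = l *: v -> mC A *m y = l *: y].
  have yy := pos_perp v0 yv y0.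
  have [e e0 [he ne]] := near_line v0 yy (iso v erefl).
  have w0 : herm (v + e *: y) (v + e *: y) < 0.
    rewrite !(hermDl, hermDr, hermZl, hermZr) yv (herm_sym0 yv).
    by rewrite (CrealP (gtr0_real e0)) !mulr0 addr0 add0r mulrA.
  have : fixed_points (isotropy <[v]>%VS) <[v + e *: y]>%VS.
    split; first by apply/H2CP.
    move=> g /(isotropyP _ v0')[B [c [uB -> ec]]].
    have eB : mC B *m (v + e *: y) = c *: (v + e *: y).
      by rewrite mulmxDr -scalemxAr ec (hy B c)// scalerDr !scalerA mulrC.
    apply/act_fixP; [exact: (mC_unitmx R uB).1|exact: neg_neq0|exists c => //].
    have cc := eig_norm (UJ_mC uB) ec (ltr0_neq0 v0).
    by apply: contra_eq_neq cc => ->; rewrite mul0r eq_sym oner_neq0.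
  move=> /he /(lineP _ v0')[c c0 h].
  have : herm (v + e *: y) y = herm (c *: v) y by rewrite h.
  rewrite hermDl !hermZl (herm_sym0 yv) mulr0 add0r => /eqP.
  by rewrite mulf_eq0 (gt_eqF e0) (gt_eqF yy).
have [[A [l [u [uA eA uv nu]]]]|sc] := pselect (exists A l u,
    [/\ gunit A, mC A *m v = l *: v, herm u v = 0 & mC A *m u <> l *: u]); last first.
  have [y y0 [yv _]] := exists_perp v v; exists y; split=> // A l uA eA.
  by apply: contrapT => h; apply: sc; exists A, l, y.
have [y [y0 yv ey]] := sel A l uA eA; exists y; split=> // B m uB eB.
have [b [b0 bv eb]] := sel B m uB eB.
have uAB := gunitM uA uB.
have eAB : mC (gmm A B) *m v = (m * l) *: v.
  by rewrite mCM -mulmxA eB -scalemxAr eA scalerA.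
have [z [z0 zv ez]] := sel _ _ uAB eAB.
have ll := eig_norm (UJ_mC uA) eA (ltr0_neq0 v0).
have mm := eig_norm (UJ_mC uB) eB (ltr0_neq0 v0).
have yy := pos_perp v0 yv y0.
(* On the complement of v, A is not the scalar l, as [u] shows; so its l-eigenspace there is only
   the line of y. *)
have line x : herm x v = 0 -> mC A *m x = l *: x -> exists c, x = c *: y.
  move=> xv ex; have [x' hx'] : exists x', x' = x - (herm x y / herm y y) *: y by exists (x - (herm x y / herm y y) *: y).
  have x'y : herm x' y = 0 by rewrite hx' hermDl hermNl hermZl divfK ?subrr ?(lt0r_neq0 yy).
  have x'v : herm x' v = 0 by rewrite hx' hermDl hermNl hermZl xv yv; ring.
  have [x'0|x'0] := eqVneq x' 0.
    by exists (herm x y / herm y y); apply/eqP; rewrite -subr_eq0 -hx' x'0.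
  case: nu; have o : orth3 v y x' by [].
  have ex' : mC A *m x' = l *: x'.
    by rewrite hx' mulmxDr mulmxN -scalemxAr ex ey scalerDr scalerN !scalerA mulrC.
  have xx' := pos_perp v0 x'v x'0.
  rewrite (orth3_decomp u o (ltr0_neq0 v0) (lt0r_neq0 yy) (lt0r_neq0 xx')).
  by rewrite uv mul0r scale0r add0r mulmxDr -!scalemxAr ey ex' comb_eig.
(* d is orthogonal to v, to b (since B b = m b) and to y (since A B z = m l z and A y = l y). If d =
   0, then z is on the line of y and B y = m y; if not, y and b both lie on the line orthogonal to v
   and d. *)
pose d := mC B *m z - m *: z.
have dv : herm d v = 0.
  by rewrite hermDl hermNl hermZl zv (eig_perp (UJ_mC uB) eB mm zv); ring.
have db : herm d b = 0.
  have e1 : herm (mC B *m z) (mC B *m b) = herm z b by rewrite herm_gunit.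
  rewrite eb hermZr in e1.
  by rewrite hermDl hermNl hermZl -e1 mulrA mm mul1r subrr.
have dy : herm d y = 0.
  have e1 : herm (mC A *m (mC B *m z)) (mC A *m y) = herm (mC B *m z) y by rewrite herm_gunit.
  rewrite mulmxA -mCM ez ey hermZl hermZr in e1.
  rewrite hermDl hermNl hermZl -e1 mulrA -(mulrA m) ll mulr1 subrr //.
have [d0|d0] := eqVneq d 0.
  have eBz : mC B *m z = m *: z by apply/eqP; rewrite -subr_eq0 -/d d0.
  have eAz : mC A *m z = l *: z.
    have m0 : m != 0 by apply: contra_eq_neq mm => ->; rewrite mul0r eq_sym oner_neq0.
    apply: (scalerI m0); rewrite scalemxAr -eBz mulmxA -mCM ez scalerA //.
  have [c ec] := line z zv eAz.
  have c0 : c != 0 by apply: contra_neq z0 => c0; rewrite ec c0 scale0r.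
  by apply: (scalerI c0); rewrite scalemxAr -ec eBz scalerA mulrC -scalerA -ec.
have [c ec] := perp_line v0 d0 b0 dv bv yv (herm_sym0 db) (herm_sym0 dy).
by rewrite ec -scalemxAr eb !scalerA mulrC.
Qed.
End Spectral.

(** * Eigenvalues of integral unitary matrices *)

Definition gvadd (v w : gv) : gv :=
  let: (v1, v2, v3) := v in let: (w1, w2, w3) := w in
  (gadd v1 w1, gadd v2 w2, gadd v3 w3).

Definition gcoord (v : gv) (i : 'I_3) : gi := let: (a, b, c) := v in nth a [:: a; b; c] i.
Definition gbase (i : 'I_3) : gv :=
  nth gid.1.1 [:: gid.1.1; gid.1.2; gid.2] i.

Definition gquad (A : gm) (x y z : gi) : gm :=
  let: (r1, r2, r3) := gmm A A in let: (s1, s2, s3) := A in let: (t1, t2, t3) := gid in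
  (gvadd (gscale x r1) (gvadd (gscale y s1) (gscale z t1)),
   gvadd (gscale x r2) (gvadd (gscale y s2) (gscale z t2)),
   gvadd (gscale x r3) (gvadd (gscale y s3) (gscale z t3))).

Lemma sqr_div_bound (s k n m : int) : 0 <= k -> 0 < n -> s * s * k = n -> 0 <= m ->
  n < (m + 1) * (m + 1) -> - m <= s <= m.
Proof.
move=> k0 n0 e m0 nm; have k1 : 1 <= k.
  by have [k1|k1] : k = 0 \/ 1 <= k by [lia]; first by rewrite k1 mulr0 in e; lia.
have sn : s * s <= n by nia.
have : s * s < (m + 1) * (m + 1) by lia.
by move=> h; nia.
Qed.

Lemma neg_norm_le8 (s k n : int) : 0 <= k -> 0 < n -> s * s * k = n -> s < 0 -> n <= 8 ->
  s = -1 \/ s = -2.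
Proof. by move=> k0 n0 e s0 n8; have := @sqr_div_bound s k n 2 k0 n0 e; lia. Qed.

Lemma neg_norm_9 (s k : int) : 0 <= k -> s * s * k = 9 -> s < 0 ->
  s = -1 \/ s = -2 \/ s = -3.
Proof. by move=> k0 e s0; have := @sqr_div_bound s k 9 3 k0 isT e; lia. Qed.

Section Lattice.
Variable R : realType.
Local Notation K := (C R).
Local Notation vec := (@vec3 R).
Local Notation mC := (gauss_mx R).
Local Notation vC := (gauss_vec R).
Local Notation gC := (gauss R).
Implicit Types (A B : gm) (c : K).

Lemma vC_add (v w : gv) : vC (gvadd v w) = vC v + vC w.
Proof.
case: v w => [[v1 v2] v3] [[w1 w2] w3].
by apply: vecP; rewrite [RHS]mxE /gauss_vec !vec3E /= gCD.
Qed.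

Lemma vC_coord (v : gv) i : vC v i 0 = gC (gcoord v i).
Proof. by case: v => [[a b] c]; elim/ord3P: i; rewrite /gauss_vec !vec3E. Qed.

Lemma vC_base i : vC (gbase i) = vec (i == i0)%:R (i == i1)%:R (i == i2)%:R.
Proof.
by apply: vecP; rewrite vC_coord vec3E; elim/ord3P: i; rewrite /gbase /= ?gC0 ?gC1.
Qed.

Lemma gC_eq0 x : (gC x == 0) = (x == (0, 0)).
Proof. by rewrite -(gC0 R) (inj_eq (@gC_inj R)). Qed.

Lemma intK_eq (m n : int) : m%:~R = n%:~R :> K -> m = n.
Proof. exact: intr_inj. Qed.

Lemma mC_quad A x y z (v : 'cV[K]_3) :
  mC (gquad A x y z) *m v = gC x *: (mC A *m (mC A *m v)) + gC y *: (mC A *m v) + gC z *: v.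
Proof.
rewrite mulmxA -mCM /gquad.
case: (gmm A A) => [[[[r1 r2] r3] [[s1 s2] s3]] [[t1 t2] t3]].
case: A => [[[[a1 a2] a3] [[b1 b2] b3]] [[c1 c2] c3]].
apply: vecP; rewrite appE /gauss_mx /mx3 !mxE !sum3 !mxE /= !gCD !gCM ?gC0 ?gC1; ring.
Qed.

(** Among the nonzero lattice vectors of the line take u with |<u,u>| least. Gaussian division in
    one nonzero coordinate of u leaves a remainder on the same line that is shorter, hence 0.
    Lengths on the line are measured by |<u,u>| because the line is not isotropic. *)
Lemma lattice_generator (v : 'cV[K]_3) : herm v v != 0 ->
  (exists f c, vC f != 0 /\ vC f = c *: v) ->
  exists u c, [/\ c != 0, vC u = c *: v &
    forall f d, vC f = d *: v -> exists k, vC f = gC k *: vC u].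
Proof.
move=> v0 [f0 [c0 [nf0 ef0]]].
pose P n := `[< exists f c, [/\ vC f != 0, vC f = c *: v & `|gsq f|%N = n] >].
have exP : exists n, P n by exists `|gsq f0|%N; apply/asboolP; exists f0, c0.
case: (ex_minnP exP) => n /asboolP [u [c [nu eu en]]] minn.
have c_0 : c != 0 by apply: contra_neq nu => c_0; rewrite eu c_0 scale0r.
exists u, c; split=> // f d ef.
have [j nj] : exists j, gcoord u j != (0, 0).
  apply: contrapT => h; case/eqP: nu; apply/matrixP => i j; rewrite ord1 vC_coord mxE.
  by apply/eqP; rewrite gC_eq0; apply: contrapT => /negP h'; apply: h; exists i.
have [q hq] := ground (gcoord f j) (elimN eqP nj).
pose r := gvadd f (gscale q u).
pose k := d / c + gC q.
have er : vC r = k *: vC u.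
  by rewrite /r vC_add vC_scale ef eu /k scalerDl (scalerA (d / c)) divfK.
have ej : gcoord r j = gadd (gcoord f j) (gmul q (gcoord u j)).
  by rewrite /r; case: (f) (u) => [[? ?] ?] [[? ?] ?]; elim/ord3P: j {nj hq}.
have kj : gC (gcoord r j) = k * gC (gcoord u j).
  by rewrite -!vC_coord er mxE.
have n1 : (gsq r * gnorm (gcoord u j) = gnorm (gcoord r j) * gsq u)%R.
  apply: intK_eq; rewrite !intrM -!herm_vCs -!gC_norm er kj rmorphM hermZl hermZr /=.
  by ring.
have uj : 0 < gnorm (gcoord u j).
  by rewrite lt_neqAle gnorm_ge0 andbT eq_sym; apply/eqP => /gnorm0 /eqP; rewrite (negPf nj).
have su : gsq u != 0.
  apply: contraTneq (v0) => h; have := herm_vCs R u; rewrite h eu hermZl hermZr => /eqP.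
  by rewrite !mulf_eq0 conjC_eq0 (negPf c_0) /= negbK.
rewrite -ej in hq.
have [r0|r0] := eqVneq (vC r) 0.
  exists (gopp q); apply/eqP; rewrite -subr_eq0 gCN scaleNr opprK.
  by rewrite -vC_scale -vC_add -/r r0.
have : (n <= `|gsq r|)%N.
  by apply: minn; apply/asboolP; exists r, (k * c); split=> //; rewrite er eu scalerA.
rewrite -en; have := gnorm_ge0 (gcoord r j).
move: n1 uj hq su; move: (gsq r) (gsq u) (gnorm _) (gnorm _) => a b x y.
by move=> *; exfalso; nia.
Qed.

Lemma herm_base i (v : 'cV[K]_3) : herm (vC (gbase i)) v = (v (rev_ord i) 0)^*.
Proof.
rewrite hermE vC_base !vec3E.
have h (a b : 'I_3) : a = b -> v a 0 = v b 0 by move=> ->.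
elim/ord3P: i => /=; rewrite !(mulr0, mulr1, addr0, add0r); congr (_^*); apply: h; exact: val_inj.
Qed.

Lemma conj_quot (a b h : K) : h^* = h -> (a * b^* / h)^* = a^* / h * b.
Proof. by move=> e; rewrite rmorphM rmorphM fmorphV /= conjCK e mulrAC. Qed.

(* An integral multiple phi of the orthogonal projector onto a line generated by a
   lattice vector u forces <u, u> to divide phi. *)
Lemma projector_norm (F : gm) (phi : gi) (v : 'cV[K]_3) : herm v v != 0 -> phi != (0, 0) ->
  mC F *m v = gC phi *: v -> (forall z, herm z v = 0 -> mC F *m z = 0) ->
  exists u c k, [/\ c != 0, vC u = c *: v & gsq u * gsq u * gnorm k = gnorm phi].
Proof.
move=> v0 phi0 ev kill.
have proj z : mC F *m z = (gC phi * (herm z v / herm v v)) *: v.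
  have : mC F *m (z - (herm z v / herm v v) *: v) = 0.
    by apply: kill; rewrite hermDl hermNl hermZl divfK// subrr.
  move/eqP; rewrite mulmxDr mulmxN -scalemxAr ev subr_eq0 => /eqP ->.
  by rewrite scalerA mulrC.
have fe i : vC (gapp F (gbase i)) = (gC phi * ((v (rev_ord i) 0)^* / herm v v)) *: v.
  by rewrite vC_app proj herm_base.
have p0 : gC phi != 0 by rewrite gC_eq0.
have vn0 : v != 0 by apply: contra_neq v0 => ->; rewrite herm0l.
have [i ni] : exists i, v i 0 != 0.
  apply: contrapT => h; case/eqP: vn0; apply/matrixP => i j; rewrite ord1 mxE.
  by apply/eqP; apply: contrapT => /negP h'; apply: h; exists i.
have [|u [c [c0 eu gen]]] := lattice_generator v0.
  exists (gapp F (gbase (rev_ord i))), (gC phi * ((v i 0)^* / herm v v)).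
  rewrite fe rev_ordK; split=> //.
  by rewrite scaler_eq0 !mulf_eq0 (negPf p0) conjC_eq0 (negPf ni) invr_eq0 (negPf v0).
have hu : herm (vC u) (vC u) = c * c^* * herm v v by rewrite eu hermZl hermZr mulrA.
have cc0 : c * c^* != 0 by rewrite mulC_conj_eq0.
have int_i i' : exists k, gC k = gC phi * (vC u i' 0)^* / herm (vC u) (vC u).
  have [k ek] := gen _ _ (fe (rev_ord i')); exists k; move: ek; rewrite fe rev_ordK eu.
  rewrite scalerA => /eqP; rewrite -subr_eq0 -scalerBl scaler_eq0 (negPf vn0) orbF subr_eq0.
  move=> /eqP h; apply: (mulIf c0); rewrite -h !hermZl !hermZr mxE rmorphM /=.
  have c0' : c^* != 0 by rewrite conjC_eq0.
  by field; rewrite v0 c0 c0'.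
have [k0 h0] := int_i i0; have [k1 h1] := int_i i1; have [k2 h2] := int_i i2.
(* The vectors F e_i are integral multiples of u, so phi conj(u_i) / <u,u> is Gaussian for every i.
   Conjugating, conj(phi) / <u,u> times u is a lattice vector, hence a Gaussian multiple of u. *)
pose t : gv := (gconj k0, gconj k1, gconj k2).
have hr : (herm (vC u) (vC u))^* = herm (vC u) (vC u) by rewrite -hermC.
have et : vC t = ((gC phi)^* / herm (vC u) (vC u)) *: vC u.
  by apply: vecP; rewrite [RHS]mxE [LHS]vec3E /t /= gC_conj ?h0 ?h1 ?h2 (conj_quot _ _ hr).
have [k ek] : exists k, vC t = gC k *: vC u.
  by apply: (gen t (((gC phi)^* / herm (vC u) (vC u)) * c)); rewrite et {3}eu scalerA.
exists u, c, k; split=> //; apply: intK_eq.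
have un0 : vC u != 0 by rewrite eu scaler_eq0 negb_or c0.
have hn0 : herm (vC u) (vC u) != 0 by rewrite hu mulf_neq0.
have hk : gC k = (gC phi)^* / herm (vC u) (vC u).
  apply/eqP; rewrite -subr_eq0; have : (gC k - (gC phi)^* / herm (vC u) (vC u)) *: vC u == 0.
    by rewrite scalerBl -ek -et subrr.
  by rewrite scaler_eq0 (negPf un0) orbF.
have hk' : (gC k)^* = gC phi / herm (vC u) (vC u).
  by have := conj_quot (gC phi)^* 1 hr; rewrite rmorph1 !mulr1 conjCK -hk.
rewrite !intrM -!gC_norm -herm_vCs hk' hk; field; exact: hn0.
Qed.

Lemma det2 (A : 'M[K]_2) : \det A = A ord0 ord0 * A ord_max ord_max - A ord0 ord_max * A ord_max ord0.
Proof.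
have h (a b c d : 'I_2) : a = c -> b = d -> A a b = A c d by move=> -> ->.
rewrite (expand_det_row _ ord0) !big_ord_recl big_ord0 /cofactor !det_mx11 !mxE /=.
rewrite !expr0 expr1 mul1r mulN1r addr0 mulrN; congr (_ * _ - _ * _).
all: apply: h; exact: val_inj.
Qed.

Lemma det3 (A : 'M[K]_3) : \det A =
  A i0 i0 * (A i1 i1 * A i2 i2 - A i1 i2 * A i2 i1)
  - A i0 i1 * (A i1 i0 * A i2 i2 - A i1 i2 * A i2 i0)
  + A i0 i2 * (A i1 i0 * A i2 i1 - A i1 i1 * A i2 i0).
Proof.
have h (a b c d : 'I_3) : a = c -> b = d -> A a b = A c d by move=> -> ->.
rewrite (expand_det_row _ i0) sum3 /cofactor !det2 !mxE /= !expr0 !expr1 /= sqrrN expr1n.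
rewrite !mul1r !mulN1r mulrN; congr (_ * (_ * _ - _ * _) - _ * (_ * _ - _ * _) + _ * (_ * _ - _ * _)).
all: apply: h; exact: val_inj.
Qed.

Lemma det_gauss A : exists x, \det (mC A) = gC x.
Proof.
case: A => [[[[a1 a2] a3] [[b1 b2] b3]] [[c1 c2] c3]].
exists (gadd (gadd (gmul a1 (gadd (gmul b2 c3) (gopp (gmul b3 c2))))
  (gopp (gmul a2 (gadd (gmul b1 c3) (gopp (gmul b3 c1))))))
  (gmul a3 (gadd (gmul b1 c2) (gopp (gmul b2 c1))))).
by rewrite det3 /gauss_mx /mx3 !mxE /= !(gCD, gCM, gCN).
Qed.

Lemma tr_gauss A : exists x, \tr (mC A) = gC x.
Proof.
case: A => [[[[a1 a2] a3] [[b1 b2] b3]] [[c1 c2] c3]].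
exists (gadd (gadd a1 b2) c3).
by rewrite /mxtrace sum3 /gauss_mx /mx3 !mxE /= !gCD.
Qed.

Lemma gu_norm x : gu x = (gC x * (gC x)^* == 1).
Proof. by rewrite gC_norm -[1]/(1%:~R) (eqr_int). Qed.

Lemma gherm_addl v w : gsq (gvadd v w) = gsq v + gsq w + 2 * (gherm v w).1.
Proof.
case: v w => [[[? ?] [? ?]] [? ?]] [[[? ?] [? ?]] [? ?]].
rewrite /gvadd /gsq /gherm /gdot /gadd /gmul /gconj /=; ring.
Qed.

(** Taking norms in A^2 z = -(A z + z) gives <z,z> = 2 <z,z> + 2 Re <A z, z>, so <z,z> is even. *)
Lemma even_perp_cubic A u : gunit A ->
  (forall z, herm z (vC u) = 0 -> mC A *m (mC A *m z) = - (mC A *m z) - z) -> even_perp u.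
Proof.
move=> uA h z zu; have hz : herm (vC z) (vC u) = 0 by rewrite herm_vC zu gC0.
have e : gapp A (gapp A z) = gscale (-1, 0) (gvadd (gapp A z) z).
  apply: (@vC_inj R); rewrite vC_scale vC_add !vC_app h//.
  have -> : gC (-1, 0) = -1 by rewrite (gC_int R (-1)).
  by rewrite scaleN1r opprD.
have := gsq_unit (gapp A z) uA; rewrite e.
have -> w : gsq (gscale (-1, 0) w) = gsq w.
  by case: w => [[[? ?] [? ?]] [? ?]]; rewrite /gsq /gherm /gdot /gadd /gmul /gconj /=; ring.
by rewrite gherm_addl gsq_unit// => h2; exists (- (gherm (gapp A z) z).1); lia.
Qed.

Lemma diag_unit3 A (v w y : 'cV[K]_3) l l2 l3 : gunit A -> orth3 v w y ->
  herm v v < 0 -> 0 < herm w w -> 0 < herm y y ->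
  mC A *m v = l *: v -> mC A *m w = l2 *: w -> mC A *m y = l3 *: y ->
  [/\ l * l^* = 1, l2 * l2^* = 1, l3 * l3^* = 1, \tr (mC A) = l + l2 + l3 &
    \det (mC A) = l * l2 * l3].
Proof.
move=> uA o v0 w0 y0 ev ew ey; have UA := UJ_mC R uA.
have u := cols3_unit o (ltr0_neq0 v0) (lt0r_neq0 w0) (lt0r_neq0 y0).
have [t d] := diag_trace u ev ew ey.
by split=> //; [exact: eig_norm UA ev (ltr0_neq0 v0)|exact: eig_norm UA ew (lt0r_neq0 w0)
  |exact: eig_norm UA ey (lt0r_neq0 y0)].
Qed.

Lemma sum2_unit (a b : K) : a * a^* = 1 -> b * b^* = 1 ->
  (a + b) * (a + b)^* + (a - b) * (a - b)^* = 4 /\ a + b = a * b * (a + b)^*.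
Proof.
move=> ha hb; rewrite !(rmorphD, rmorphN) /=; split.
  transitivity (2 * (a * a^*) + 2 * (b * b^*)); first by ring.
  by rewrite ha hb; ring.
transitivity (b * (a * a^*) + a * (b * b^*)); first by rewrite ha hb; ring.
by ring.
Qed.

(* phi = 1 - b + d is the value at 1 of X^2 - b X + d, whose roots are unit complex numbers *)
Lemma unit_pair_values (b d : gi) : gu d -> b = gmul d (gconj b) -> gnorm b <= 4 ->
  let phi := gadd (gadd (1, 0) (gopp b)) d in phi != (0, 0) ->
  [\/ gnorm phi = 1 \/ gnorm phi = 2, gnorm phi = 4 \/ gnorm phi = 8,
      b = (-1, 0) /\ d = (1, 0) | b = (-2, 0) /\ d = (1, 0)].
Proof.
case: b => x y /gu_cases [] -> /= [e1 e2] n; move: n e1 e2.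
all: rewrite /gnorm /gadd /gopp /gmul /gconj /= => n e1 e2 h.
- have y0 : y = 0 by lia.
  have hx : -2 <= x <= 2 by subst y; nia.
  have : x = -2 \/ x = -1 \/ x = 0 \/ x = 1 \/ x = 2 by lia.
  case=> [->|[->|[->|[->|xx]]]]; rewrite ?y0.
  + by apply: Or44.
  + by apply: Or43.
  + by apply: Or42; left.
  + by apply: Or41; left.
  + by rewrite y0 xx in h.
- have x0 : x = 0 by lia.
  have hy : -2 <= y <= 2 by subst x; nia.
  have : y = -2 \/ y = -1 \/ y = 0 \/ y = 1 \/ y = 2 by lia.
  case=> [->|[->|[yy|[->|->]]]]; rewrite ?x0.
  + by apply: Or42; left.
  + by apply: Or41; left.
  + by rewrite x0 yy in h.
  + by apply: Or41; left.
  + by apply: Or42; left.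
- have xy : y = x by lia.
  have hx : -1 <= x <= 1 by subst y; nia.
  have : x = -1 \/ x = 0 \/ x = 1 by lia.
  case=> [xx|[xx|xx]]; rewrite xy xx in h *.
  + by apply: Or42; right.
  + by apply: Or41; right.
  + by [].
- have xy : y = - x by lia.
  have hx : -1 <= x <= 1 by subst y; nia.
  have : x = -1 \/ x = 0 \/ x = 1 by lia.
  case=> [xx|[xx|xx]]; rewrite xy xx in h *.
  + by apply: Or42; right.
  + by apply: Or41; right.
  + by [].
Qed.

(** The operator (A - l2)(A - l3) kills the complement of v and multiplies v by phi = (1 - l2)(1 -
    l3), so <u,u>^2 divides |phi|^2. If l2 = l3 = -1, then |phi|^2 = 16 is too weak, and A + 1,
    which multiplies v by 2, is used. Norm -3 needs |phi|^2 = 9, where A^2 + A + 1 vanishes on the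
    complement. *)
Lemma gaussian_eigenvalue A (v : 'cV[K]_3) : gunit A -> herm v v < 0 -> mC A *m v = v ->
  (forall z, herm z v = 0 -> mC A *m z = z -> z = 0) ->
  exists u c, [/\ c != 0, vC u = c *: v, gsq u = -1 \/ gsq u = -2 \/ gsq u = -3 &
    gsq u = -3 -> even_perp u].
Proof.
move=> uA v0 ev iso; have ev1 : mC A *m v = 1 *: v by rewrite scale1r.
have [w [y [l2 [l3 [o ww yy ew ey]]]]] := unitary_diag (UJ_mC R uA) v0 ev1.
have [_ n2 n3 tr det] := diag_unit3 uA o v0 ww yy ev1 ew ey.
have [d ed] := det_gauss A; rewrite det mul1r in ed.
have [t et] := tr_gauss A; rewrite tr in et.
pose b := gadd t (-1, 0).
have eb : l2 + l3 = gC b by rewrite gCD -et (gC_int R (-1)); ring.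
have [hs hb] := sum2_unit n2 n3.
have ud : gu d by rewrite gu_norm -ed rmorphM /= mulrACA n2 n3 mulr1.
have hb' : b = gmul d (gconj b).
  by apply: (@gC_inj R); rewrite gCM gC_conj -eb -ed -hb.
have nb : gnorm b <= 4.
  rewrite -(ler_int K) -gC_norm -eb -[4%:~R]/(4 : K) -hs lerDl mulC_conj_ge0 //.
pose phi := gadd (gadd (1, 0) (gopp b)) d.
have ephi : gC phi = (1 - l2) * (1 - l3) by rewrite !gCD gCN gC1 -eb -ed; ring.
have o' := o; case: o' => wv yv yw.
have ne1 (x : 'cV[K]_3) l : 0 < herm x x -> herm x v = 0 -> mC A *m x = l *: x -> 1 - l != 0.
  move=> xx xv ex; rewrite subr_eq0; apply: contraTneq xx => l1.
  by rewrite (iso x xv) ?herm0l ?ltxx// ex -l1 scale1r.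
have phi0 : phi != (0, 0).
  by rewrite -gC_eq0 ephi mulf_neq0 //; [exact: (ne1 w)|exact: (ne1 y)].
have v0' := ltr0_neq0 v0; have ww' := lt0r_neq0 ww; have yy' := lt0r_neq0 yy.
have kill z : herm z v = 0 -> mC A *m (mC A *m z) = gC b *: (mC A *m z) - gC d *: z.
  by move=> zv; rewrite (quad_kill o v0' ww' yy' ew ey zv) eb ed.
have neg u c : c != 0 -> vC u = c *: v -> gsq u < 0.
  move=> c0 eu; rewrite -(ltr_int K) -herm_vCs eu hermZl hermZr mulrA.
  by rewrite pmulr_rlt0// lt_neqAle eq_sym mulC_conj_eq0 c0 mulC_conj_ge0.
have fin F psi : psi != (0, 0) -> gnorm psi <= 8 -> mC F *m v = gC psi *: v ->
   (forall z, herm z v = 0 -> mC F *m z = 0) ->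
   exists u c, [/\ c != 0, vC u = c *: v, gsq u = -1 \/ gsq u = -2 \/ gsq u = -3 &
    gsq u = -3 -> even_perp u].
  move=> p0 p8 eF kF; have [u [c [k [c0 eu hk]]]] := projector_norm v0' p0 eF kF.
  have p1 : 0 < gnorm psi.
    by rewrite lt_neqAle gnorm_ge0 andbT eq_sym; apply/eqP => /gnorm0 /eqP; rewrite (negPf p0).
  have h := neg_norm_le8 (gnorm_ge0 k) p1 hk (neg u c c0 eu) p8.
  by exists u, c; split=> //; [case: h => ->; [left|right; left]|case: h => ->].
have eF : mC (gquad A (1, 0) (gopp b) d) *m v = gC phi *: v.
  by rewrite mC_quad !ev -!scalerDl -!gCD.
have kF z : herm z v = 0 -> mC (gquad A (1, 0) (gopp b) d) *m z = 0.
  by move=> zv; rewrite mC_quad kill// gC1 scale1r gCN scaleNr addrAC subrK subrr.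
have := unit_pair_values ud hb' nb phi0; rewrite -/phi; case=> [h|h|[eb0 ed0]|[eb0 ed0]].
- by apply: fin phi0 _ eF kF; case: h => ->.
- by apply: fin phi0 _ eF kF; case: h => ->.
- have [u [c [k [c0 eu hk]]]] := projector_norm v0' phi0 eF kF.
  have p9 : gnorm phi = 9 by rewrite /phi eb0 ed0.
  exists u, c; split=> //.
    by rewrite p9 in hk; exact: neg_norm_9 (gnorm_ge0 k) hk (neg u c c0 eu).
  move=> _; apply: (even_perp_cubic uA) => z; rewrite eu hermZr => /eqP.
  rewrite mulf_eq0 conjC_eq0 (negPf c0) /= => /eqP zv.
  by rewrite kill// eb0 ed0 gC1 (gC_int R (-1)) scaleN1r scale1r.
have l23 : l2 = -1 /\ l3 = -1.
  have e1 : l2 + l3 = -2 by rewrite eb eb0 (gC_int R (-2)).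
  have e2 : l2 * l3 = 1 by rewrite ed ed0 gC1.
  have : (l2 + 1) ^+ 2 = 0.
    transitivity (l2 * (l2 + l3) - l2 * l3 + 2 * l2 + 1); first by ring.
    by rewrite e1 e2; ring.
  move=> /eqP; rewrite sqrf_eq0 addr_eq0 => /eqP l2e; split=> //.
  by apply: (addrI l2); rewrite e1 l2e; ring.
have psi0 : (2, 0) != (0, 0) :> gi by [].
apply: (fin (gquad A (0, 0) (1, 0) (1, 0))) psi0 _ _ _ => //.
  by rewrite mC_quad !ev gC0 gC1 scale0r scale1r add0r (gC_int R 2) scaler_nat mulr2n.
move=> z zv; rewrite mC_quad gC0 gC1 scale0r !scale1r add0r.
have [p [q ->]] := orth3_decomp2 o v0' ww' yy' zv.
case: l23 => l2e l3e.
by rewrite mulmxDr -!scalemxAr ew ey l2e l3e !scaleN1r !scalerN -opprD addNr.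
Qed.
End Lattice.

(** * Characteristic polynomials and the three types of fixed points *)

Definition gscalem (u : gi) (A : gm) : gm := gmm (gdiag u u u) A.

Lemma gunit_scalem u A : gu u -> gunit A -> gunit (gscalem u A).
Proof. by move=> uu uA; apply: gunitM => //; apply: gunit_diag. Qed.

(* discriminant of X^3 - a X^2 + conj(a) X - 1 *)
Definition gdisc (a : gi) : int :=
  gnorm a * gnorm a - 8 * (gmul a (gmul a a)).1 + 18 * gnorm a - 27.

Lemma gdisc_cases a : gnorm a <= 9 -> gdisc a <= 0 ->
  a \in [:: (3, 0); (-1, 0); (-1, 2); (-1, -2); (1, 0); (0, 0); (0, 1); (0, -1); (2, 0);
    (-1, 1); (-1, -1)].
Proof.
case: a => x y n9 d0.
have rng (z : int) : z * z <= 9 -> z \in [:: -3; -2; -1; 0; 1; 2; 3 : int].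
  move=> h; have hz : -3 <= z <= 3 by nia.
  have : z = -3 \/ z = -2 \/ z = -1 \/ z = 0 \/ z = 1 \/ z = 2 \/ z = 3 by lia.
  by case=> [->|[->|[->|[->|[->|[->|->]]]]]].
have hx : x * x <= 9 by move: n9; rewrite /gnorm /=; nia.
have hy : y * y <= 9 by move: n9; rewrite /gnorm /=; nia.
have /allP/(_ _ (rng x hx))/allP/(_ _ (rng y hy))/implyP/(_ d0) : all (fun x : int => all (fun y : int =>
  (gdisc (x, y) <= 0) ==> ((x, y) \in [:: (3, 0); (-1, 0); (-1, 2); (-1, -2); (1, 0); (0, 0);
   (0, 1); (0, -1); (2, 0); (-1, 1); (-1, -1)])) [:: -3; -2; -1; 0; 1; 2; 3 : int])
   [:: -3; -2; -1; 0; 1; 2; 3 : int] by vm_compute.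
by [].
Qed.

Section Trichotomy.
Variable R : realType.
Local Notation K := (C R).
Local Notation vec := (@vec3 R).
Local Notation mC := (gauss_mx R).
Local Notation vC := (gauss_vec R).
Local Notation gC := (gauss R).
Implicit Types (A B : gm).

Lemma mC_scalem u A : mC (gscalem u A) = gC u *: mC A.
Proof.
rewrite /gscalem mCM -mul_scalar_mx; congr (_ *m _).
apply/matrixP => i j; rewrite /gauss_mx /mx3 !mxE.
by elim/ord3P: i; elim/ord3P: j; rewrite /= ?gC0.
Qed.

Lemma unit_triple (a b c : K) : a * a^* = 1 -> b * b^* = 1 -> c * c^* = 1 -> a * b * c = 1 ->
  [/\ a^* = b * c, b^* = a * c & c^* = a * b].
Proof.
move=> ha hb hc e; split.
- by rewrite -[LHS]mulr1 -e; transitivity (a * a^* * (b * c)); [ring|rewrite ha mul1r].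
- by rewrite -[LHS]mulr1 -e; transitivity (b * b^* * (a * c)); [ring|rewrite hb mul1r].
- by rewrite -[LHS]mulr1 -e; transitivity (c * c^* * (a * b)); [ring|rewrite hc mul1r].
Qed.

(** Each conj(l_i) is the product of the other two eigenvalues, so conj(l1 - l2) = -l3 (l1 - l2) and
    conj(d) = -d. The discriminant d^2 is therefore -|d|^2. *)
Lemma gdisc_norm (a : gi) (l1 l2 l3 : K) :
  l1 * l1^* = 1 -> l2 * l2^* = 1 -> l3 * l3^* = 1 -> l1 * l2 * l3 = 1 -> l1 + l2 + l3 = gC a ->
  let d := (l1 - l2) * (l2 - l3) * (l1 - l3) in (gdisc a)%:~R = - (d * d^*).
Proof.
move=> h1 h2 h3 e ea d; rewrite {}/d; have [c1 c2 c3] := unit_triple h1 h2 h3 e.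
have ec : gC (gconj a) = l2 * l3 + l1 * l3 + l1 * l2.
  by rewrite gC_conj -ea !rmorphD /= c1 c2 c3.
have -> : (gdisc a)%:~R = (gC a * gC (gconj a)) ^+ 2 - 4 * (gC a ^+ 3 + gC (gconj a) ^+ 3)
    + 18 * (gC a * gC (gconj a)) - 27 * (l1 * l2 * l3) ^+ 2 :> K.
  rewrite e -!gCM !exprS !expr0 !mulr1 -!gCM -gCD -(gC_int R (gdisc a)).
  rewrite -[4](gC_int R 4) -[18](gC_int R 18) -[27](gC_int R 27) -!gCM -gCN -gCD -gCD -gCN -gCD.
  congr gC; case: (a) => x y.
  by rewrite /gdisc /gnorm /gconj /gmul /gadd /gopp /gint /=; congr pair; ring.
rewrite ec -ea !rmorphM !rmorphB /= c1 c2 c3.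
transitivity ((l1 + l2 + l3) ^+ 2 * (l2 * l3 + l1 * l3 + l1 * l2) ^+ 2
  - 4 * ((l1 + l2 + l3) ^+ 3 * (l1 * l2 * l3) + (l2 * l3 + l1 * l3 + l1 * l2) ^+ 3)
  + 18 * ((l1 + l2 + l3) * (l2 * l3 + l1 * l3 + l1 * l2)) * (l1 * l2 * l3)
   - 27 * (l1 * l2 * l3) ^+ 2).
  by rewrite e; ring.
transitivity (((l1 - l2) * (l2 - l3) * (l1 - l3)) ^+ 2); first by ring.
transitivity (((l1 - l2) * (l2 - l3) * (l1 - l3)) ^+ 2 * (l1 * l2 * l3)); first by rewrite e mulr1.
by ring.
Qed.

(** 9 - |a|^2 is the sum of the three |l_i - l_j|^2. *)
Lemma trace_constraints (a : gi) (l1 l2 l3 : K) :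
  l1 * l1^* = 1 -> l2 * l2^* = 1 -> l3 * l3^* = 1 -> l1 * l2 * l3 = 1 ->
  l1 + l2 + l3 = gC a ->
  [/\ gnorm a <= 9, gdisc a <= 0 &
    forall t, (t - l1) * (t - l2) * (t - l3) = t ^+ 3 - gC a * t ^+ 2 + gC (gconj a) * t - 1].
Proof.
move=> h1 h2 h3 e ea; have [c1 c2 c3] := unit_triple h1 h2 h3 e.
have ec : gC (gconj a) = l2 * l3 + l1 * l3 + l1 * l2.
  by rewrite gC_conj -ea !rmorphD /= c1 c2 c3.
split.
- rewrite -(ler_int K) -gC_norm -gC_conj ec -ea.
  have -> : 9%:~R = (l1 + l2 + l3) * (l2 * l3 + l1 * l3 + l1 * l2) +
     ((l1 - l2) * (l1 - l2)^* + (l2 - l3) * (l2 - l3)^* + (l1 - l3) * (l1 - l3)^*) :> K.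
    rewrite !rmorphB /= c1 c2 c3.
    transitivity (9 * (l1 * l2 * l3)); first by rewrite e; ring.
    by ring.
  by rewrite lerDl !addr_ge0 ?mulC_conj_ge0.
- by rewrite -(ler_int K) (gdisc_norm h1 h2 h3 e ea) oppr_le0 mulC_conj_ge0.
- by move=> t; rewrite ec -ea -e; ring.
Qed.

(** Here and in [zeta8_type] the eigenvalues at v and y are the two roots of an irreducible
    quadratic over Q(i). The eigenvalue at w is Gaussian, which will make the line of w rational and
    place v on the complex line orthogonal to a lattice vector. *)
Definition omega_type (v : 'cV[K]_3) : Prop := exists B m mu w y,
  [/\ [/\ gunit B, gu mu & m * m + m + 1 = 0], [/\ orth3 v w y, 0 < herm w w & 0 < herm y y] &
    [/\ mC B *m v = m *: v, mC B *m w = gC mu *: w & mC B *m y = (-1 - m) *: y]].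

Definition zeta8_type (v : 'cV[K]_3) : Prop := exists B m mu w y,
  [/\ [/\ gunit B, gu mu & m * m = - 'i], [/\ orth3 v w y, 0 < herm w w & 0 < herm y y] &
    [/\ mC B *m v = m *: v, mC B *m w = gC mu *: w & mC B *m y = - m *: y]].

Definition gauss_type (v : 'cV[K]_3) : Prop := exists B,
  [/\ gunit B, mC B *m v = v & forall z, herm z v = 0 -> mC B *m z = z -> z = 0].

Lemma gauss_typeI A u (v : 'cV[K]_3) : gunit A -> gu u -> mC A *m v = gC u *: v ->
  (forall z, herm z v = 0 -> mC A *m z = gC u *: z -> z = 0) -> gauss_type v.
Proof.
move=> uA uu ev iso; have [uc ec] := gu_conj uu.
have e1 : gC (gconj u) * gC u = 1 by rewrite -gCM ec (gC_int R 1).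
exists (gscalem (gconj u) A); split; first exact: gunit_scalem.
  by rewrite mC_scalem -scalemxAl ev scalerA e1 scale1r.
move=> z zv ez; apply: iso => //.
by rewrite -{2}ez mC_scalem -scalemxAl scalerA mulrC e1 scale1r.
Qed.

Lemma scalem_eig u A (v : 'cV[K]_3) l : mC A *m v = l *: v ->
  mC (gscalem u A) *m v = (gC u * l) *: v.
Proof. by move=> e; rewrite mC_scalem -scalemxAl e scalerA. Qed.

Lemma ginv_eig A (v : 'cV[K]_3) l : gunit A -> l * l^* = 1 -> mC A *m v = l *: v ->
  mC (ginv A) *m v = l^* *: v.
Proof.
move=> uA ll e; have := mC_V v uA; rewrite e -scalemxAr => h.
by rewrite -[in RHS]h scalerA mulrC ll scale1r.
Qed.

Lemma omega_typeI A (a mu eta : gi) (v w y : 'cV[K]_3) l l2 l3 : gunit A -> gu mu -> gu eta ->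
  orth3 v w y -> 0 < herm w w -> 0 < herm y y ->
  mC A *m v = l *: v -> mC A *m w = l2 *: w -> mC A *m y = l3 *: y ->
  l2 = gC mu \/ l3 = gC mu -> l + l2 + l3 = gC a ->
  (gC eta * l) * (gC eta * l) + gC eta * l + 1 = 0 ->
  gmul eta (gadd a (gopp mu)) = (-1, 0) -> omega_type v.
Proof.
move=> uA um ue [wv yv yw] ww yy ev ew ey hmu tr hl ha.
have ha' : gC eta * (gC a - gC mu) = -1.
  by rewrite -gCN -gCD -gCM ha (gC_int R (-1)).
have ug : gu (gmul eta mu) by rewrite /gu gnormM (eqP ue) (eqP um).
have fin w' y' l2' l3' : orth3 v w' y' -> 0 < herm w' w' -> 0 < herm y' y' ->
    mC A *m w' = l2' *: w' -> mC A *m y' = l3' *: y' -> l2' = gC mu ->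
    l + l2' + l3' = gC a -> omega_type v.
  move=> o ww' yy' ew' ey' e2 e3.
  exists (gscalem eta A), (gC eta * l), (gmul eta mu), w', y'.
  split; split=> //; first exact: gunit_scalem.
  - exact: scalem_eig.
  - by rewrite gCM; apply: scalem_eig; rewrite ew' e2.
  - have -> : -1 - gC eta * l = gC eta * l3' by rewrite -ha' -e3 e2; ring.
    exact: scalem_eig.
case: hmu => e; first exact: (fin w y l2 l3).
by apply: (fin y w l3 l2 _ yy ww ey ew e); [exact: And3 yv wv (herm_sym0 yw)|rewrite addrAC].
Qed.

(** Each of the eleven polynomials has a Gaussian root. Either it splits over Q(i), and then [l] is
    a unit, or the remaining factor becomes X^2 + X + 1 after scaling by a unit, or it is X^2 - i or
    X^2 + i. *)
Lemma trichotomy_det1 A (v : 'cV[K]_3) l : gunit A -> herm v v < 0 -> mC A *m v = l *: v ->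
  (forall z, herm z v = 0 -> mC A *m z = l *: z -> z = 0) -> \det (mC A) = 1 ->
  [\/ gauss_type v, omega_type v | zeta8_type v].
Proof.
move=> uA v0 ev iso d1.
have [w [y [l2 [l3 [o ww yy ew ey]]]]] := unitary_diag (UJ_mC R uA) v0 ev.
have [n1 n2 n3 tr det] := diag_unit3 uA o v0 ww yy ev ew ey.
rewrite d1 in det; have [a ea] := tr_gauss R A; rewrite tr in ea.
have [na da T] := trace_constraints n1 n2 n3 (esym det) ea.
have neq (x : 'cV[K]_3) m : 0 < herm x x -> herm x v = 0 -> mC A *m x = m *: x -> l <> m.
  move=> xx xv ex lm; have := iso x xv; rewrite ex lm => /(_ erefl) x0.
  by rewrite x0 herm0l ltxx in xx.
have o' := o; case: o' => wv yv yw.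
have o2 : orth3 v y w := And3 yv wv (herm_sym0 yw).
have nl2 := neq w l2 ww wv ew; have nl3 := neq y l3 yy yv ey.
have E := T l; rewrite subrr !mul0r in E; move/esym in E.
have G u : gu u -> l = gC u -> gauss_type v.
  by move=> uu lu; apply: (gauss_typeI uA uu) => //; rewrite -lu.
have root mu : l <> gC mu -> gC mu ^+ 3 - gC a * gC mu ^+ 2 + gC (gconj a) * gC mu - 1 = 0 ->
    l2 = gC mu \/ l3 = gC mu.
  move=> lm; rewrite -T => /eqP; rewrite !mulf_eq0 !subr_eq0 => /orP[/orP[]|] /eqP h.
  - by case: lm.
  - by left.
  - by right.
have I2 := ii R; set I : K := 'i in I2.
have gi_ : gC (0, 1) = I := gCi R.
have gni : gC (0, -1) = - I by rewrite /gauss /= add0r mulN1r.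
have g1 := gC1 R; have gn1 : gC (-1, 0) = -1 := gC_int R (-1).
(* [mu] is a Gaussian root of the polynomial, and scaling by [eta] turns the other factor into X^2 +
   X + 1. *)
have om mu eta : gu mu -> gu eta ->
   gC mu ^+ 3 - gC a * gC mu ^+ 2 + gC (gconj a) * gC mu - 1 = 0 ->
   (l - gC mu) * ((gC eta * l) * (gC eta * l) + gC eta * l + 1) = 0 ->
   gmul eta (gadd a (gopp mu)) = (-1, 0) -> [\/ gauss_type v, omega_type v | zeta8_type v].
  move=> um ue rmu /eqP; rewrite mulf_eq0 subr_eq0 => /orP[/eqP lm _|/eqP hl ha].
    by apply: Or31; apply: G um lm.
  have [lm|lm] := pselect (l = gC mu); first by apply: Or31; apply: G um lm.
  apply: Or32; apply: (omega_typeI uA um ue o ww yy ev ew ey) ea hl ha.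
  exact: root.
have gE x1 x2 : gC (x1, x2) = x1%:~R + x2%:~R * I by [].
have G3 q r s : gu q -> gu r -> gu s -> (l - gC q) * (l - gC r) * (l - gC s) = 0 ->
    [\/ gauss_type v, omega_type v | zeta8_type v].
  move=> uq ur us /eqP; rewrite !mulf_eq0 !subr_eq0 -orbA => /or3P[] /eqP e; apply: Or31.
  - exact: G uq e.
  - exact: G ur e.
  - exact: G us e.
have := gdisc_cases na da; rewrite !inE => /orP[/eqP h|].
  by apply: (G3 (1, 0) (1, 0) (1, 0)) => //; rewrite -E h /gconj /= !gE; ring.
move=> /orP[/eqP h|].
  by apply: (G3 (1, 0) (-1, 0) (-1, 0)) => //; rewrite -E h /gconj /= !gE; ring.
move=> /orP[/eqP h|].
  by apply: (G3 (-1, 0) (0, 1) (0, 1)) => //; rewrite -E h /gconj /= !gE; ring: I2.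
move=> /orP[/eqP h|].
  by apply: (G3 (-1, 0) (0, -1) (0, -1)) => //; rewrite -E h /gconj /= !gE; ring: I2.
move=> /orP[/eqP h|].
  by apply: (G3 (1, 0) (0, -1) (0, 1)) => //; rewrite -E h /gconj /= !gE; ring: I2.
move=> /orP[/eqP h|].
  apply: (om (1, 0) (1, 0)) => //; rewrite ?h //.
    by rewrite /gconj /= !gE; ring.
  by rewrite -E h g1 /gconj /= !gE; ring.
move=> /orP[/eqP h|].
  have [lm|lm] := pselect (l = gC (0, 1)); first by apply: Or31; apply: (G (0, 1)).
  have l22 : l * l = I.
    have : (l - I) * (l * l - I) = 0.
      transitivity (l ^+ 3 - gC a * l ^+ 2 + gC (gconj a) * l - 1 + (I * I + 1)).
        by rewrite h /gconj /= !gE; ring.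
      by rewrite E I2; ring.
    move=> /eqP; rewrite mulf_eq0 !subr_eq0 => /orP[] /eqP // e.
    by case: lm; rewrite gi_.
  have r : l2 = gC (0, 1) \/ l3 = gC (0, 1).
    apply: root => //.
    transitivity ((- (I * I) - 1) : K); last by rewrite I2; ring.
    by rewrite h /gconj /= !gE; ring.
  apply: Or33.
  have fin w' y' l2' l3' : orth3 v w' y' -> 0 < herm w' w' -> 0 < herm y' y' ->
      mC A *m w' = l2' *: w' -> mC A *m y' = l3' *: y' -> l2' = gC (0, 1) ->
      l3' * l3'^* = 1 -> l + l2' + l3' = gC a -> zeta8_type v.
    move=> oo w0 y0 ew' ey' e2 n3' e3.
    (* Here l^2 = i, whereas [zeta8_type] asks for -i; passing to the inverse conjugates the
       eigenvalues. *)
    exists (ginv A), l^*, (0, -1), w', y'; split; split=> //; first exact: gunitV.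
    - by rewrite -rmorphM l22 /= conjCi.
    - exact: ginv_eig.
    - have -> : gC (0, -1) = (gC (0, 1))^* by rewrite gi_ gni /= conjCi.
      rewrite -e2; apply: ginv_eig => //.
      by rewrite e2 gi_ conjCi mulrN I2 opprK.
    - have -> : - l^* = l3'^*.
        rewrite -rmorphN /=; congr (_^*); apply: (addrI (l + l2')).
        by rewrite e3 e2 h; ring.
      exact: ginv_eig.
  case: r => e; first exact: (fin w y l2 l3).
  by apply: (fin y w l3 l2 o2 yy ww ey ew e n2); rewrite addrAC.
move=> /orP[/eqP h|].
  have [lm|lm] := pselect (l = gC (0, -1)); first by apply: Or31; apply: (G (0, -1)).
  have l22 : l * l = - I.
    have : (l + I) * (l * l + I) = 0.
      transitivity (l ^+ 3 - gC a * l ^+ 2 + gC (gconj a) * l - 1 + (I * I + 1)).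
        by rewrite h /gconj /= !gE; ring.
      by rewrite E I2; ring.
    move=> /eqP; rewrite mulf_eq0 !addr_eq0 => /orP[] /eqP // e.
    by case: lm; rewrite gni.
  have r : l2 = gC (0, -1) \/ l3 = gC (0, -1).
    apply: root => //.
    transitivity ((- (I * I) - 1) : K); last by rewrite I2; ring.
    by rewrite h /gconj /= !gE; ring.
  apply: Or33.
  have fin w' y' l2' l3' : orth3 v w' y' -> 0 < herm w' w' -> 0 < herm y' y' ->
      mC A *m w' = l2' *: w' -> mC A *m y' = l3' *: y' -> l2' = gC (0, -1) ->
      l + l2' + l3' = gC a -> zeta8_type v.
    move=> oo w0 y0 ew' ey' e2 e3.
    exists A, l, (0, -1), w', y'; split; split=> //; first by rewrite -e2.
    by have -> : - l = l3' by [apply: (addrI (l + l2')); rewrite e3 e2 h; ring].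
  case: r => e; first exact: (fin w y l2 l3).
  by apply: (fin y w l3 l2 o2 yy ww ey ew e); rewrite addrAC.
move=> /orP[/eqP h|].
  apply: (om (1, 0) (-1, 0)) => //; rewrite ?h //.
    by rewrite /gconj /= !gE; ring.
  by rewrite -E h g1 gn1 /gconj /= !gE; ring.
move=> /orP[/eqP h|/eqP h].
  apply: (om (-1, 0) (0, 1)) => //; rewrite ?h //.
    by rewrite /gconj /= !gE; ring.
  rewrite gi_ gn1; transitivity (- (l ^+ 3 - gC a * l ^+ 2 + gC (gconj a) * l - 1)
    + (I * I + 1) * (l ^+ 3 + l ^+ 2)).
    by rewrite h /gconj /= !gE; ring.
  by rewrite E I2; ring.
apply: (om (-1, 0) (0, -1)) => //; rewrite ?h //.
  by rewrite /gconj /= !gE; ring.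
rewrite gni gn1; transitivity (- (l ^+ 3 - gC a * l ^+ 2 + gC (gconj a) * l - 1)
    + (I * I + 1) * (l ^+ 3 + l ^+ 2)).
  by rewrite h /gconj /= !gE; ring.
by rewrite E I2; ring.
Qed.

(** The determinant d is a unit, so d^4 = 1 and d A has determinant d^3 d = 1. *)
Lemma trichotomy A (v : 'cV[K]_3) l : gunit A -> herm v v < 0 -> mC A *m v = l *: v ->
  (forall z, herm z v = 0 -> mC A *m z = l *: z -> z = 0) ->
  [\/ gauss_type v, omega_type v | zeta8_type v].
Proof.
move=> uA v0 ev iso.
have [w [y [l2 [l3 [o ww yy ew ey]]]]] := unitary_diag (UJ_mC R uA) v0 ev.
have [n1 n2 n3 tr det] := diag_unit3 uA o v0 ww yy ev ew ey.
have [d ed] := det_gauss R A.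
have ud : gu d.
  rewrite (gu_norm R) -ed det !rmorphM /=; apply/eqP.
  transitivity ((l * l^*) * (l2 * l2^*) * (l3 * l3^*)); first by ring.
  by rewrite n1 n2 n3 !mulr1.
have d4 : gC d * gC d * gC d * gC d = 1.
  by rewrite -!gCM; case: (gu_cases ud) => ->; rewrite -[RHS]gC1; congr gC.
apply: (@trichotomy_det1 (gscalem d A) v (gC d * l)) => //.
- exact: gunit_scalem.
- exact: scalem_eig.
- move=> z zv; rewrite mC_scalem -scalemxAl -scalerA => ez; apply: iso => //.
  have d0 : gC d != 0 by apply: contra_eq_neq d4 => ->; rewrite !mul0r eq_sym oner_neq0.
  exact: (scalerI d0).
by rewrite mC_scalem detZ ed exprS expr2; rewrite -[RHS]d4; ring.
Qed.
End Trichotomy.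

(** * Orbits of fixed points *)

Section Orbits.
Variable R : realType.
Local Notation K := (C R).
Local Notation vec := (@vec3 R).
Local Notation mC := (gauss_mx R).
Local Notation vC := (gauss_vec R).
Local Notation gC := (gauss R).
Implicit Types (A B : gm).

Definition korb (v w : 'cV[K]_3) : Prop :=
  exists A c, [/\ gunit A, c != 0 & w = c *: (mC A *m v)].

Lemma korb_scale c (v : 'cV[K]_3) : c != 0 -> korb v (c *: v).
Proof. by move=> c0; exists gid, c; rewrite gunit1 mC1 mul1mx. Qed.

Lemma korb_app A (v : 'cV[K]_3) : gunit A -> korb v (mC A *m v).
Proof. by move=> uA; exists A, 1; rewrite oner_neq0 scale1r. Qed.

Lemma korb_trans (u v w : 'cV[K]_3) : korb u v -> korb v w -> korb u w.
Proof.
move=> [A [c [uA c0 ->]]] [B [d [uB d0 ->]]]; exists (gmm B A), (d * c).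
by rewrite gunitM// mulf_neq0// mCM -scalemxAr scalerA mulmxA.
Qed.

Lemma korb_sym (v w : 'cV[K]_3) : korb v w -> korb w v.
Proof.
move=> [A [c [uA c0 ->]]]; exists (ginv A), c^-1.
by rewrite gunitV// invr_eq0 c0 -scalemxAr scalerA mulVf// mC_V// scale1r.
Qed.

Lemma korb_geqv u v : geqv u v -> korb (vC u) (vC v).
Proof. by move=> [A uA <-]; rewrite vC_app; apply: korb_app. Qed.

Lemma korb_neg (v w : 'cV[K]_3) : korb v w -> herm v v < 0 -> herm w w < 0.
Proof.
move=> [A [c [uA c0 ->]]] h; rewrite hermZl hermZr mulrA herm_gunit//.
by rewrite pmulr_rlt0// lt_neqAle eq_sym mulC_conj_eq0 c0 mulC_conj_ge0.
Qed.

Lemma korb_orbit (v w : 'cV[K]_3) : v != 0 ->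
  korb v w <-> Gamma1_orbit <[v]>%VS <[w]>%VS.
Proof.
move=> v0; split=> [[A [c [uA c0 ->]]]|[g /Gamma1P[A uA ->]]].
  exists <[mC A]>%VS; first by apply/Gamma1P; exists A.
  rewrite act_line; apply/esym/lineP; last by exists c.
  exact: (unit_mx_app (mC_unitmx R uA).1).
rewrite act_line => /esym/(lineP _ (unit_mx_app (mC_unitmx R uA).1 v0))[c c0 ->].
by exists A, c.
Qed.

(** An imprimitive vector of norm -2 is replaced by one of norm -1 on the same line. In norm -3 the
    orbit of (-2,1,1) is excluded because its complement contains (1,-1,0), of odd norm. *)
Lemma gauss_orbit (v : 'cV[K]_3) : herm v v < 0 -> gauss_type v ->
  [\/ korb v (vC ((1, 1), (0, -1), (-1, -1))), korb v (vC ((1, 0), (0, 0), (-1, 0))) |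
   korb v (vC ((1, 0), (-1, 0), (-1, 0)))].
Proof.
move=> v0 [A [uA ev iso]].
have [u [c [c0 eu su ep]]] := gaussian_eigenvalue uA v0 ev iso.
have h1 : korb v (vC u) by rewrite eu; apply: korb_scale.
have m1 : gu (-1, 0) by [].
have p3 w : korb v (vC w) -> gsq w = -1 -> korb v (vC ((1, 0), (-1, 0), (-1, 0))).
  move=> hw sw; apply: (korb_trans hw); apply: korb_geqv.
  exact: geqv_trans (norm_m1 sw) (geqv_scale _ m1).
case: su => [s|[s|s]]; first by apply: Or33; exact: p3 h1 s.
  have [e|[w ew sw]] := norm_m2 s.
    apply: Or32; apply: (korb_trans h1); apply: korb_geqv.
    exact: geqv_trans e (geqv_scale _ m1).
  apply: Or33; apply: (p3 w) => //; apply: (korb_trans h1).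
  have g0 : gC (1, 1) != 0 by rewrite gC_eq0.
  rewrite ew vC_scale; apply: korb_sym; exact: korb_scale.
have [e|e] := norm_m3 s.
  have [|k] := even_perp_geqv e (ep s) (y := ((1, 0), (-1, 0), (0, 0))) => //.
  by rewrite /gsq /=; lia.
apply: Or31; apply: (korb_trans h1); apply: korb_geqv; apply: (geqv_trans e).
apply: (geqv_trans (geqv_scale _ m1)).
exact: (@geqv_mid (0, 1)).
Qed.

Definition conjg (h B : gm) : gm := gmm h (gmm B (ginv h)).

Lemma conjg_app h B (z : 'cV[K]_3) : gunit h ->
  mC (conjg h B) *m (mC h *m z) = mC h *m (mC B *m z).
Proof. by move=> uh; rewrite /conjg !mCM -!mulmxA mC_V. Qed.

Lemma gunit_conjg h B : gunit h -> gunit B -> gunit (conjg h B).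
Proof. by move=> uh uB; rewrite !gunitM ?gunitV. Qed.

(* A unitary B with B^2 = s B + t on the complement of u, moved so that u becomes a lattice vector u'. *)
Lemma transport h B u u' (v : 'cV[K]_3) m mu (s t : K) : gunit h -> gunit B ->
  mC h *m u = u' -> herm v v < 0 -> herm v u = 0 -> mC B *m v = m *: v ->
  mC B *m u = mu *: u ->
  (forall z, herm z u = 0 -> mC B *m (mC B *m z) = s *: (mC B *m z) + t *: z) ->
  let B' := conjg h B in let v' := mC h *m v in
  [/\ [/\ gunit B', herm v' v' < 0 & herm v' u' = 0], mC B' *m v' = m *: v',
   mC B' *m u' = mu *: u' &
   forall z, herm z u' = 0 -> mC B' *m (mC B' *m z) = s *: (mC B' *m z) + t *: z].
Proof.
move=> uh uB eu v0 vu ev emu q /=; split; first split.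
- exact: gunit_conjg.
- by rewrite herm_gunit.
- by rewrite -eu herm_gunit.
- by rewrite conjg_app// ev -scalemxAr.
- by rewrite -eu conjg_app// emu -scalemxAr.
move=> z zu'; rewrite -(mC_VV z uh); set z' := mC (ginv h) *m z.
have zu : herm z' u = 0 by rewrite (herm_inv z u (gunitV uh)) ginvK eu.
by rewrite !conjg_app// q// mulmxDr -!scalemxAr.
Qed.

(** On the plane orthogonal to (0,1,0) the form is hyperbolic. Once i is factored out of the
    off-diagonal entries, B restricts there to an integral matrix of trace -1 and determinant 1,
    which is the relation between q, r and s. *)
Lemma omega_entries B mu : gunit B -> gu mu ->
  mC B *m vC ((0, 0), (1, 0), (0, 0)) = gC mu *: vC ((0, 0), (1, 0), (0, 0)) ->
  (forall z, herm z (vC ((0, 0), (1, 0), (0, 0))) = 0 ->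
    mC B *m (mC B *m z) = -1 *: (mC B *m z) + -1 *: z) ->
  exists s r q : int, q * r = 1 + s + s * s /\
    (forall a, mC B *m vec a 0 1 =
      vec ((-1 - s%:~R) * a + q%:~R * 'i) 0 (r%:~R * 'i * a + s%:~R)).
Proof.
move=> uB um eB q.
(* In the form B z + z + B^{-1} z = 0 the relation B^2 = -B - 1 is linear in the integer coordinates
   of the entries, because [ginv] is. *)
have rel z : gherm z ((0, 0), (1, 0), (0, 0)) = (0, 0) ->
    gvadd (gapp B z) (gvadd z (gapp (ginv B) z)) = ((0, 0), (0, 0), (0, 0)).
  move=> hz; apply: (@vC_inj R); rewrite !vC_add !vC_app.
  have hz' : herm (vC z) (vC ((0, 0), (1, 0), (0, 0))) = 0 by rewrite herm_vC hz gC0.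
  have := congr1 (mulmx (mC (ginv B))) (q _ hz'); rewrite mC_V// !scaleN1r => ->.
  rewrite mulmxDr !mulmxN mC_V//.
  have -> : vC ((0, 0), (0, 0), (0, 0)) = 0 by apply: vecP; rewrite vec3E mxE /= gC0.
  by rewrite -opprD addNr.
have perp z : gherm z ((0, 0), (1, 0), (0, 0)) = (0, 0) ->
    gherm (gapp B z) ((0, 0), (1, 0), (0, 0)) = (0, 0).
  move=> hz; apply: (@gC_inj R); rewrite -herm_vC vC_app gC0.
  apply: (eig_perp (UJ_mC R uB) eB); last by rewrite herm_vC hz gC0.
  by apply/eqP; rewrite -gu_norm.
move: (rel ((1, 0), (0, 0), (0, 0)) erefl) (rel ((0, 0), (0, 0), (1, 0)) erefl).
move: (perp ((1, 0), (0, 0), (0, 0)) erefl) (perp ((0, 0), (0, 0), (1, 0)) erefl).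
move/gunitP: (uB) => [e1 _]; move: e1 {rel perp q eB uB}.
case: B => [[[[[a1 a1'] [a2 a2']] [a3 a3']] [[[b1 b1'] [b2 b2']] [b3 b3']]]
  [[[c1 c1'] [c2 c2']] [c3 c3']]].
rewrite /gmm /ginv /gtr /gapp /gherm /gdot /gvadd /gadd /gmul /gconj /gid /gdiag /gint /=.
move=> [e11 e11' _ _ _ _ _ _ _ _ _ _ _ _ _ _ _ _] [p1 p1'] [p2 p2'] .
move=> [k1 k1' _ _ k3 k3'] [l1 l1' _ _ l3 l3'].
have z1 : b1 = 0 by lia.
have z1' : b1' = 0 by lia.
have z3 : b3 = 0 by lia.
have z3' : b3' = 0 by lia.
have y1 : c1 = 0 by lia.
have y3 : a3 = 0 by lia.
have x1 : a1 = - 1 - c3 by lia.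
have x1' : a1' = c3' by lia.
subst b1 b1' b3 b3' c1 a3 a1 a1'.
have c3'0 : c3' = 0.
  have : c3' * (2 * c3 + 1) = 0 by lia.
  by move/eqP; rewrite mulf_eq0 => /orP[/eqP|/eqP] //; lia.
subst c3'.
exists c3, c1', a3'; split; first by lia.
move=> a; apply: vecP; rewrite appE !vec3E /gauss_mx /mx3 !mxE /= /gauss /=.
- by rewrite rmorphB rmorphN /=; ring.
- by ring.
- by ring.
Qed.

(** Dividing B^2 = -i by B gives a relation linear in the integer coordinates of the entries. *)
Lemma quarter_rel B (u z : gv) : gunit B ->
  (forall z, herm z (vC u) = 0 ->
    mC B *m (mC B *m z) = 0 *: (mC B *m z) + - 'i *: z) ->
  gherm z u = (0, 0) -> gapp B z = gscale (0, -1) (gapp (ginv B) z).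
Proof.
move=> uB q hz; apply: (@vC_inj R); rewrite vC_scale !vC_app.
have hz' : herm (vC z) (vC u) = 0 by rewrite herm_vC hz gC0.
have := congr1 (mulmx (mC (ginv B))) (q _ hz'); rewrite mC_V// scale0r add0r => ->.
by rewrite -scalemxAr; congr (_ *: _); rewrite /gauss /= add0r mulN1r.
Qed.

Lemma eig_perp_gv B mu (u z : gv) : gunit B -> gu mu -> mC B *m vC u = gC mu *: vC u ->
  gherm z u = (0, 0) -> gherm (gapp B z) u = (0, 0).
Proof.
move=> uB um eB hz; apply: (@gC_inj R); rewrite -herm_vC vC_app gC0.
apply: (eig_perp (UJ_mC R uB) eB); last by rewrite herm_vC hz gC0.
by apply/eqP; rewrite -gu_norm.
Qed.

(** Parity: [quarter_rel] makes the real part of the upper left entry of B^{-1} B even, while it has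
    to be 1. *)
Lemma zeta8_even_contra B mu : gunit B -> gu mu ->
  mC B *m vC ((0, 0), (1, 0), (0, 0)) = gC mu *: vC ((0, 0), (1, 0), (0, 0)) ->
  (forall z, herm z (vC ((0, 0), (1, 0), (0, 0))) = 0 ->
    mC B *m (mC B *m z) = 0 *: (mC B *m z) + - 'i *: z) -> False.
Proof.
move=> uB um eB q.
move: (quarter_rel (z := ((1, 0), (0, 0), (0, 0))) uB q erefl).
move: (quarter_rel (z := ((0, 0), (0, 0), (1, 0))) uB q erefl).
move: (eig_perp_gv (z := ((1, 0), (0, 0), (0, 0))) uB um eB erefl).
move: (eig_perp_gv (z := ((0, 0), (0, 0), (1, 0))) uB um eB erefl).
move/gunitP: (uB) => [e1 _]; move: e1 {q eB uB}.
case: B => [[[[[a1 a1'] [a2 a2']] [a3 a3']] [[[b1 b1'] [b2 b2']] [b3 b3']]]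
  [[[c1 c1'] [c2 c2']] [c3 c3']]].
rewrite /gmm /ginv /gtr /gapp /gscale /gherm /gdot /gadd /gmul /gconj /gid /gdiag /gint /=.
move=> [e11 e11' _ _ _ _ _ _ _ _ _ _ _ _ _ _ _ _] [p1 p1'] [p2 p2'].
move=> [k1 k1' _ _ k3 k3'] [l1 l1' _ _ l3 l3'].
have z1 : b1 = 0 by lia.
have z1' : b1' = 0 by lia.
have z3 : b3 = 0 by lia.
have z3' : b3' = 0 by lia.
have x1 : a1 = - c3' by lia.
have x1' : a1' = - c3 by lia.
have y1 : c1 = - c1' by lia.
have y3 : a3 = - a3' by lia.
subst b1 b1' b3 b3' c1 a3 a1 a1'; lia.
Qed.

(** The plane orthogonal to (1,-1,0) is spanned by (1,0,0) and (0,1,1), and B has trace 0 on it. The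
    integers c, x, b are chosen as the coefficients of the fixed-point equation 2 c s^2 - 4 x s + b
    = 0 in the coordinate of [tau8]; b c = 2 x^2 + 1 says that its discriminant is -8. *)
Lemma zeta8_entries B mu : gunit B -> gu mu ->
  mC B *m vC ((1, 0), (-1, 0), (0, 0)) = gC mu *: vC ((1, 0), (-1, 0), (0, 0)) ->
  (forall z, herm z (vC ((1, 0), (-1, 0), (0, 0))) = 0 ->
    mC B *m (mC B *m z) = 0 *: (mC B *m z) + - 'i *: z) ->
  exists c x b q1 q2 : int, [/\ b * c = 2 * x * x + 1, q1 - q2 = b + 2 * x, q1 + q2 = 2 * x + c &
    forall a, let p := x%:~R + (x + c)%:~R * 'i in
      let r := c%:~R * (1 - 'i) in
      mC B *m vec a 1 1 = vec (p * a + (q1%:~R + q2%:~R * 'i)) (r * a - p) (r * a - p)].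
Proof.
move=> uB um eB q.
have f1 := quarter_rel (z := ((1, 0), (0, 0), (0, 0))) uB q erefl.
have f2 := quarter_rel (z := ((0, 0), (1, 0), (1, 0))) uB q erefl.
have f3 := eig_perp_gv (z := ((1, 0), (0, 0), (0, 0))) uB um eB erefl.
have f4 := eig_perp_gv (z := ((0, 0), (1, 0), (1, 0))) uB um eB erefl.
have f5 : gapp B (gapp B ((1, 0), (0, 0), (0, 0))) = gscale (0, -1) ((1, 0), (0, 0), (0, 0)).
  have /= := f1 => /(congr1 (gapp B)) ->.
  have -> w : gapp B (gscale (0, -1) w) = gscale (0, -1) (gapp B w).
    apply: (@vC_inj R); rewrite vC_app !vC_scale vC_app scalemxAr //.
  by rewrite -gappM; have /gunitP[_ ->] := uB; rewrite gapp1.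
move: f1 f2 f3 f4 f5 {q eB}.
case: B uB => [[[[[a1 a1'] [a2 a2']] [a3 a3']] [[[b1 b1'] [b2 b2']] [b3 b3']]]
  [[[c1 c1'] [c2 c2']] [c3 c3']]] uB.
rewrite /gmm /ginv /gtr /gapp /gscale /gherm /gdot /gadd /gmul /gconj /gid /gdiag /gint /=.
move=> [k1 k1' k2 k2' k3 k3'] [l1 l1' l2 l2' l3 l3'] [p1 p1'] [p2 p2'].
move=> [m1 m1' m2 m2' m3 m3'].
have z1 : b1 = c1 by lia.
have z1' : b1' = c1' by lia.
have z2 : b2 + b3 = c2 + c3 by lia.
have z2' : b2' + b3' = c2' + c3' by lia.
have x1 : c1' = - c1 by lia.
subst b1 b1' c1'.
(* If c1 = 0, the vector (1,0,0) is an eigenvector, whose eigenvalue would be a Gaussian square root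
   of -i. *)
have nc : c1 <> 0.
  by move=> c0; subst c1; have : a1 * a1 = a1' * a1' by [lia]; move: m1'; nia.
have t0 : a1 + c2 + c3 + (a1' + c2' + c3') = 0.
  have : c1 * (a1 + c2 + c3 + (a1' + c2' + c3')) = 0 by lia.
  by move/eqP; rewrite mulf_eq0 => /orP[/eqP|/eqP].
have t0' : a1 + c2 + c3 - (a1' + c2' + c3') = 0.
  have : c1 * (a1 + c2 + c3 - (a1' + c2' + c3')) = 0 by lia.
  by move/eqP; rewrite mulf_eq0 => /orP[/eqP|/eqP].
have w1 : a1' = a1 + c1 by lia.
subst a1'.
have t1 : c2 + c3 = - a1 by lia.
have t2 : c2' + c3' = - (a1 + c1) by lia.
have s1 : a2 + a3 + (a2' + a3') = 2 * a1 + c1.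
  have : c1 * (a2 + a3 + (a2' + a3') - (2 * a1 + c1)) = 0 by lia.
  by move/eqP; rewrite mulf_eq0 => /orP[/eqP|/eqP]; lia.
exists c1, a1, (a2 + a3 - (a2' + a3') - 2 * a1), (a2 + a3), (a2' + a3').
split; [by lia|by lia|by lia|].
have b23 : b2 = c2 + c3 - b3 by lia.
have b23' : b2' = c2' + c3' - b3' by lia.
have c23 : c2 = - a1 - c3 by lia.
have c23' : c2' = - (a1 + c1) - c3' by lia.
subst b2 b2' c2 c2'.
move=> a; apply: vecP; rewrite appE !vec3E /gauss_mx /mx3 !mxE /= /gauss /=.
- by rewrite !(rmorphD, rmorphN) /=; ring.
- by rewrite !(rmorphD, rmorphN) /=; ring.
- by rewrite !(rmorphD, rmorphN) /=; ring.
Qed.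
End Orbits.

(** * Algebraic values of the roots of unity *)

Section RootsOfUnity.
Variable R : realType.
Local Notation K := (C R).
Local Notation cR := (fun x : R => real_complex R x : K).

Lemma zetaE k : zeta R k = cR (cos (2 * pi / k%:R)) + 'i * cR (sin (2 * pi / k%:R)).
Proof. by rewrite /zeta [LHS]complexE complexiE. Qed.

Lemma pi2_gt0 : 0 < pi / 2 :> R.
Proof. by rewrite divr_gt0 ?pi_gt0. Qed.

Lemma acute (n : R) : 1 < n -> - (pi / 2) < pi / 2 / n < pi / 2.
Proof.
move=> n1; have n0 : 0 < n by apply: lt_trans n1.
have p0 := pi2_gt0; have q0 : 0 < pi / 2 / n by rewrite divr_gt0.
rewrite (lt_trans _ q0) ?oppr_lt0//= ltr_pdivrMr// ltr_pMr//.
Qed.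

Lemma zeta8E : exists s : K, [/\ 0 < s, 2 * s * s = 1 & zeta R 8 = s * (1 + 'i)].
Proof.
pose t : R := pi / 2 / 2.
have et : 2 * pi / 8 = t by rewrite /t; field.
have ht : t *+ 2 = pi / 2 by rewrite /t mulr2n; field.
have /andP[t1 t2] : - (pi / 2) < t < pi / 2 by apply: acute; rewrite ltr1n.
have c0 : 0 < cos t by apply: cos_gt0_pihalf; rewrite t1.
have s0 : 0 < sin t by apply: sin_gt0_pihalf; rewrite t2 andbT /t divr_gt0 ?pi2_gt0.
have c2 : cos t ^+ 2 *+ 2 = 1.
  by have := cos_mulr2n t; rewrite ht cos_pihalf => /esym/eqP; rewrite subr_eq0 => /eqP.
have s2 : sin t ^+ 2 *+ 2 = 1.
  have := cos2Dsin2 t => h; have -> : sin t ^+ 2 = 1 - cos t ^+ 2 by rewrite -h; ring.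
  by rewrite mulrnBl c2; ring.
have e : sin t = cos t.
  apply/eqP; rewrite -(eqrXn2 (n := 2)) ?ltW//; apply/eqP.
  by apply: (@mulfI _ 2); rewrite ?pnatr_eq0// !mulr_natl c2 s2.
exists (cR (cos t)); split; first by rewrite ltcR.
  transitivity (real_complex R (cos t ^+ 2 *+ 2) : K); last by rewrite c2 rmorph1.
  by rewrite rmorphMn rmorphXn /=; ring.
by rewrite zetaE et e; ring.
Qed.

Lemma zeta12E : exists s : K, [/\ 0 < s, 4 * s * s = 3 & zeta R 12 = s + 'i / 2].
Proof.
pose t : R := pi / 2 / 3.
have et : 2 * pi / 12 = t by rewrite /t; field.
have ht : t *+ 2 + t = pi / 2 by rewrite /t mulr2n; field.
have /andP[t1 t2] : - (pi / 2) < t < pi / 2 by apply: acute; rewrite ltr1n.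
have c0 : 0 < cos t by apply: cos_gt0_pihalf; rewrite t1.
have s0 : 0 < sin t by apply: sin_gt0_pihalf; rewrite t2 andbT /t divr_gt0 ?pi2_gt0.
have cs := cos2Dsin2 t.
have c2 : cos t ^+ 2 = 1 - sin t ^+ 2 by rewrite -cs; ring.
(* sin(3t) = 1 for t = pi/6, and 4 s^3 - 3 s + 1 factors in this way. *)
have h : (sin t + 1) * (2 * sin t - 1) ^+ 2 = 0.
  have := sinD (t *+ 2) t; rewrite ht sin_pihalf sin_mulr2n cos_mulr2n => h.
  move: h cs; move: (cos t) (sin t) => c s h cs.
  transitivity (1 - (c * s *+ 2 * c + (c ^+ 2 *+ 2 - 1) * s) + 4 * s * (c ^+ 2 + s ^+ 2 - 1)).
    by ring.
  by rewrite cs -h; ring.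
have sE : sin t = 1 / 2.
  move/eqP: h; rewrite mulf_eq0 sqrf_eq0 => /orP[|] /eqP h.
    by have := s0; rewrite -[sin t](addrK 1) h; rewrite sub0r oppr_gt0 ltr10.
  by have -> : sin t = (2 * sin t - 1) / 2 + 1 / 2 by [field]; rewrite h mul0r add0r.
exists (cR (cos t)); split; first by rewrite ltcR.
  rewrite -[4](rmorph_nat (real_complex R) 4) -[3](rmorph_nat (real_complex R) 3) -!rmorphM.
  congr (real_complex R _); transitivity (4 * cos t ^+ 2); first by ring.
  by rewrite c2 sE; field.
by rewrite zetaE et sE fmorph_div rmorph1 rmorph_nat; field.
Qed.

Lemma zeta4E : zeta R 4 = 'i.
Proof.
have e : 2 * pi / 4 = pi / 2 :> R by field.
by rewrite zetaE e cos_pihalf sin_pihalf rmorph0 rmorph1 add0r mulr1.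
Qed.

Lemma zeta2E : zeta R 2 = -1.
Proof.
have e : 2 * pi / 2 = pi :> R by field.
by rewrite zetaE e cospi sinpi rmorphN rmorph1 rmorph0 mulr0 addr0.
Qed.
End RootsOfUnity.

(** * Reduction at discriminants -3 and -8 *)

Lemma round_double (b r : int) : r != 0 -> exists k, - `|r| <= b + 2 * r * k <= `|r|.
Proof.
move=> r0; have [|k hk] := @round_int b (2 * `|r|); first by lia.
have [rp|rn] : 0 < r \/ r < 0 by lia.
  by exists (- k); lia.
by exists k; lia.
Qed.

Section Descent.
Variable R : realType.
Local Notation K := (C R).
Local Notation vec := (@vec3 R).
Local Notation mC := (gauss_mx R).
Local Notation vC := (gauss_vec R).
Local Notation gC := (gauss R).

Lemma herm_vec (a b c : K) : herm (vec a b c) (vec a b c) = a * c^* + b * b^* + (a * c^*)^*.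
Proof. by rewrite hermE !vec3E rmorphM /= conjCK; ring. Qed.

(** For c = 1 and a = i s this is the translation s -> s + k. *)
Lemma korb_trans_im (k : int) (a b c : K) : korb (vec a b c) (vec (a + k%:~R * 'i * c) b c).
Proof.
exists (gtrans (0, 0) k), 1; rewrite gunit_trans oner_neq0 scale1r; split=> //.
apply: vecP; rewrite appE !vec3E /gauss_mx /gtrans /gint /gopp /gmul /gconj /gnorm /mx3 !mxE /=;
  rewrite /gauss /=; ring.
Qed.

Lemma korb_J (a b c : K) : korb (vec a b c) (vec c b a).
Proof.
exists gJ, 1; rewrite gunit_J oner_neq0 scale1r; split=> //.
by apply: vecP; rewrite appE !vec3E /gauss_mx /gJ /mx3 !mxE /= /gauss /=; ring.
Qed.

Lemma korb_vec (v : 'cV[K]_3) (d a b c : K) : d != 0 -> korb v (vec (d * a) (d * b) (d * c)) ->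
  korb v (vec a b c).
Proof.
move=> d0 h; apply: (korb_trans h).
have -> : vec a b c = d^-1 *: vec (d * a) (d * b) (d * c).
  by apply: vecP; rewrite [RHS]mxE !vec3E mulrA mulVf// mul1r.
by apply: korb_scale; rewrite invr_eq0.
Qed.

Let I2 : 'i * 'i = -1 :> K := ii R.
Let i_neq0 : 'i != 0 :> K. Proof. exact: neq0Ci. Qed.

(** A translation brings |b| down to at most |r|; then 4 r q = b^2 + 3 gives |q| < |r| unless |r| =
    1. The inversion s -> -1/s exchanges r and q. If |r| = 1, then b = 1 or -1, and one more
    translation fixes the sign. *)
Lemma omega_descent n (r b q : int) (s : K) : (`|r| <= n)%N -> b * b - 4 * r * q = -3 ->
  r%:~R * s * s + b%:~R * s + q%:~R = 0 ->
  herm (vec ('i * s) 0 1) (vec ('i * s) 0 1) < 0 ->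
  exists2 s', s' * s' - s' + 1 = 0 & korb (vec ('i * s) 0 1) (vec ('i * s') 0 1).
Proof.
elim: n r b q s => [|n IH] r b q s rn D e neg.
  by have r0 : r = 0 by [lia]; subst r; exfalso; nia.
have r0 : r != 0 by apply/eqP => r0; subst r; nia.
have [k hk] : exists k, - `|r| <= b + 2 * r * k <= `|r|.
  exact: round_double.
pose b' := b + 2 * r * k; pose q' := r * k * k + b * k + q; pose t := s - k%:~R.
have D' : b' * b' - 4 * r * q' = -3 by rewrite -D /b' /q'; ring.
have e' : r%:~R * t * t + b'%:~R * t + q'%:~R = 0.
  by rewrite -e /t /b' /q' !(rmorphD, rmorphM) /=; ring.
have h1 : korb (vec ('i * s) 0 1) (vec ('i * t) 0 1).
  have := korb_trans_im (- k) ('i * s) 0 1; congr korb; congr vec.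
  by rewrite /t rmorphN /=; ring.
have neg' := korb_neg h1 neg.
have [r1|r1] : `|r| = 1 \/ 1 < `|r| by lia.
  have b1 : b' = 1 \/ b' = -1.
    rewrite r1 -/b' in hk.
    have [b0|] : b' = 0 \/ (b' = 1 \/ b' = -1) by [lia]; last by [].
    by rewrite b0 in D'; lia.
  have rq : q' = r /\ r * r = 1.
    have [re|re] : r = 1 \/ r = -1 by [lia]; case: b1 => be; rewrite re be in D'; lia.
  have rr : (r%:~R : K) * r%:~R = 1 by rewrite -intrM rq.2.
  have e2 : t * t + (r * b')%:~R * t + 1 = 0.
    transitivity (r%:~R * (r%:~R * t * t + b'%:~R * t + q'%:~R)); last by rewrite e' mulr0.
    rewrite rq.1 rmorphM /=; transitivity ((r%:~R * r%:~R) * (t * t + 1) + r%:~R * b'%:~R * t); last by ring.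
    by rewrite rr; ring.
  have [rb|rb] : r * b' = -1 \/ r * b' = 1.
    by have [re|re] : r = 1 \/ r = -1 by [lia]; case: b1 => be; rewrite re be; lia.
    by exists t => //; rewrite -e2 rb; ring.
  exists (t + 1).
    by rewrite -e2 rb; ring.
  apply: (korb_trans h1); have := korb_trans_im 1 ('i * t) 0 1; congr korb; congr vec.
  by ring.
have q0 : (`|q'| < `|r|)%N by rewrite -/b' in hk; nia.
have t0 : t != 0.
  apply: contra_eq_neq e' => ->; rewrite !mulr0 !add0r intr_eq0.
  by apply/eqP => z; rewrite z in D'; nia.
have h2 : korb (vec ('i * s) 0 1) (vec ('i * (- t^-1)) 0 1).
  apply: (korb_trans h1); apply: (@korb_vec _ ('i * t)); first by rewrite mulf_neq0.
  have := korb_J ('i * t) 0 1; congr korb; congr vec; [|by ring|by ring].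
  by transitivity (- ('i * 'i) * (t / t)); [rewrite I2 divff//; ring|ring].
have [|||s' es' hs'] := IH q' (- b') r (- t^-1) _ _ _ (korb_neg h2 neg).
- by lia.
- by rewrite -D'; ring.
- transitivity ((r%:~R * t * t + b'%:~R * t + q'%:~R) / (t * t)); last by rewrite e' mul0r.
  by rewrite rmorphN /=; field.
by exists s'; [exact: es'|exact: korb_trans h2 hs'].
Qed.

(** The norm of (i s, 0, 1) is -2 Im s, which has opposite signs at the two roots t and 1 - t; only
    t = i / zeta_12 gives a negative vector. *)
Lemma omega_p5 (s : K) : s * s - s + 1 = 0 ->
  herm (vec ('i * s) 0 1) (vec ('i * s) 0 1) < 0 -> korb (vec ('i * s) 0 1) (vec 1 0 (- zeta R 12)).
Proof.
have [c [c0 c2 ->]] := zeta12E R; set z := c + 'i / 2 => e neg.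
have z2 : z * z = 'i * z + 1.
  transitivity (c * c + 'i * c + 'i * 'i / 4); first by rewrite /z; field.
  transitivity ('i * c + 'i * 'i / 2 + 1); last by rewrite /z; field.
  have -> : c * c = 3 / 4 by rewrite -c2; field.
  by rewrite I2; field.
have zn0 : z != 0.
  by apply: contra_eq_neq z2 => ->; rewrite !mulr0 add0r eq_sym oner_neq0.
pose t := 'i / z.
have te : t * t - t + 1 = 0.
  transitivity (('i * 'i - 'i * z + z * z) / (z * z)); first by rewrite /t; field.
  by rewrite z2 I2; apply/eqP; rewrite mulf_eq0; apply/orP; left; apply/eqP; ring.
have hc : c^* = c by apply: CrealP; apply: gtr0_real.
have : (s - t) * (s + t - 1) = 0.
  transitivity ((s * s - s + 1) - (t * t - t + 1)); first by ring.
  by rewrite e te subrr.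
have tz : vec ('i * t) 0 1 = (- z^-1) *: vec 1 0 (- z).
  apply: vecP; rewrite [RHS]mxE !vec3E; last by field.
    by transitivity (('i * 'i) / z); [rewrite /t; ring|rewrite I2; ring].
  by ring.
clearbody t.
move=> /eqP; rewrite mulf_eq0 subr_eq0 => /orP[/eqP ->|/eqP h].
  rewrite tz; apply: korb_sym; apply: korb_scale.
  by rewrite oppr_eq0 invr_eq0.
exfalso; have st : s = 1 - t by rewrite -[s](addrK t) -[s + t](subrK 1) h add0r.
have n5 : herm (vec 1 0 (- z)) (vec 1 0 (- z)) < 0.
  rewrite herm_vec mul1r !rmorphN mul0r addr0 /= conjCK -opprD oppr_lt0.
  rewrite /z rmorphD rmorphM fmorphV rmorph_nat /= conjCi hc.
  have -> : c + - 'i / 2 + (c + 'i / 2) = c + c by ring.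
  exact: addr_gt0.
have n5' : herm (vec ('i * t) 0 1) (vec ('i * t) 0 1) < 0.
  rewrite tz; apply: (korb_neg (korb_scale _ _) n5); by rewrite oppr_eq0 invr_eq0.
move: neg n5'; rewrite st !herm_vec rmorph1 !mulr1 mul0r !addr0.
rewrite !rmorphM /= conjCi rmorphB rmorph1.
have -> : 'i * (1 - t) + - 'i * (1 - t^*) = - ('i * t + - 'i * t^*) by ring.
by rewrite oppr_lt0 => h1 h2; have := lt_trans h1 h2; rewrite ltxx.
Qed.

(** J moves (1,-1,0) to (0,-1,1), so it cannot serve as inversion on the line orthogonal to
    (1,-1,0). This element induces there the Fricke involution of level 2. *)
Definition fricke : gm :=
  (((-1, 0), (-2, 0), (2, 1)), ((1, 1), (2, 1), (-1, -1)), ((1, 1), (1, 1), (0, -1))).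

(** A coordinate on the line orthogonal to (1,-1,0). The real part -1/2 cancels the norm of the
    middle coordinate, so ([tau8 s], 1, 1) has norm -2 Im s; the imaginary shift 1/2 gives [fricke]
    its simple form. *)
Definition tau8 (s : K) : K := - (1 - 'i) / 2 + 'i * s.

(* fricke fixes (1,-1,0) and acts on tau8 s by s |-> - 1 / (2 s) *)
Lemma korb_fricke (s : K) : s != 0 ->
  korb (vec (tau8 s) 1 1) (vec (tau8 (- (2 * s)^-1)) 1 1).
Proof.
move=> s0; have i1 : 'i - 1 != 0 :> K.
  rewrite subr_eq0; apply: contra_eq_neq I2 => ->.
  by rewrite mulr1 -subr_eq0 opprK -mulr2n pnatr_eq0.
apply: (@korb_vec _ (('i - 1) * s)); first exact: mulf_neq0.
exists fricke, 1; rewrite oner_neq0 scale1r; split=> //.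
have r0 : 'i * 'i + 1 = 0 :> K by rewrite I2 addNr.
apply: vecP; rewrite appE !vec3E /fricke /gauss_mx /mx3 !mxE /= /gauss /= /tau8.
- transitivity (('i - 1) * s * (- (1 - 'i) / 2 + 'i * - (2 * s)^-1) + ('i * 'i + 1) * (1 - s) / 2).
    by rewrite r0 mul0r mul0r addr0.
  by field.
- transitivity (('i - 1) * s * 1 + ('i * 'i + 1) * (1 / 2 + s)); first by rewrite r0 mul0r addr0.
  by field.
- transitivity (('i - 1) * s * 1 + ('i * 'i + 1) * (1 / 2 + s)); first by rewrite r0 mul0r addr0.
  by field.
Qed.

(** A translation achieves 2 |x| <= |c|; then |b| |c| = 2 x^2 + 1 <= c^2 / 2 + 1, which is below c^2
    for |c| >= 2. The involution s -> -1/(2s) exchanges b and c and negates x. *)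
Lemma zeta8_descent n (c x b : int) (s : K) : (`|c| <= n)%N -> b * c = 2 * x * x + 1 ->
  2 * c%:~R * s * s - 4 * x%:~R * s + b%:~R = 0 ->
  herm (vec (tau8 s) 1 1) (vec (tau8 s) 1 1) < 0 ->
  exists2 s', 2 * s' * s' + 1 = 0 & korb (vec (tau8 s) 1 1) (vec (tau8 s') 1 1).
Proof.
elim: n c x b s => [|n IH] c x b s cn D e neg.
  by have c0 : c = 0 by [lia]; subst c; exfalso; nia.
have c0 : c != 0 by apply/eqP => c0; subst c; nia.
have [k hk] : exists k, - `|c| <= 2 * (x - c * k) <= `|c|.
  have [k hk] := round_double (2 * x) c0; exists (- k); lia.
pose x' := x - c * k; pose b' := 2 * c * k * k - 4 * x * k + b; pose t := s - k%:~R.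
have D' : b' * c = 2 * x' * x' + 1 by rewrite /b' /x' mulrDl D; ring.
have e' : 2 * c%:~R * t * t - 4 * x'%:~R * t + b'%:~R = 0.
  by rewrite -e /t /b' /x' !(rmorphD, rmorphN, rmorphM) /=; ring.
have h1 : korb (vec (tau8 s) 1 1) (vec (tau8 t) 1 1).
  have := korb_trans_im (- k) (tau8 s) 1 1; congr korb; congr vec.
  by rewrite /tau8 /t rmorphN /=; ring.
have neg' := korb_neg h1 neg; rewrite -/x' in hk.
have [c1|c1] : `|c| = 1 \/ 1 < `|c| by lia.
  have x0 : x' = 0 by lia.
  have cc : (c%:~R : K) * c%:~R = 1.
    by rewrite -intrM; have -> : c * c = 1 by have [->|->] : c = 1 \/ c = -1 by lia.
  have bc : (b'%:~R : K) * c%:~R = 1 by rewrite -intrM D' x0.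
  exists t; [|exact: h1].
  transitivity (2 * (c%:~R * c%:~R) * t * t + b'%:~R * c%:~R); first by rewrite cc bc; ring.
  transitivity (c%:~R * (2 * c%:~R * t * t - 4 * x'%:~R * t + b'%:~R)).
    by rewrite x0; ring.
  by rewrite e' mulr0.
have q0 : (`|b'| < `|c|)%N.
  have : 4 * (`|b'| * `|c|) = 8 * (x' * x') + 4.
    rewrite -normrM D' ger0_norm; last by nia.
    by ring.
  by nia.
have t0 : t != 0.
  apply: contra_eq_neq e' => ->; rewrite !mulr0 oppr0 !add0r intr_eq0.
  by apply/eqP => z; rewrite z mul0r in D'; nia.
have h2 := korb_trans h1 (korb_fricke t0).
have [|||s' es' hs'] := IH b' (- x') c (- (2 * t)^-1) _ _ _ (korb_neg h2 neg).
- by lia.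
- by rewrite mulrC D'; ring.
- transitivity ((2 * c%:~R * t * t - 4 * x'%:~R * t + b'%:~R) / (2 * t * t)); last by rewrite e' mul0r.
  by rewrite rmorphN /=; field.
by exists s'; [exact: es'|exact: korb_trans h2 hs'].
Qed.

Lemma herm_tau8 (s : K) : herm (vec (tau8 s) 1 1) (vec (tau8 s) 1 1) = 'i * s + ('i * s)^*.
Proof.
have r2 : (2 : K)^* = 2 by rewrite rmorph_nat.
have -> // : forall w, w = 'i * s -> herm (vec (- (1 - 'i) / 2 + w) 1 1) (vec (- (1 - 'i) / 2 + w) 1 1) = w + w^*.
move=> w _; rewrite herm_vec rmorph1 !mulr1 rmorphD /=.
have -> : (- (1 - 'i) / 2 : K)^* = - (1 + 'i) / 2.
  by rewrite rmorphM rmorphN rmorphB rmorph1 fmorphV /= r2 conjCi opprK.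
by field.
Qed.

Lemma herm_p4 : herm (vec 1 ('i * (zeta R 8 - 1)) ('i * (zeta R 8 - 1)))
  (vec 1 ('i * (zeta R 8 - 1)) ('i * (zeta R 8 - 1))) < 0.
Proof.
have [c [c0 c2 ->]] := zeta8E R.
have hc : c^* = c by apply: CrealP; apply: gtr0_real.
rewrite herm_vec; set x := 'i * _.
have hx : x^* = - 'i * (c * (1 - 'i) - 1).
  by rewrite /x rmorphM rmorphB rmorphM rmorphD !rmorph1 /= conjCi hc.
rewrite mul1r conjCK hx /x.
have -> : - 'i * (c * (1 - 'i) - 1) + 'i * (c * (1 + 'i) - 1) * (- 'i * (c * (1 - 'i) - 1))
   + 'i * (c * (1 + 'i) - 1) = 2 * c * ('i * 'i) - ('i * 'i) * ((c - 1) * (c - 1) - 'i * 'i * c * c) :> K.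
  by ring.
rewrite I2; have -> : 2 * c * -1 - -1 * ((c - 1) * (c - 1) - -1 * c * c) = 2 * c * c + 1 - 4 * c :> K by ring.
rewrite c2 subr_lt0.
have -> : 1 + 1 = 2 :> K by [].
(* The norm is 2 - 4 c with 2 c^2 = 1, so comparing squares reduces the claim to 4 < 8. *)
rewrite -(ltr_pXn2r (n := 2)) ?nnegrE ?mulr_ge0 ?ltW //.
have -> : (4 * c) ^+ 2 = 8 * (2 * c * c) by ring.
rewrite c2 mulr1 -natrX ltr_nat //.
Qed.

(** The roots are t and -t with t = i / sqrt 2, and they give norms of opposite signs. The vector at
    t is proportional to the given point because [tau8 t] is the inverse of i (zeta_8 - 1). *)
Lemma zeta8_p4 (s : K) : 2 * s * s + 1 = 0 ->
  herm (vec (tau8 s) 1 1) (vec (tau8 s) 1 1) < 0 ->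
  korb (vec (tau8 s) 1 1) (vec 1 ('i * (zeta R 8 - 1)) ('i * (zeta R 8 - 1))).
Proof.
have n4 := herm_p4; move: n4.
have [c [c0 c2 ->]] := zeta8E R; set z := 'i * (c * (1 + 'i) - 1) => n4 e neg.
pose t := 'i * c.
have te : 2 * t * t + 1 = 0.
  transitivity (('i * 'i) * (2 * c * c) + 1); first by rewrite /t; ring.
  by rewrite I2 c2; ring.
have tz : tau8 t * z = 1.
  have -> : tau8 t = - (1 - 'i) / 2 - c.
    transitivity (- (1 - 'i) / 2 + ('i * 'i) * c); first by rewrite /tau8 /t; ring.
    by rewrite I2; ring.
  have -> : z = 'i * (c - 1) - c.
    transitivity ('i * (c - 1) + ('i * 'i) * c); first by rewrite /z; ring.
    by rewrite I2; ring.
  transitivity ((1 + 'i) / 2 + (1 - 'i) * (2 * c * c) / 2 + ('i * 'i + 1) * (c - 1) / 2).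
    by field.
  by rewrite I2 c2; field.
clearbody z.
have z0 : z != 0 by apply: contra_eq_neq tz => ->; rewrite mulr0 eq_sym oner_neq0.
have ht : korb (vec (tau8 t) 1 1) (vec 1 z z).
  have -> : vec 1 z z = z *: vec (tau8 t) 1 1.
    by apply: vecP; rewrite [RHS]mxE !vec3E ?mulr1// mulrC tz.
  exact: korb_scale.
have nt := korb_neg (korb_sym ht) n4.
have : (s - t) * (s + t) = 0.
  transitivity (((2 * s * s + 1) - (2 * t * t + 1)) / 2); first by field.
  by rewrite e te subrr mul0r.
move=> /eqP; rewrite mulf_eq0 subr_eq0 addr_eq0 => /orP[/eqP -> //|/eqP st].
exfalso; move: neg nt; rewrite st !herm_tau8 mulrN rmorphN -opprD oppr_lt0 => h1 h2.
by have := lt_trans h1 h2; rewrite ltxx.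
Qed.
End Descent.

(** * Classification of the isolated fixed points *)

Lemma sqr_div_1 (s k : int) : 0 <= k -> s * s * k = 1 -> 0 < s -> s = 1.
Proof. by move=> k0 e s0; have := @sqr_div_bound s k 1 1 k0 isT e; lia. Qed.

Lemma sqr_div_2 (s k : int) : 0 <= k -> s * s * k = 2 -> 0 < s -> s = 1.
Proof. by move=> k0 e s0; have := @sqr_div_bound s k 2 1 k0 isT e; lia. Qed.

Lemma sqr_div_9 (s k : int) : 0 <= k -> s * s * k = 9 -> 0 < s -> s = 1 \/ s = 3.
Proof.
move=> k0 e s0; have h := @sqr_div_bound s k 9 3 k0 isT e.
have [s1|[s1|s1]] : s = 1 \/ s = 2 \/ s = 3 by lia.
- by left.
- by subst s; lia.
- by right.
Qed.

Lemma not_even_perp u y : even_perp u -> gherm y u = (0, 0) -> gsq y = 1 -> False.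
Proof. by move=> ep h1 h2; have [k] := ep y h1; rewrite h2; lia. Qed.

Section Classification.
Variable R : realType.
Local Notation K := (C R).
Local Notation vec := (@vec3 R).
Local Notation mC := (gauss_mx R).
Local Notation vC := (gauss_vec R).
Local Notation gC := (gauss R).
Implicit Types (A B : gm).

Lemma lattice_pos (u : gv) c (w : 'cV[K]_3) : c != 0 -> vC u = c *: w -> 0 < herm w w -> 0 < gsq u.
Proof.
move=> c0 eu w0; rewrite -(ltr_int K) -herm_vCs eu hermZl hermZr mulrA.
by rewrite pmulr_lgt0// lt_neqAle eq_sym mulC_conj_eq0 c0 mulC_conj_ge0.
Qed.

Lemma perp_scale c (u w z : 'cV[K]_3) : c != 0 -> u = c *: w -> herm z u = 0 -> herm z w = 0.
Proof.
by move=> c0 ->; rewrite hermZr => /eqP; rewrite mulf_eq0 conjC_eq0 (negPf c0) /= => /eqP.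
Qed.

Lemma mC_quad_eig B x y z (w : 'cV[K]_3) l : mC B *m w = l *: w ->
  mC (gquad B x y z) *m w = (gC x * l * l + gC y * l + gC z) *: w.
Proof. by move=> e; rewrite mC_quad e -scalemxAr e !scalerA -!scalerDl. Qed.

Lemma perp_e2 (v : 'cV[K]_3) : herm v v < 0 -> herm v (vC ((0, 0), (1, 0), (0, 0))) = 0 ->
  exists d a, [/\ d != 0, v = d *: vec a 0 1 & korb v (vec a 0 1)].
Proof.
move=> v0; rewrite hermE /gauss_vec !vec3E /= gC0 gC1 rmorph0 rmorph1 !mul0r mul1r add0r addr0 => v1.
have v3 := neg_lead v0; exists (v i2 0), (v i0 0 / v i2 0).
have e : v = v i2 0 *: vec (v i0 0 / v i2 0) 0 1.
  by apply: vecP; rewrite [RHS]mxE vec3E ?v1; [field|ring|ring].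
by split; [exact: v3|exact: e|move: (korb_sym (korb_scale (vec (v i0 0 / v i2 0) 0 1) v3)); rewrite -e].
Qed.

Lemma perp_110 (v : 'cV[K]_3) : herm v v < 0 -> herm v (vC ((1, 0), (-1, 0), (0, 0))) = 0 ->
  exists d a, [/\ d != 0, v = d *: vec a 1 1 & korb v (vec a 1 1)].
Proof.
move=> v0; rewrite hermE /gauss_vec !vec3E /= gC0 gC1 (gC_int R (-1)) rmorphN rmorph0 !rmorph1.
rewrite mul0r add0r mulN1r mul1r addrC => /eqP; rewrite subr_eq0 => /eqP v1.
have v3 := neg_lead v0; exists (v i2 0), (v i0 0 / v i2 0).
have e : v = v i2 0 *: vec (v i0 0 / v i2 0) 1 1.
  by apply: vecP; rewrite [RHS]mxE vec3E -?v1; [field|ring|ring].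
by split; [exact: v3|exact: e|move: (korb_sym (korb_scale (vec (v i0 0 / v i2 0) 1 1) v3)); rewrite -e].
Qed.

(** B^2 + B + 1 kills the complement of w and multiplies w by mu^2 + mu + 1, of squared modulus 1 or
    9, so the generator u of the line of w has norm 1 or 3. Parity on its complement excludes
    (1,1,1) and (1,-1,0), and u can be moved to (0,1,0). *)
Lemma omega_orbit (v : 'cV[K]_3) : herm v v < 0 -> omega_type v -> korb v (vec 1 0 (- zeta R 12)).
Proof.
move=> v0 [B [m [mu [w [y [[uB um em] [o ww yy] [ev ew ey]]]]]]].
have [wv yv yw] := o; have v0' := ltr0_neq0 v0.
have ww' := lt0r_neq0 ww; have yy' := lt0r_neq0 yy.
have o' : orth3 w v y := And3 (herm_sym0 wv) yw yv.
have q z : herm z w = 0 -> mC B *m (mC B *m z) = -1 *: (mC B *m z) + -1 *: z.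
  move=> zw; rewrite (quad_kill o' ww' v0' yy' ev ey zw).
  have -> : m + (-1 - m) = -1 by ring.
  have -> : m * (-1 - m) = 1 by transitivity (1 - (m * m + m + 1)); [ring|rewrite em subr0].
  by rewrite scale1r [-1 *: z]scaleN1r.
pose phi := gadd (gadd (gmul mu mu) mu) (1, 0).
have phiC : gC phi = gC mu * gC mu + gC mu + 1 by rewrite !gCD gCM gC1.
have phin : phi != (0, 0) /\ (gnorm phi = 1 \/ gnorm phi = 9).
  by rewrite /phi; case: (gu_cases um) => ->; split=> //; [right|left|left|left].
have [u [c [k [c0 eu hk]]]] : exists u c k, [/\ c != 0, vC u = c *: w &
    gsq u * gsq u * gnorm k = gnorm phi].
  apply: (projector_norm (F := gquad B (1, 0) (1, 0) (1, 0)) ww' phin.1).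
    by rewrite (mC_quad_eig _ _ _ ew) gC1 !mul1r phiC.
  move=> z zw; rewrite mC_quad q// gC1 !scale1r !scaleN1r -opprD addrAC -addrA.
  by rewrite [z + _]addrC addNr.
have u0 := lattice_pos c0 eu ww.
have su : gsq u = 1 \/ gsq u = 3.
  have k0 := gnorm_ge0 k.
  by case: phin => _ [] h; rewrite h in hk; [left; exact: sqr_div_1 k0 hk u0|exact: sqr_div_9 k0 hk u0].
have qu z : herm z (vC u) = 0 -> mC B *m (mC B *m z) = -1 *: (mC B *m z) + -1 *: z.
  by move=> zu; apply: q; exact: perp_scale c0 eu zu.
have ep : even_perp u.
  by apply: (@even_perp_cubic R B u uB) => z zu; rewrite qu// !scaleN1r.
have [h uh eh] : geqv u ((0, 0), (1, 0), (0, 0)).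
  case: su => s; last first.
    have e := norm_p3 s.
    by case: (@not_even_perp _ ((1, 0), (-1, 0), (0, 0)) (even_perp_geqv e ep) erefl erefl).
  have [//|e] := norm_p1 s.
  by case: (@not_even_perp _ ((0, 0), (1, 0), (1, 0)) (even_perp_geqv e ep) erefl erefl).
have eh' : mC h *m vC u = vC ((0, 0), (1, 0), (0, 0)) by rewrite -vC_app eh.
have vu : herm v (vC u) = 0 by rewrite eu hermZr (herm_sym0 wv) mulr0.
have eBu : mC B *m vC u = gC mu *: vC u by rewrite eu -scalemxAr ew !scalerA mulrC.
have [[uB' v0'' vu'] ev' eu' q'] := transport uh uB eh' v0 vu ev eBu qu.
have [s [r [q0 [qr Bv]]]] := omega_entries uB' um eu' q'.
have [d [a [d0 ed kd]]] := perp_e2 v0'' vu'.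
have korb1 : korb v (vec a 0 1) := korb_trans (korb_app v uh) kd.
have : mC (conjg h B) *m vec a 0 1 = m *: vec a 0 1.
  by apply: (scalerI d0); rewrite scalemxAr -ed ev' ed !scalerA mulrC.
rewrite Bv => e; have e1 : (-1 - s%:~R) * a + q0%:~R * 'i = m * a.
  by have /matrixP/(_ i0 0) := e; rewrite [RHS]mxE !vec3E.
have e2 : r%:~R * 'i * a + s%:~R = m.
  by have /matrixP/(_ i2 0) := e; rewrite [RHS]mxE !vec3E mulr1.
have [t at_] : exists t, a = 'i * t by exists (- 'i * a); rewrite mulrA mulrN (ii R) opprK mul1r.
subst a.
(* The eigenvector equation with m eliminated; its discriminant is (2s+1)^2 - 4 q r = -3. *)
have et : r%:~R * t * t + (- (2 * s + 1))%:~R * t + q0%:~R = 0.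
  have h0 : (-1 - s%:~R) * ('i * t) + q0%:~R * 'i - (r%:~R * 'i * ('i * t) + s%:~R) * ('i * t) = 0.
    by rewrite e1 e2 subrr.
  apply: (mulfI (neq0Ci K)); rewrite mulr0 -h0.
  transitivity ('i * (- (1 + 2 * s%:~R) * t + q0%:~R - r%:~R * ('i * 'i) * t * t)); last by ring.
  by rewrite (ii R) !(rmorphN, rmorphD, rmorphM) /=; ring.
have nv : herm (vec ('i * t) 0 1) (vec ('i * t) 0 1) < 0.
  exact: korb_neg korb1 v0.
have D : - (2 * s + 1) * - (2 * s + 1) - 4 * r * q0 = -3.
  by rewrite -mulrA (mulrC r) qr; ring.
have [t' et' kt] := omega_descent (leqnn `|r|%N) D et nv.
apply: (korb_trans korb1); apply: (korb_trans kt).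
exact: omega_p5 et' (korb_neg kt nv).
Qed.

(** B^2 + i kills the complement of w and multiplies w by mu^2 + i, of squared modulus 2, so the
    generator of the line of w has norm 1. Parity excludes (0,1,0), which leaves (1,-1,0). *)
Lemma zeta8_orbit (v : 'cV[K]_3) : herm v v < 0 -> zeta8_type v ->
  korb v (vec 1 ('i * (zeta R 8 - 1)) ('i * (zeta R 8 - 1))).
Proof.
move=> v0 [B [m [mu [w [y [[uB um em] [o ww yy] [ev ew ey]]]]]]].
have [wv yv yw] := o; have v0' := ltr0_neq0 v0.
have ww' := lt0r_neq0 ww; have yy' := lt0r_neq0 yy.
have o' : orth3 w v y := And3 (herm_sym0 wv) yw yv.
have q z : herm z w = 0 -> mC B *m (mC B *m z) = 0 *: (mC B *m z) + - 'i *: z.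
  move=> zw; rewrite (quad_kill o' ww' v0' yy' ev ey zw).
  by rewrite subrr mulrN em opprK scaleNr.
pose phi := gadd (gmul mu mu) (0, 1).
have phiC : gC phi = gC mu * gC mu + 'i by rewrite !gCD gCM gCi.
have phin : phi != (0, 0) /\ gnorm phi = 2.
  by rewrite /phi; case: (gu_cases um) => ->.
have [u [c [k [c0 eu hk]]]] : exists u c k, [/\ c != 0, vC u = c *: w &
    gsq u * gsq u * gnorm k = gnorm phi].
  apply: (projector_norm (F := gquad B (1, 0) (0, 0) (0, 1)) ww' phin.1).
    by rewrite (mC_quad_eig _ _ _ ew) gC1 gC0 gCi mul1r mul0r addr0 phiC.
  move=> z zw; rewrite mC_quad q// gC1 gC0 gCi !scale0r scale1r addr0 add0r scaleNr.
  by rewrite addNr.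
have u0 := lattice_pos c0 eu ww; rewrite phin.2 in hk.
have su := sqr_div_2 (gnorm_ge0 k) hk u0.
have qu z : herm z (vC u) = 0 -> mC B *m (mC B *m z) = 0 *: (mC B *m z) + - 'i *: z.
  by move=> zu; apply: q; exact: perp_scale c0 eu zu.
have vu : herm v (vC u) = 0 by rewrite eu hermZr (herm_sym0 wv) mulr0.
have eBu : mC B *m vC u = gC mu *: vC u by rewrite eu -scalemxAr ew !scalerA mulrC.
have [[h uh eh]|[h uh eh]] := norm_p1 su.
  have eh' : mC h *m vC u = vC ((0, 0), (1, 0), (0, 0)) by rewrite -vC_app eh.
  have [[uB' v0'' vu'] ev' eu' q'] := transport uh uB eh' v0 vu ev eBu qu.
  by case: (zeta8_even_contra uB' um eu' q').
have eh' : mC h *m vC u = vC ((1, 0), (-1, 0), (0, 0)) by rewrite -vC_app eh.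
have [[uB' v0'' vu'] ev' eu' q'] := transport uh uB eh' v0 vu ev eBu qu.
have [c' [x [b [q1 [q2 [bc hq1 hq2 Bv]]]]]] := zeta8_entries uB' um eu' q'.
have [d [a [d0 ed kd]]] := perp_110 v0'' vu'.
have korb1 : korb v (vec a 1 1) := korb_trans (korb_app v uh) kd.
have : mC (conjg h B) *m vec a 1 1 = m *: vec a 1 1.
  by apply: (scalerI d0); rewrite scalemxAr -ed ev' ed !scalerA mulrC.
rewrite Bv => e.
have /matrixP/(_ i0 0) := e; rewrite [RHS]mxE !vec3E => e1.
have /matrixP/(_ i2 0) := e; rewrite [RHS]mxE !vec3E mulr1 => e2.
have [t at_] : exists t, a = tau8 t.
  by exists (- 'i * (a + (1 - 'i) / 2)); rewrite /tau8 mulrA mulrN (ii R) opprK mul1r; field.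
subst a.
have et : 2 * c'%:~R * t * t - 4 * x%:~R * t + b%:~R = 0.
  have h0 : c'%:~R * (1 - 'i) * tau8 t * tau8 t - (x%:~R + (x + c')%:~R * 'i) * tau8 t * 2 -
     (q1%:~R + q2%:~R * 'i) = 0 :> K.
    transitivity (m * tau8 t - m * tau8 t); last by rewrite subrr.
    by rewrite -{1}e2 -e1; ring.
  have hb : (b%:~R : K) = q1%:~R - q2%:~R - 2 * x%:~R.
    by rewrite -intrB hq1 !(rmorphD, rmorphM) /=; ring.
  have hq : (q1%:~R : K) + q2%:~R = 2 * x%:~R + c'%:~R.
    by rewrite -intrD hq2 !(rmorphD, rmorphM) /=.
  have hq1' : (q1%:~R : K) = (b%:~R + 4 * x%:~R + c'%:~R) / 2.
    by rewrite hb; transitivity ((q1%:~R - q2%:~R + (2 * x%:~R + c'%:~R)) / 2 : K); [rewrite -hq; field|field].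
  have hq2' : (q2%:~R : K) = (c'%:~R - b%:~R) / 2.
    by rewrite hb; transitivity (((2 * x%:~R + c'%:~R) - (q1%:~R - q2%:~R)) / 2 : K); [rewrite -hq; field|field].
  have i1 : - (1 - 'i) / 2 != 0 :> K.
    rewrite mulf_neq0 ?invr_eq0 ?pnatr_eq0// oppr_eq0 subr_eq0.
    apply: contra_eq_neq (ii R) => <-.
    by rewrite mulr1 -subr_eq0 opprK -mulr2n pnatr_eq0.
  apply: (mulfI i1); rewrite mulr0 -h0 hq1' hq2' /tau8 rmorphD /=.
  have r0 : 'i * 'i = -1 :> K := ii R.
  move: (c'%:~R : K) (x%:~R : K) (b%:~R : K) (t) => C0 X0 B0 T0.
  have red (p1 p2 p3 : K) : p1 = p2 + p3 * ('i * 'i + 1) -> p1 = p2.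
    by move=> ->; rewrite r0 addNr mulr0 addr0.
  (* The two sides agree only modulo i^2 + 1; the argument is the cofactor. *)
  apply: (red _ _ (- (C0 * (1 / 2 + T0) * (1 / 2 + T0) + C0 * (1 / 2 + T0)
    - 2 * (X0 + C0) * (1 / 2 + T0) - 'i * C0 * (1 / 2 + T0) * (1 / 2 + T0)))).
  by field.
have nv : herm (vec (tau8 t) 1 1) (vec (tau8 t) 1 1) < 0.
  exact: korb_neg korb1 v0.
have [t' et' kt] := zeta8_descent (leqnn `|c'|%N) bc et nv.
apply: (korb_trans korb1); apply: (korb_trans kt).
exact: zeta8_p4 et' (korb_neg kt nv).
Qed.

Definition points : seq ('cV[K]_3) :=
  [:: vec (1 + 'i) (- 'i) (- 1 - 'i); vec 1 0 (- 1); vec 1 (- 1) (- 1);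
      vec 1 ('i * (zeta R 8 - 1)) ('i * (zeta R 8 - 1)); vec 1 0 (- zeta R 12)].

Lemma vC_p1 : vC ((1, 1), (0, -1), (-1, -1)) = vec (1 + 'i) (- 'i) (- 1 - 'i).
Proof. by apply: vecP; rewrite /gauss_vec !vec3E /gauss /=; ring. Qed.

Lemma vC_p2 : vC ((1, 0), (0, 0), (-1, 0)) = vec 1 0 (- 1).
Proof. by apply: vecP; rewrite /gauss_vec !vec3E /gauss /=; ring. Qed.

Lemma vC_p3 : vC ((1, 0), (-1, 0), (-1, 0)) = vec 1 (- 1) (- 1).
Proof. by apply: vecP; rewrite /gauss_vec !vec3E /gauss /=; ring. Qed.

Lemma isolated_korb (v : 'cV[K]_3) : herm v v < 0 ->
  isolated_fixed_point (isotropy <[v]>%VS) <[v]>%VS ->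
  exists k : 'I_5, korb v (nth 0 points k).
Proof.
move=> v0 /(isolated_selects v0)[A [l [uA ev iso]]].
have P k (h : (k < 5)%N) : korb v (nth 0 points k) -> exists k : 'I_5, korb v (nth 0 points k).
  by exists (Ordinal h).
case: (trichotomy uA v0 ev iso) => [g|g|g].
- case: (gauss_orbit v0 g); rewrite ?vC_p1 ?vC_p2 ?vC_p3 => h.
  + exact: (P 0%N).
  + exact: (P 1%N).
  + exact: (P 2%N).
- by apply: (P 4%N) => //; exact: omega_orbit.
- by apply: (P 3%N) => //; exact: zeta8_orbit.
Qed.
End Classification.

(** * Groups and reflections *)

Definition gunits : seq gi := [:: (1, 0); (0, 1); (-1, 0); (0, -1)].

Lemma mem_gunits u : gu u -> u \in gunits.
Proof. by move=> /gu_cases[] ->. Qed.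

Lemma gu_gunits u : u \in gunits -> gu u.
Proof. by rewrite !inE => /or4P[] /eqP ->. Qed.

Definition gproj (A B : gm) : bool := has (fun u => gscalem u A == B) gunits.

Definition gword (l : seq gm) : gm := foldr gmm gid l.

(* the matrix of y |-> y + c <y,w> w *)
Definition grefl (c : gi) (w : gv) : gm :=
  let: (w1, w2, w3) := w in
  let f x y := gmul c (gmul x (gconj y)) in
  ((gadd (1, 0) (f w1 w3), f w1 w2, f w1 w1),
   (f w2 w3, gadd (1, 0) (f w2 w2), f w2 w1),
   (f w3 w3, f w3 w2, gadd (1, 0) (f w3 w1))).

Section Classes.
Variable R : realType.
Local Notation K := (C R).
Local Notation vec := (@vec3 R).
Local Notation mC := (gauss_mx R).
Local Notation vC := (gauss_vec R).
Local Notation gC := (gauss R).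
Implicit Types (A B : gm).

Definition gauss_class A : mxclass R := <[mC A]>%VS.

Lemma cl_neq0 A : gunit A -> mC A != 0.
Proof. by move=> uA; exact: unitmx_neq0 (mC_unitmx R uA).1. Qed.

Lemma mulmx_act_inj (A B : 'M[K]_3) : (forall v : 'cV[K]_3, A *m v = B *m v) -> A = B.
Proof.
move=> h; apply/matrixP => i j; have /matrixP/(_ i 0) := h (delta_mx j 0).
by rewrite -!colE !mxE.
Qed.

(** If B = c A, then c is an entry of B A^{-1} and has modulus 1, so it is a Gaussian unit. Equality
    in PU(J) is thus decided by four comparisons. *)
Lemma cl_eqP A B : gunit A -> gunit B -> reflect (gauss_class A = gauss_class B) (gproj A B).
Proof.
move=> uA uB; apply: (iffP hasP) => [[u ue /eqP <-]|].
  have uu := gu_gunits ue; apply/esym/lineP; first exact: cl_neq0.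
  exists (gC u); last by rewrite mC_scalem.
  by rewrite gC_eq0; apply: contraTneq uu => ->.
move=> /esym/(lineP _ (cl_neq0 uA))[c c0 e].
have h : mC (gmm B (ginv A)) = c%:M.
  by rewrite mCM e -scalemxAl -mCM; have /gunitP[_ ->] := uA; rewrite mC1 scalemx1.
have [x ex] : exists x, c = gC x.
  by have [x hx] := (gaussIntP _).1 (mC_gauss R (gmm B (ginv A)) i0 i0); exists x;
     rewrite -hx h mxE.
have ux : gu x.
  rewrite (gu_norm R) -ex; apply/eqP.
  pose v := vec 0 1 0; have hv : herm v v = 1 by rewrite herm_vec !mul0r conjC0 rmorph1; ring.
  have := herm_gunit v v uB; rewrite e -scalemxAl hermZl hermZr herm_gunit// hv mulr1 //.
exists x; first exact: mem_gunits.
by apply/eqP; apply: (@mC_inj R); rewrite mC_scalem -ex e.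
Qed.

Lemma cl_mul A B : (gauss_class A * gauss_class B)%VS = gauss_class (gmm A B).
Proof. by rewrite /gauss_class prodv_line mCM. Qed.

Lemma cl1 : gauss_class gid = 1%VS.
Proof. by rewrite /gauss_class mC1. Qed.

Lemma cl_mulV A : gunit A -> (gauss_class A * gauss_class (ginv A))%VS = 1%VS.
Proof. by move=> /gunitP[_ h]; rewrite cl_mul h cl1. Qed.

Lemma cl_PUJ A : gunit A -> PUJ (gauss_class A).
Proof. by move=> uA; exists (mC A) => //; exact: UJ_mC. Qed.

Lemma subgroup_word (H : set (mxclass R)) l : is_subgroup H ->
  (forall g, g \in l -> H (gauss_class g)) -> H (gauss_class (gword l)).
Proof.
move=> [_ h1 hM _]; elim: l => [|g l IH] h; first by rewrite /= cl1.
rewrite /= -cl_mul; apply: hM; first by apply: h; rewrite inE eqxx.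
by apply: IH => x xl; apply: h; rewrite inE xl orbT.
Qed.

Lemma isotropy_subgroup (v : 'cV[K]_3) : v != 0 -> is_subgroup (isotropy <[v]>%VS).
Proof.
move=> v0; split.
- by move=> g /(isotropyP _ v0)[B [c [uB -> _]]]; exact: cl_PUJ.
- by apply/(isotropyP _ v0); exists gid, 1; rewrite gunit1 mC1 mul1mx scale1r -cl1.
- move=> _ _ /(isotropyP _ v0)[A [c [uA -> eA]]] /(isotropyP _ v0)[B [d [uB -> eB]]].
  apply/(isotropyP _ v0); exists (gmm A B), (d * c); split; [exact: gunitM|exact: cl_mul|].
  by rewrite mCM -mulmxA eB -scalemxAr eA scalerA.
- move=> _ /(isotropyP _ v0)[A [c [uA -> eA]]]; exists (gauss_class (ginv A)); last exact: cl_mulV.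
  apply/(isotropyP _ v0); exists (ginv A), c^-1; split; [exact: gunitV|by []|].
  have c0 : c != 0.
    by apply: contra_neq (unit_mx_app (mC_unitmx R uA).1 v0) => c0; rewrite eA c0 scale0r.
  by apply: (scalerI c0); rewrite scalerA divff// scale1r scalemxAr -eA mC_V.
Qed.

Definition cls (l : seq gm) : set (mxclass R) := [set x | exists2 g, g \in l & x = gauss_class g].

Definition distinct_classes (l : seq gm) : bool :=
  pairwise (fun A B => ~~ gproj A B) l.

Lemma card_cls l : all gunit l -> distinct_classes l -> cls l #= `I_(size l).
Proof.
move=> /allP ul /(pairwiseP gid) pw.
have -> : cls l = (fun k => gauss_class (nth gid l k)) @` `I_(size l).
  apply/seteqP; split=> [_ [g gl ->]|_ [k kl <-]]; last by exists (nth gid l k); rewrite ?mem_nth.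
  by exists (index g l); rewrite /= ?index_mem// nth_index.
apply: inj_card_eq => i j /set_mem /= il /set_mem /= jl.
have h a b : (a < size l)%N -> (b < size l)%N -> (a < b)%N -> gauss_class (nth gid l a) <> gauss_class (nth gid l b).
  move=> al bl ab /(cl_eqP (ul _ (mem_nth _ al)) (ul _ (mem_nth _ bl))).
  by apply/negP; exact: pw.
case: (ltngtP i j) => // ij e; [by case: (h i j)|by case: (h j i)].
Qed.

Definition complete (v : 'cV[K]_3) (l : seq gm) : Prop :=
  forall B c, gunit B -> mC B *m v = c *: v -> exists2 g, g \in l & gproj g B.

Lemma isotropy_cls (v : 'cV[K]_3) l : v != 0 -> all gunit l ->
  (forall g, g \in l -> exists c, mC g *m v = c *: v) -> complete v l ->
  isotropy <[v]>%VS = cls l.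
Proof.
move=> v0 /allP ul s c; apply/seteqP; split=> [_ /(isotropyP _ v0)[B [d [uB -> eB]]]|_ [g gl ->]].
  have [g gl gB] := c B d uB eB; exists g => //; apply/esym; apply/cl_eqP => //; exact: ul.
apply/(isotropyP _ v0); have [d ed] := s g gl; exists g, d; split=> //; exact: ul.
Qed.

Lemma generated_words (v : 'cV[K]_3) (S : set (mxclass R)) (ws : seq (seq gm)) : v != 0 ->
  isotropy <[v]>%VS = cls (map gword ws) -> S `<=` isotropy <[v]>%VS ->
  (forall w g, w \in ws -> g \in w -> S (gauss_class g)) -> isotropy <[v]>%VS = generated S.
Proof.
move=> v0 e sub h; apply/seteqP; split; last first.
  by apply: smallest_sub => //; exact: isotropy_subgroup.
rewrite e => _ [_ /mapP[w wl ->] ->] H [sH SH].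
by apply: subgroup_word => // g gw; apply: SH; exact: h gw.
Qed.

Lemma grefl_app c w (y : 'cV[K]_3) :
  mC (grefl c w) *m y = y + (gC c * herm y (vC w)) *: vC w.
Proof.
case: w => [[w1 w2] w3]; apply: vecP; rewrite appE hermE [RHS]mxE [X in _ = _ + X]mxE /gauss_vec !vec3E.
all: rewrite /grefl /gauss_mx /mx3 !mxE /= ?gCD !gCM !gC_conj ?gC1; ring.
Qed.

Lemma rank1_app s (w y : 'cV[K]_3) :
  (1%:M + s *: (w *m w ^t* *m J R)) *m y = y + (s * herm y w) *: w.
Proof.
rewrite mulmxDl mul1mx -scalemxAl -scalerA; congr (_ + _ *: _).
rewrite -!mulmxA; have -> : w ^t* *m (J R *m y) = (herm y w)%:M.
  by rewrite [LHS]mx11_scalar mulmxA.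
by rewrite mul_mx_scalar.
Qed.

Lemma grefl_rank1 c w : mC (grefl c w) = 1%:M + gC c *: (vC w *m (vC w) ^t* *m J R).
Proof. by apply: mulmx_act_inj => y; rewrite grefl_app rank1_app. Qed.

Lemma mem_mirror (w y : 'cV[K]_3) : herm y y < 0 -> herm y w = 0 -> mirror w <[y]>%VS.
Proof. by move=> y0 yw; exists y. Qed.

Lemma mirror_act h (w : 'cV[K]_3) : gunit h -> act (gauss_class h) @` mirror w = mirror (mC h *m w).
Proof.
move=> uh; apply/seteqP; split=> [_ [_ [y [y0 yw] <-] <-]|_ [y [y0 yw] <-]].
  rewrite act_line; apply: mem_mirror; first by rewrite herm_gunit.
  by rewrite herm_gunit.
exists <[mC (ginv h) *m y]>%VS; last by rewrite act_line mC_VV.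
apply: mem_mirror; first by rewrite (herm_gunit _ _ (gunitV uh)).
by rewrite (herm_inv _ _ (gunitV uh)) ginvK.
Qed.

Lemma mirror_scale c (w : 'cV[K]_3) : c != 0 -> mirror (c *: w) = mirror w.
Proof.
move=> c0; apply/seteqP; split=> [_ [y [y0 yw] <-]|_ [y [y0 yw] <-]]; apply: (mem_mirror y0).
  exact: (perp_scale c0 erefl yw).
by rewrite hermZr yw mulr0.
Qed.

(** The mirror contains the points of y, y + v and y - v, which is enough to recover its linear span
    and to compare eigenvalues along it. y comes from projecting a negative vector off w, which
    keeps it negative. *)
Lemma mirror_frame (w : 'cV[K]_3) : 0 < herm w w -> exists y v,
  [/\ herm y y < 0, 0 < herm v v, orth3 y w v, herm (y + v) (y + v) < 0 &
      herm (y - v) (y - v) < 0].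
Proof.
move=> w0; have wn := lt0r_neq0 w0.
pose n0 : 'cV[K]_3 := vec 1 0 (-1).
have hn : herm n0 n0 < 0.
  rewrite herm_vec rmorphN rmorph1 mul0r addr0 mul1r rmorphN rmorph1 -opprD oppr_lt0.
  by rewrite addr_gt0 ?ltr01.
have [y0 y0E] : exists y0, y0 = n0 - (herm n0 w / herm w w) *: w by eexists.
have y0w : herm y0 w = 0 by rewrite y0E hermDl hermNl hermZl divfK// subrr.
have hy0 : herm y0 y0 < 0.
  have -> : herm y0 y0 = herm n0 n0 - (herm n0 w * (herm n0 w)^*) / herm w w.
    rewrite {2}y0E hermDr hermNr hermZr y0w mulr0 subr0 y0E hermDl hermNl hermZl (hermC n0 w).
    by rewrite mulrAC.
  rewrite subr_lt0 (lt_le_trans hn)// divr_ge0 ?mulC_conj_ge0// ltW //.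
have [v v0 [vy vw]] := exists_perp y0 w.
have vv := pos_perp hy0 vy v0.
pose N := - herm y0 y0; have N0 : 0 < N by rewrite oppr_gt0.
(* Scaling y0 by t makes t^2 N exceed <v,v>, so that adding v or -v keeps the norm negative. *)
pose t := 1 + herm v v / N.
have t1 : 1 <= t by rewrite lerDl divr_ge0// ltW.
have t0 : 0 < t := lt_le_trans ltr01 t1.
have tc : t^* = t by apply: CrealP; apply: gtr0_real.
have key : t * t * herm y0 y0 + herm v v < 0.
  rewrite -[herm y0 y0]opprK -/N mulrN addrC subr_lt0.
  apply: (@lt_le_trans _ _ (t * N)).
    by rewrite mulrDl mul1r divfK ?lt0r_neq0// ltrDr.
  by rewrite ler_pM2r// ler_peMr// ltW.
have yv : herm y0 v = 0 := herm_sym0 vy.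
exists (t *: y0), v; split.
- by rewrite hermZl hermZr tc mulrA pmulr_rlt0// mulr_gt0.
- exact: vv.
- split; [by rewrite hermZr (herm_sym0 y0w) mulr0|by rewrite hermZr vy mulr0|exact: vw].
- rewrite !(hermDl, hermDr, hermZl, hermZr) vy yv tc !mulr0 addr0 add0r mulrA; exact: key.
- rewrite !(hermDl, hermDr, hermNl, hermNr, hermZl, hermZr) vy yv tc !mulr0 oppr0 addr0 add0r opprK mulrA.
  exact: key.
Qed.

Lemma mirror_polar (w x : 'cV[K]_3) : 0 < herm w w -> x != 0 ->
  (forall y, herm y y < 0 -> herm y w = 0 -> herm y x = 0) -> exists2 c, c != 0 & x = c *: w.
Proof.
move=> w0 x0 h; have [y [v [y0 v0 o yv _]]] := mirror_frame w0.
have [wy vy vw] := o; have yw := herm_sym0 wy.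
have h1 : herm y x = 0 := h y y0 yw.
have yvw : herm (y + v) w = 0 by rewrite hermDl yw vw addr0.
have h2 : herm v x = 0 by have := h _ yv yvw; rewrite hermDl h1 add0r.
have [c ex] : exists c, x = c *: w.
  exists (herm x w / herm w w).
  rewrite [LHS](orth3_decomp x o (ltr0_neq0 y0) (lt0r_neq0 w0) (lt0r_neq0 v0)).
  by rewrite (herm_sym0 h1) (herm_sym0 h2) !mul0r !scale0r add0r addr0.
by exists c => //; apply: contra_neq x0 => c0; rewrite ex c0 scale0r.
Qed.

Lemma mirror_inj (w x : 'cV[K]_3) : 0 < herm w w -> x != 0 -> mirror w `<=` mirror x ->
  exists2 c, c != 0 & x = c *: w.
Proof.
move=> w0 x0 h; apply: (mirror_polar w0 x0) => y y0 yw.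
have [z [z0 zx] e] := h _ (mem_mirror y0 yw).
have [c _ ->] := (lineP y (neg_neq0 z0)).1 (esym e).
by rewrite hermZl zx mulr0.
Qed.

Lemma fixes_eig A (w : 'cV[K]_3) : gunit A -> fixes_pointwise (gauss_class A) (mirror w) ->
  forall y, herm y y < 0 -> herm y w = 0 -> exists c, mC A *m y = c *: y.
Proof.
move=> uA h y y0 yw; have := h _ (mem_mirror y0 yw).
by move=> /(act_fixP (mC_unitmx R uA).1 (neg_neq0 y0))[c _ e]; exists c.
Qed.

(** If A has eigenvalues m, a, b at y, y + v, y - v, then 2 m y = (a + b) y + (a - b) v, so all
    three agree. *)
Lemma fixes_scalar A (w : 'cV[K]_3) : gunit A -> 0 < herm w w ->
  fixes_pointwise (gauss_class A) (mirror w) ->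
  exists m, forall y, herm y w = 0 -> mC A *m y = m *: y.
Proof.
move=> uA w0 h; have [y [v [y0 v0 o yv0 yv1]]] := mirror_frame w0.
have [wy vy vw] := o; have yw := herm_sym0 wy.
have [m em] := fixes_eig uA h y0 yw.
have yvw0 : herm (y + v) w = 0 by rewrite hermDl yw vw addr0.
have yvw1 : herm (y - v) w = 0 by rewrite hermDl hermNl yw vw subr0.
have [a ea] := fixes_eig uA h yv0 yvw0; have [b eb] := fixes_eig uA h yv1 yvw1.
have [] : 2 * m = a + b /\ a = b.
  have : herm ((2 * m) *: y) y = herm ((a + b) *: y + (a - b) *: v) y /\
         herm ((2 * m) *: y) v = herm ((a + b) *: y + (a - b) *: v) v.
    suff -> : (2 * m) *: y = (a + b) *: y + (a - b) *: v by [].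
    have -> : (2 * m) *: y = mC A *m (y + v) + mC A *m (y - v).
      rewrite -mulmxDr addrACA subrr addr0 mulmxDr em -scalerDl; congr (_ *: _); ring.
    rewrite ea eb !scalerDr scalerN addrACA !scalerDl scaleNr //.
  have yv := herm_sym0 vy; have y0' := ltr0_neq0 y0; have v0' := lt0r_neq0 v0.
  rewrite !hermDl !hermZl vy yv !mulr0 addr0 add0r => -[/(mulIf y0') e1 /esym/eqP].
  by rewrite mulf_eq0 (negPf v0') orbF subr_eq0 => /eqP e2.
move=> e1 e2; have ma : m = a.
  have n2 : 2 != 0 :> K by rewrite pnatr_eq0.
  by apply: (mulfI n2); rewrite e1 -e2; ring.
have ev : mC A *m v = m *: v.
  by apply: (addrI (m *: y)); rewrite -scalerDr -{1}em -mulmxDr ea ma.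
exists m => z zw.
have o' : orth3 w y v := And3 yw vw vy.
have [p [q ->]] := orth3_decomp2 o' (lt0r_neq0 w0) (ltr0_neq0 y0) (lt0r_neq0 v0) zw.
by rewrite mulmxDr -!scalemxAr em ev comb_eig.
Qed.
End Classes.

(** * Recognition of reflections and counting of mirrors *)

Definition gtrace (A : gm) : gi :=
  let: ((a1, a2, a3), (b1, b2, b3), (c1, c2, c3)) := A in gadd (gadd a1 b2) c3.

Definition gdet (A : gm) : gi :=
  let: ((a1, a2, a3), (b1, b2, b3), (c1, c2, c3)) := A in
  gadd (gadd (gmul a1 (gadd (gmul b2 c3) (gopp (gmul b3 c2))))
  (gopp (gmul a2 (gadd (gmul b1 c3) (gopp (gmul b3 c1))))))
  (gmul a3 (gadd (gmul b1 c2) (gopp (gmul b2 c1)))).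

(* scaling A by its determinant, a fourth root of unity, makes the determinant 1 *)
Definition separable_char (A : gm) : bool := gdisc (gtrace (gscalem (gdet A) A)) != 0.

(** The c for which 1 + c <w,w>, the eigenvalue at w, is a unit other than 1: -1+i, -2, -1-i for
    norm 1, -1 for norm 2, 1 for norm -2, and 1-i, 2, 1+i for norm -1. *)
Definition grefl_coefs : seq gi := [:: (-1, 1); (-2, 0); (-1, -1); (-1, 0); (1, 0); (1, -1); (2, 0); (1, 1)].

Definition is_grefl (w : gv) (A : gm) : bool :=
  has (fun c => has (fun u => A == gscalem u (grefl c w)) gunits) grefl_coefs.

Definition good_refl (c : gi) (w : gv) : bool :=
  let A := grefl c w in
  [&& gunit A, 0 < gsq w, gword (nseq 4 A) == gid & ~~ gproj gid A].

Section Reflections.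
Variable R : realType.
Local Notation K := (C R).
Local Notation vec := (@vec3 R).
Local Notation mC := (gauss_mx R).
Local Notation vC := (gauss_vec R).
Local Notation gC := (gauss R).
Local Notation cl := (gauss_class R).
Implicit Types (A B : gm).

Lemma gtraceE A : \tr (mC A) = gC (gtrace A).
Proof.
case: A => [[[[a1 a2] a3] [[b1 b2] b3]] [[c1 c2] c3]].
by rewrite /mxtrace sum3 /gauss_mx /mx3 !mxE /= !gCD.
Qed.

Lemma gdetE A : \det (mC A) = gC (gdet A).
Proof.
case: A => [[[[a1 a2] a3] [[b1 b2] b3]] [[c1 c2] c3]].
by rewrite det3 /gauss_mx /mx3 !mxE /= !(gCD, gCM, gCN).
Qed.

Lemma gdisc_repeated (a : gi) (l1 l2 : K) : l1 * l1^* = 1 -> l2 * l2^* = 1 ->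
  l1 * l1 * l2 = 1 -> l1 + l1 + l2 = gC a -> gdisc a = 0.
Proof.
move=> h1 h2 e ea.
by apply: (@intK_eq R); rewrite (gdisc_norm h1 h1 h2 e ea) subrr !mul0r oppr0.
Qed.

Lemma fixes_not_separable A (w : 'cV[K]_3) : gunit A -> 0 < herm w w ->
  fixes_pointwise (cl A) (mirror w) -> separable_char A = false.
Proof.
move=> uA w0 h; have [m em] := fixes_scalar uA w0 h.
have [y [v [y0 v0 o _ _]]] := mirror_frame w0; have [wy vy vw] := o.
have ey : mC A *m y = m *: y := em y (herm_sym0 wy).
have ev : mC A *m v = m *: v := em v vw.
have UA := UJ_mC R uA.
have m1 := eig_norm UA ey (ltr0_neq0 y0).
have v0' := lt0r_neq0 v0; have w0' := lt0r_neq0 w0; have y0' := ltr0_neq0 y0.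
have vn : v != 0 := pos_neq0 v0; have wn : w != 0 := pos_neq0 w0.
have v1 := eig_norm UA ev v0'.
have [k ek] : exists k, mC A *m w = k *: w.
  exact: (perp_line y0 vn wn vy wy (eig_perp UA ey m1 wy) (herm_sym0 vw)
    (eig_perp UA ev v1 (herm_sym0 vw))).
have ud : gu (gdet A).
  have [_ k1 _ _ det] := diag_unit3 uA o y0 w0 v0 ey ek ev.
  rewrite (gu_norm R) -gdetE det !rmorphM /=; apply/eqP.
  transitivity ((m * m^*) * (k * k^*) * (m * m^*)); first by ring.
  by rewrite m1 k1 !mulr1.
have d4 : gC (gdet A) * gC (gdet A) * gC (gdet A) * gC (gdet A) = 1.
  by rewrite -!gCM; case: (gu_cases ud) => ->; rewrite -[RHS]gC1; congr gC.
set d := gdet A in ud d4 *.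
have uA' := gunit_scalem ud uA.
have [n1 n2 _ tr det] := diag_unit3 uA' o y0 w0 v0 (scalem_eig d ey) (scalem_eig d ek) (scalem_eig d ev).
apply/negbTE; rewrite negbK /separable_char -/d; apply/eqP.
apply: (gdisc_repeated n1 n2).
  rewrite mulrAC -det mC_scalem detZ gdetE -/d exprS expr2 -[RHS]d4; ring.
by rewrite addrAC -tr gtraceE.
Qed.

Lemma is_greflP w A : is_grefl w A -> exists c u, [/\ c != (0, 0), gu u & A = gscalem u (grefl c w)].
Proof.
move=> /hasP[c cc /hasP[u uu /eqP ->]]; exists c, u; split=> //; last exact: gu_gunits.
by move: cc; rewrite !inE; do ![case/orP => [/eqP -> //|]]; move=> /eqP ->.
Qed.

Lemma grefl_eig c u w (y : 'cV[K]_3) d : c != (0, 0) -> gu u ->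
  mC (gscalem u (grefl c w)) *m y = d *: y -> herm y (vC w) = 0 \/ exists k, vC w = k *: y.
Proof.
move=> c0 uu; rewrite mC_scalem -scalemxAl grefl_app => e.
have [h|h] := eqVneq (herm y (vC w)) 0; [by left|right].
have u0 : gC u != 0 by rewrite gC_eq0; apply: contraTneq uu => ->.
have c0' : gC c != 0 by rewrite gC_eq0.
have s0 : gC u * (gC c * herm y (vC w)) != 0 by rewrite !mulf_neq0.
exists ((gC u * (gC c * herm y (vC w)))^-1 * (d - gC u)).
apply: (scalerI s0); rewrite [RHS]scalerA mulVKf// scalerBl -e scalerDr addrC addKr.
by rewrite scalerA.
Qed.

Lemma grefl_mirror c u w (x : 'cV[K]_3) : let A := gscalem u (grefl c w) in
  gunit A -> c != (0, 0) -> gu u -> 0 < gsq w -> 0 < herm x x ->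
  fixes_pointwise (cl A) (mirror x) -> mirror x = mirror (vC w).
Proof.
move=> A uA c0 uu w0 x0 h.
have ww : 0 < herm (vC w) (vC w) by rewrite herm_vCs ltr0z.
have [k k0 ->] : exists2 k, k != 0 & vC w = k *: x.
  apply: (mirror_polar x0 (pos_neq0 ww)) => y y0 yx.
  have [d ed] := fixes_eig uA h y0 yx.
  have [//|[k ek]] := grefl_eig c0 uu ed.
  move: ww; rewrite ek hermZl hermZr mulrA => ww; exfalso.
  have : k * k^* * herm y y <= 0 by rewrite mulr_ge0_le0 ?mulC_conj_ge0// ltW.
  by move=> h'; have := lt_le_trans ww h'; rewrite ltxx.
by rewrite mirror_scale.
Qed.

(** Two negative vectors are never orthogonal, so a fixed negative line must be that of w itself,
    whereas a mirror contains more than one point. *)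
Lemma grefl_negative c u w (x : 'cV[K]_3) : let A := gscalem u (grefl c w) in
  gunit A -> c != (0, 0) -> gu u -> gsq w < 0 -> 0 < herm x x ->
  ~ fixes_pointwise (cl A) (mirror x).
Proof.
move=> A uA c0 uu w0 x0 h.
have ww : herm (vC w) (vC w) < 0 by rewrite herm_vCs ltrz0.
have [y [v [y0 v0 o yv0 _]]] := mirror_frame x0; have [wy vy vw] := o.
have dich z : herm z z < 0 -> herm z x = 0 -> exists k, vC w = k *: z.
  move=> z0 zx; have [d ed] := fixes_eig uA h z0 zx.
  have [e|//] := grefl_eig c0 uu ed; exfalso.
  by have := lt_trans (pos_perp ww e (neg_neq0 z0)) z0; rewrite ltxx.
have [a ea] := dich y y0 (herm_sym0 wy).
have yvx : herm (y + v) x = 0 by rewrite hermDl vw (herm_sym0 wy) addr0.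
have [b eb] := dich (y + v) yv0 yvx.
have : herm (vC w) v = b * herm v v by rewrite eb hermZl hermDl (herm_sym0 vy) add0r.
rewrite ea hermZl (herm_sym0 vy) mulr0 => /esym/eqP.
rewrite mulf_eq0 (negPf (lt0r_neq0 v0)) orbF => /eqP b0.
by move: ww; rewrite eb b0 scale0r herm0l ltxx.
Qed.

Lemma mC_word n A : mC (gword (nseq n A)) = mC A ^+ n.
Proof.
elim: n => [|n IH]; first by rewrite [LHS]mC1 expr0.
by rewrite [LHS]mCM IH exprS.
Qed.

Lemma grefl_is_reflection c w : good_refl c w -> is_reflection_in (mirror (vC w)) (cl (grefl c w)).
Proof.
move=> /and4P[uA w0 /eqP o4 ne]; split.
- exact: cl_PUJ.
- by rewrite -cl1 => /esym/(cl_eqP R gunit1 uA); apply/negP.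
- by exists 4%N => //; rewrite /gauss_class expv_line -mC_word o4 -cl1.
split; first by exists (vC w) => //; rewrite herm_vCs ltr0z.
move=> _ [y [y0 yw] <-]; apply/act_fixP; [exact: (mC_unitmx R uA).1|exact: neg_neq0|].
by exists 1; rewrite ?oner_neq0// grefl_app yw mulr0 scale0r addr0 scale1r.
Qed.

(* D contains polar vectors of mirrors, N negative vectors: -1 on the line of the fixed point
   itself gives a repeated eigenvalue without fixing a mirror *)
Definition reflections_covered (l : seq gm) (D N : seq gv) : bool :=
  all (fun A => [|| gproj gid A, separable_char A, has (fun w => is_grefl w A) D
    | has (fun w => is_grefl w A) N]) l &&
  (all (fun w => 0 < gsq w) D && all (fun w => gsq w < 0) N).

Lemma reflection_cases l D N A M : all gunit l -> reflections_covered l D N -> A \in l ->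
  is_reflection_in M (cl A) -> exists2 w, w \in D & M = mirror (vC w) /\ is_grefl w A.
Proof.
move=> /allP ul /andP[/allP cov /andP[/allP Dp /allP Nn]] Al [_ ne _ [[x x0 ->] h]].
have uA := ul A Al.
have /or4P[e|e|/hasP[w wD rw]|/hasP[w wN rw]] := cov A Al.
- by case: ne; rewrite -cl1; apply/esym/cl_eqP => //; exact: gunit1.
- by rewrite (fixes_not_separable uA x0 h) in e.
- have [c [u [c0 uu eA]]] := is_greflP rw; exists w; first exact: wD.
  split; last exact: rw.
  rewrite eA in uA h; exact: (grefl_mirror uA c0 uu (Dp w wD) x0 h).
- have [c [u [c0 uu eA]]] := is_greflP rw; exfalso.
  rewrite eA in uA h; exact: (grefl_negative uA c0 uu (Nn w wN) x0 h).
Qed.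

Definition gwt (j : nat) : gv :=
  nth ((0, 0), (1, 0), (0, 0)) [:: ((0, 0), (1, 0), (0, 0)); ((1, 0), (-1, 0), (0, 0));
    ((1, 0), (0, 0), (1, 0))] j.

Lemma gauss_ratio (i : nat) (v : gv) c : (i < 3)%N -> vC v = c *: vC (gwt i) -> exists x, c = gC x.
Proof.
move=> i3 /matrixP e.
case: i i3 e => [|[|[|//]]] _ e; [exists (gcoord v i1)|exists (gcoord v i0)|exists (gcoord v i0)];
  rewrite -vC_coord e mxE vC_coord /= gC1 mulr1 //.
Qed.

(** Each representative has a coordinate 1, so c and its inverse are Gaussian and c is a unit. The
    norms 1, 1, 2 and [even_perp], which holds for (0,1,0) and not for (1,-1,0), then separate the
    orbits. *)
Lemma gwt_orbits_distinct i j h c : (i < 3)%N -> (j < 3)%N -> gunit h -> c != 0 ->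
  vC (gwt j) = c *: (mC h *m vC (gwt i)) -> i = j.
Proof.
move=> i3 j3 uh c0 e.
have [x ex] : exists x, c = gC x.
  apply: (@gauss_ratio i (gapp (ginv h) (gwt j))) => //.
  by rewrite vC_app e -scalemxAr mC_V.
have [x' ex'] : exists x, c^-1 = gC x.
  apply: (@gauss_ratio j (gapp h (gwt i))) => //.
  by rewrite vC_app e scalerA mulVf// scale1r.
have xx : gnorm x * gnorm x' = 1.
  rewrite -gnormM; have -> : gmul x x' = (1, 0) by apply: (@gC_inj R); rewrite gCM -ex -ex' divff// gC1.
  by [].
have ux : gu x.
  rewrite /gu; have := gnorm_ge0 x; have := gnorm_ge0 x'; move: xx.
  move: (gnorm x) (gnorm x') => a b ab b0 a0; apply/eqP.
  have b1 : b <> 0 by move=> z; rewrite z mulr0 in ab.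
  have a1 : a <> 0 by move=> z; rewrite z mul0r in ab.
  by nia.
have E : geqv (gwt i) (gwt j).
  apply: (@geqv_trans _ (gapp h (gwt i))); first by exists h.
  have -> : gwt j = gscale x (gapp h (gwt i)).
    by apply: (@vC_inj R); rewrite vC_scale vC_app -ex.
  exact: geqv_scale.
have ep0 : even_perp (gwt 0).
  move=> [[[y1 y1'] [y2 y2']] [y3 y3']]; rewrite /gherm /gdot /gadd /gmul /gconj /= => -[h1 h2].
  exists (y1 * y3 + y1' * y3'); rewrite /gsq /gherm /gdot /gadd /gmul /gconj /=.
  have y20 : y2 = 0 by lia.
  have y20' : y2' = 0 by lia.
  by subst y2 y2'; lia.
have nep1 : ~ even_perp (gwt 1).
  by move=> ep; exact: (@not_even_perp _ ((0, 0), (1, 0), (1, 0)) ep erefl erefl).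
have sq := geqv_gsq E.
case: i j i3 j3 E sq {e} => [|[|[|//]]] [|[|[|//]]] _ _ E sq //.
- by case: nep1; exact: even_perp_geqv E ep0.
- by case: nep1; exact: even_perp_geqv (geqv_sym E) ep0.
Qed.

Definition parallel (v w : gv) : bool :=
  let: (v1, v2, v3) := v in let: (w1, w2, w3) := w in
  [&& gmul v1 w2 == gmul v2 w1, gmul v1 w3 == gmul v3 w1 & gmul v2 w3 == gmul v3 w2].

Lemma parallel_scale c v w : vC w = c *: vC v -> parallel v w.
Proof.
move=> /matrixP e; have e1 := e i0 0; have e2 := e i1 0; have e3 := e i2 0.
case: v w e1 e2 e3 {e} => [[v1 v2] v3] [[w1 w2] w3].
rewrite /gauss_vec !mxE /= => e1 e2 e3.
by apply/and3P; split; apply/eqP; apply: (@gC_inj R); rewrite !gCM ?e1 ?e2 ?e3; ring.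
Qed.

(* D lists polar vectors of mirrors, each with the index j of the orbit of gwt j *)
Definition mirror_data (l : seq gm) (D : seq (gv * nat)) : bool :=
  all (fun d => [&& (d.2 < 3)%N,
    has (fun h => has (fun u => gapp h (gwt d.2) == gscale u d.1) gunits) l &
    has (fun A => has (fun c => good_refl c d.1 && gproj (grefl c d.1) A) grefl_coefs) l]) D
  && pairwise (fun d e => ~~ parallel d.1 e.1) D.

(** A mirror determines its polar vector up to scalars, so the mirrors of the orbit correspond
    bijectively to the entries of D with index j, which are pairwise not parallel. *)
Lemma mirrors_in_orbit_card (v : 'cV[K]_3) l (D : seq (gv * nat)) N j : isotropy <[v]>%VS = cls l ->
  all gunit l -> reflections_covered l (map fst D) N -> mirror_data l D -> (j < 3)%N ->
  mirrors_in_orbit (isotropy <[v]>%VS) (vC (gwt j)) #= `I_(count (fun d => d.2 == j) D).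
Proof.
move=> eG ul cov /andP[/allP Dok pw] j3.
pose L := [seq d <- D | d.2 == j]; rewrite -size_filter -/L.
have pos d : d \in D -> 0 < gsq d.1.
  move=> dD; have /andP[_ /andP[/allP h _]] := cov.
  by apply: h; apply/mapP; exists d.
have posC d : d \in D -> 0 < herm (vC d.1) (vC d.1) by move=> /pos; rewrite herm_vCs ltr0z.
have move_ d : d \in D -> exists h k, [/\ gunit h, k != 0 & vC d.1 = k *: (mC h *m vC (gwt d.2))].
  move=> dD; have /and3P[_ /hasP[h hl /hasP[u ue /eqP e]] _] := Dok d dD.
  have uu := gu_gunits ue; have u0 : gC u != 0 by rewrite gC_eq0; apply: contraTneq uu => ->.
  exists h, (gC u)^-1; split; [exact: (allP ul)|by rewrite invr_eq0|].
  by rewrite -vC_app e vC_scale scalerA mulVf// scale1r.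
have setE : mirrors_in_orbit (isotropy <[v]>%VS) (vC (gwt j)) =
    (fun k => mirror (vC (nth (gwt 0, 0%N) L k).1)) @` `I_(size L).
  apply/seteqP; split=> [M [[g gG rg] [_ /Gamma1P[h uh ->] eM]]|_ [k kL <-]].
    move: gG rg; rewrite eG => -[A Al ->] rg.
    have [w wD [eMw _]] := reflection_cases ul cov Al rg.
    have [d dD ew] := mapP wD.
    have [h' [k' [uh' k0' ed]]] := move_ d dD.
    have [c c0 ec] : exists2 c, c != 0 & mC h *m vC (gwt j) = c *: vC d.1.
      apply: (mirror_inj (posC d dD)).
        apply: (unit_mx_app (mC_unitmx R uh).1); apply: (@pos_neq0 R).
        by rewrite herm_vCs ltr0z; case: (j) j3 => [|[|[|]]].
      by rewrite -(mirror_act _ uh) -eM eMw ew.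
    have dj : d.2 = j.
      apply: (@gwt_orbits_distinct d.2 j (gmm (ginv h) h') (c * k')) => //.
      - by have /and3P[] := Dok d dD.
      - by rewrite gunitM ?gunitV.
      - by rewrite mulf_neq0.
      - by rewrite mCM -mulmxA -scalerA scalemxAr -ed scalemxAr -ec mC_V.
    have dL : d \in L by rewrite mem_filter dj eqxx.
    exists (index d L); first by rewrite /= index_mem.
    by rewrite (nth_index _ dL) -ew; exact: esym eMw.
  set d := nth _ _ _; have dL : d \in L by exact: mem_nth.
  move: dL; rewrite mem_filter => /andP[/eqP dj dD].
  have [h [k' [uh k0 ed]]] := move_ d dD.
  have /and3P[_ _ /hasP[A Al /hasP[c _ /andP[gr pA]]]] := Dok d dD.
  split.
    exists (cl (grefl c d.1)); last exact: grefl_is_reflection.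
    rewrite eG; exists A => //; apply/cl_eqP => //; [by case/and4P: gr|exact: (allP ul)].
  exists (cl h); first by apply/Gamma1P; exists h.
  rewrite (mirror_act _ uh) -dj ed (mirror_scale _ k0); exact: erefl.
rewrite setE; apply: inj_card_eq => a b /set_mem /= aL /set_mem /= bL.
have pwL : pairwise (fun d e => ~~ parallel d.1 e.1) L.
  exact: (subseq_pairwise (filter_subseq _ _) pw).
move/(pairwiseP (gwt 0, 0%N)): pwL => pwL.
have LD k : (k < size L)%N -> nth (gwt 0, 0%N) L k \in D.
  by move=> kL; have := mem_nth (gwt 0, 0%N) kL; rewrite mem_filter => /andP[].
have ne x y : (x < size L)%N -> (y < size L)%N -> (x < y)%N ->
    mirror (vC (nth (gwt 0, 0%N) L x).1) <> mirror (vC (nth (gwt 0, 0%N) L y).1).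
  move=> xL yL xy e; have := pwL x y xL yL xy; apply/negP; rewrite negbK.
  have [c _ ec] := @mirror_inj R _ (vC (nth (gwt 0, 0%N) L y).1) (posC _ (LD x xL))
    (pos_neq0 (posC _ (LD y yL))) (eq_ind _ (fun S => _ `<=` S) (@subset_refl _ _) _ e).
  exact: parallel_scale ec.
move=> e; have [ab|ab|ab] := ltngtP a b; last exact: ab.
  by case: (ne a b aL bL ab e).
by case: (ne b a bL aL ab (esym e)).
Qed.
End Reflections.

(** * Polar reflections *)

(* c for which 1 + n c can be a unit *)
Definition refl_coefs (n : int) : seq gi :=
  if n == 1 then [:: (0, 0); (-1, 1); (-2, 0); (-1, -1)] else [:: (0, 0); (-1, 0)].

Lemma refl_coefsP n c : n = 1 \/ n = 2 -> gu (gadd (1, 0) (gmul (n, 0) c)) -> c \in refl_coefs n.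
Proof.
case: c => a b n12 /gu_cases; rewrite /gadd /gmul /= !mul0r subr0 addr0 add0r.
case: n12 => -> ; rewrite /refl_coefs /= => h.
  have [e1 e2] : a \in [:: 0; -1; -2] /\ b \in [:: 0; 1; -1].
    by rewrite !inE; case: h => -[h1 h2]; lia.
  move: e1 e2; rewrite !inE !xpair_eqE; by case: h => -[h1 h2]; lia.
by rewrite !inE !xpair_eqE; case: h => -[h1 h2]; lia.
Qed.

(** Witnesses of integrality: z is orthogonal to w and has a coordinate 1, so a scalar action on the
    complement of w is by a Gaussian number; <z',w> = 1 and w has a coordinate 1, so the coefficient
    of y + c <y,w> w is Gaussian. *)
Definition polar_data (w z z' : gv) : bool :=
  [&& (gsq w == 1) || (gsq w == 2), gherm z w == (0, 0), has (fun k => gcoord z k == (1, 0)) [:: i0; i1; i2],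
   gherm z' w == (1, 0), has (fun k => gcoord w k == (1, 0)) [:: i0; i1; i2] &
   let l := [seq grefl c w | c <- refl_coefs (gsq w)] in all gunit l && distinct_classes l].

Section Polar.
Variable R : realType.
Local Notation K := (C R).
Local Notation vec := (@vec3 R).
Local Notation mC := (gauss_mx R).
Local Notation vC := (gauss_vec R).
Local Notation gC := (gauss R).
Local Notation cl := (gauss_class R).

Lemma grefl_fixes c w : gunit (grefl c w) -> fixes_pointwise (cl (grefl c w)) (mirror (vC w)).
Proof.
move=> uA _ [y [y0 yw] <-]; apply/act_fixP; [exact: (mC_unitmx R uA).1|exact: neg_neq0|].
by exists 1; rewrite ?oner_neq0// grefl_app yw mulr0 scale0r addr0 scale1r.
Qed.

Lemma gauss_scalar (z z' : gv) k m : gcoord z k = (1, 0) -> vC z' = m *: vC z -> exists x, m = gC x.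
Proof.
move=> hk e; have : vC z' k 0 = (m *: vC z) k 0 by rewrite e.
by rewrite [RHS]mxE !vC_coord hk gC1 mulr1 => <-; exists (gcoord z' k).
Qed.

(** Divided by its scalar on the complement of w, an element fixing the mirror has the form y + c
    <y,w> w with c Gaussian; its eigenvalue 1 + <w,w> c at w is a unit, which leaves the c of
    [refl_coefs]. *)
Lemma mirror_fixator_cls w z z' : polar_data w z z' ->
  mirror_fixator (vC w) = @cls R [seq grefl c w | c <- refl_coefs (gsq w)].
Proof.
move=> /and5P[n12 /eqP zw /hasP[k _ /eqP hk] /eqP z'w /andP[/hasP[k' _ /eqP hk'] /andP[/allP ul _]]].
have n12' : gsq w = 1 \/ gsq w = 2 by case/orP: n12 => /eqP; [left|right].
have n0 : 0 < gsq w by case: n12' => ->.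
have w0 : 0 < herm (vC w) (vC w) by rewrite herm_vCs ltr0z.
have w0' := lt0r_neq0 w0.
apply/seteqP; split=> [g [/Gamma1P[A uA ->] fA]|_ [A Al ->]]; last first.
  have uA := ul _ Al; split; first by apply/Gamma1P; exists A.
  by have /mapP[c _ eA] := Al; rewrite eA in uA *; exact: grefl_fixes.
have [m em] := fixes_scalar uA w0 fA.
have UA := UJ_mC R uA.
have ez : mC A *m vC z = m *: vC z by apply: em; rewrite herm_vC zw gC0.
have [x ex] := gauss_scalar hk (etrans (vC_app R A z) ez).
have [y [v [y0 v0 o _ _]]] := mirror_frame w0; have [wy vy vw] := o.
have ey := em y (herm_sym0 wy).
have m1 := eig_norm UA ey (ltr0_neq0 y0).
have ux : gu x by rewrite (gu_norm R) -ex m1.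
have [ucx xx] := gu_conj ux.
pose B := gscalem (gconj x) A; have uB : gunit B := gunit_scalem ucx uA.
have eB y' : herm y' (vC w) = 0 -> mC B *m y' = y'.
  by move=> h; rewrite mC_scalem -scalemxAl (em _ h) scalerA ex -gCM xx gC1 scale1r.
have UB := UJ_mC R uB.
have ev1 : mC B *m v = 1 *: v by rewrite scale1r; exact: eB.
have ey1 : mC B *m y = 1 *: y by rewrite scale1r; exact: eB (herm_sym0 wy).
have c1 : (1 : K) * 1^* = 1 by rewrite rmorph1 mulr1.
have wn : vC w != 0 := pos_neq0 w0.
have [q eq] : exists q, mC B *m vC w = q *: vC w.
  exact: (perp_line y0 (pos_neq0 v0) wn vy wy (eig_perp UB ey1 c1 wy) (herm_sym0 vw)
    (eig_perp UB ev1 c1 (herm_sym0 vw))).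
have q1 := eig_norm UB eq w0'.
have n0' : (gsq w)%:~R != 0 :> K by rewrite intr_eq0 gt_eqF.
have [c ec] : exists c, c = (q - 1) / (gsq w)%:~R by eexists.
have Bapp y' : mC B *m y' = y' + (c * herm y' (vC w)) *: vC w.
  have [t et] : exists t, t = herm y' (vC w) / (gsq w)%:~R by eexists.
  have p : herm (y' - t *: vC w) (vC w) = 0.
    by rewrite hermDl hermNl hermZl herm_vCs et divfK// subrr.
  have := eB _ p; rewrite mulmxDr mulmxN -scalemxAr eq => /eqP; rewrite subr_eq => /eqP ->.
  rewrite -addrA; congr (_ + _); rewrite scalerA -scaleNr -scalerDl; congr (_ *: _).
  by rewrite et ec; field.
have [d ed] : exists d, c = gC d.
  apply: (@gauss_scalar w (gvadd (gapp B z') (gscale (-1, 0) z')) k') => //.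
  rewrite vC_add vC_scale vC_app Bapp herm_vC z'w gC1 mulr1.
  have -> : gC (-1, 0) = -1 by rewrite (gC_int R (-1)).
  by rewrite scaleN1r addrAC subrr add0r.
have dl : d \in refl_coefs (gsq w).
  apply: refl_coefsP; first exact: n12'.
  rewrite (gu_norm R) gCD gC1 gCM (gC_int R) -ed ec mulrCA mulfV// mulr1 addrC subrK; exact/eqP.
have mem : grefl d w \in [seq grefl c w | c <- refl_coefs (gsq w)] by apply: map_f.
exists (grefl d w); first exact: mem.
have -> : grefl d w = B.
  by apply: (@mC_inj R); apply: mulmx_act_inj => y'; rewrite grefl_app Bapp ed.
apply/cl_eqP => //; apply/hasP; exists (gconj x); last exact: eqxx.
exact: mem_gunits.
Qed.

(** The fixator has 4 or 2 classes, so zeta_k is i or -1 and (zeta_k - 1) / <w,w> is -1+i or -1. *)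
Lemma polar_reflection_cl w z z' : polar_data w z z' ->
  polar_reflection (vC w) = cl (grefl (if gsq w == 1 then (-1, 1) else (-1, 0)) w).
Proof.
move=> h; rewrite /polar_reflection /gauss_class grefl_rank1 (mirror_fixator_cls h).
have /and5P[n12 _ _ _ /andP[_ /andP[ul dl]]] := h.
rewrite (card_fset_set (card_cls R ul dl)) size_map.
congr (<[1%:M + _ *: _]>%VS); rewrite herm_vCs.
case/orP: n12 => /eqP ->; rewrite /refl_coefs /=.
  by rewrite zeta4E divr1 /gauss /=; ring.
by rewrite zeta2E /gauss /=; field.
Qed.
End Polar.

(** * Enumeration of the isotropy groups *)

Definition covers (l cand : seq gm) : bool :=
  all (fun A => gunit A ==> has (fun g => gproj g A) l) cand.

Definition gcol (A : gm) (i : 'I_3) : gv := gapp A (gbase i).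

Definition gbox : seq gi :=
  [seq (a, b) | a <- [:: -2; -1; 0; 1; 2], b <- [:: -2; -1; 0; 1; 2]].

(* when v.1.2 is a unit, the vectors y with y.1.1 and y.2 in the box, <y,v> = c and <y,y> = n *)
Definition columns (v : gv) (c : gi) (n : int) : seq gv :=
  [seq y <- [seq (y1, gmul v.1.2 (gadd c (gopp (gadd (gmul y1 (gconj v.2)) (gmul y3 (gconj v.1.1))))), y3)
     | y1 <- gbox, y3 <- gbox] | gsq y == n].

(** If A is unitary and A v = v, column i of A has the norm of e_i and the same product with v as
    e_i; those norms are 0, 1, 0. *)
Definition box_candidates (v : gv) : seq gm :=
  [seq A <- [seq gtr (a, p.1, p.2) | a <- columns v (gconj v.2) 0,
    p <- [seq (b, c) | b <- columns v (gconj v.1.2) 1, c <- columns v (gconj v.1.1) 0]]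
  | gapp A v == v].

Lemma gcolE A : A = gtr (gcol A i0, gcol A i1, gcol A i2).
Proof.
case: A => [[[[[a1 a1'] [a2 a2']] [a3 a3']] [[[b1 b1'] [b2 b2']] [b3 b3']]] [[[c1 c1'] [c2 c2']] [c3 c3']]].
rewrite /gcol /gbase /gapp /gdot /gadd /gmul /gtr /=.
by congr ((_, _), (_, _), (_, _), ((_, _), (_, _), (_, _)), ((_, _), (_, _), (_, _))); ring.
Qed.

Lemma mem_gbox a b : -2 <= a <= 2 -> -2 <= b <= 2 -> (a, b) \in gbox.
Proof.
move=> ha hb; apply: allpairs_f; rewrite !inE; lia.
Qed.

Lemma mem_columns v c n y : gu v.1.2 -> gherm y v = c -> gsq y = n ->
  y.1.1 \in gbox -> y.2 \in gbox -> y \in columns v c n.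
Proof.
case: y v => [[y1 y2] y3] [[v1 v2] v3] /= uv hc hn b1 b3.
rewrite mem_filter hn eqxx andTb; apply/allpairsPdep; exists y1, y3; split; [exact: b1|exact: b3|].
rewrite -hc; congr (_, _, _).
have : gmul v2 (gconj v2) = (1, 0).
  move: uv; rewrite /gu /gnorm /gmul /gconj /= => /eqP e; congr (_, _); [lia|ring].
case: y1 y2 y3 v1 v2 v3 {uv hc hn b1 b3} => [p1 q1] [p2 q2] [p3 q3] [r1 s1] [r2 s2] [r3 s3].
rewrite /gherm /gdot /gmul /gadd /gopp /gconj /= => -[e1 e2].
have e3 : r2 * r2 + s2 * s2 = 1 by lia.
congr (_, _).
  transitivity ((r2 * r2 + s2 * s2) * p2); [by rewrite e3 mul1r|ring].
transitivity ((r2 * r2 + s2 * s2) * q2); [by rewrite e3 mul1r|ring].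
Qed.

Lemma gproj_scale u g A : gu u -> gproj g (gscalem u A) -> gproj g A.
Proof.
move=> uu /hasP[x xe /eqP e]; have [uc cu] := gu_conj uu; apply/hasP.
exists (gmul (gconj u) x).
  apply: mem_gunits; rewrite /gu gnormM; move: uc (gu_gunits xe); rewrite /gu => /eqP -> /eqP -> //.
have s a b M : gscalem (gmul a b) M = gscalem a (gscalem b M).
  rewrite /gscalem gmmA; congr gmm.
  by rewrite /gdiag /gmm /gapp /gdot /gtr /gadd /gmul /gint /=; congr ((_, _), (_, _), (_, _), ((_, _), (_, _), (_, _)), ((_, _), (_, _), (_, _))); ring.
by rewrite s e -s cu /gscalem gmm1l.
Qed.

Section Complete.
Variable R : realType.
Local Notation K := (C R).
Local Notation vec := (@vec3 R).
Local Notation mC := (gauss_mx R).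
Local Notation vC := (gauss_vec R).
Local Notation gC := (gauss R).
Local Notation cl := (gauss_class R).

Lemma gherm_base v : [/\ gherm (gbase i0) v = gconj v.2, gherm (gbase i1) v = gconj v.1.2 &
  gherm (gbase i2) v = gconj v.1.1].
Proof.
case: v => [[[a a'] [b b']] [c c']]; rewrite /gherm /gbase /gdot /gadd /gmul /gconj /=.
split; congr (_, _); ring.
Qed.

(** A unit coordinate of v makes the eigenvalue at v a Gaussian unit, so after scaling only matrices
    with A v = v need be listed. *)
Lemma complete_gauss v k l : gu (gcoord v k) -> gsq v < 0 ->
  (forall A, gunit A -> gapp A v = v -> exists2 g, g \in l & gproj g A) -> complete (vC v) l.
Proof.
move=> uv v0 h B c uB e.
have v0' : herm (vC v) (vC v) != 0 by rewrite herm_vCs intr_eq0 lt_eqF.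
have c1 := eig_norm (UJ_mC R uB) e v0'.
have [x ex] : exists x, c = gC x.
  have [_ cv] := gu_conj uv.
  exists (gmul (gcoord (gapp B v) k) (gconj (gcoord v k))).
  have hk : gC (gcoord (gapp B v) k) = c * gC (gcoord v k).
    by rewrite -vC_coord vC_app e [LHS]mxE vC_coord.
  have cv' : gC (gcoord v k) * gC (gconj (gcoord v k)) = 1 by rewrite mulrC -gCM cv gC1.
  by rewrite gCM hk -mulrA cv' mulr1.
have ux : gu x by rewrite (gu_norm R) -ex c1.
have [ucx xx] := gu_conj ux.
have Av : gapp (gscalem (gconj x) B) v = v.
  apply: (@vC_inj R); rewrite vC_app mC_scalem -scalemxAl e scalerA ex -gCM xx gC1 scale1r //.
have [g gl gA] := h _ (gunit_scalem ucx uB) Av; exists g; first exact: gl.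
exact: gproj_scale gA.
Qed.

Lemma gcol_data A v i : gunit A -> gapp A v = v ->
  gherm (gcol A i) v = gherm (gbase i) v /\ gsq (gcol A i) = gsq (gbase i).
Proof. by move=> uA Av; rewrite /gcol -{1}Av gherm_unit// gsq_unit. Qed.

Lemma covers_has l cand A : covers l cand -> gunit A -> A \in cand -> exists2 g, g \in l & gproj g A.
Proof. by move=> /allP cov uA cA; have := cov A cA; rewrite uA => /hasP. Qed.

Lemma complete_box v l : gu v.1.2 -> gsq v < 0 ->
  (forall i y, gherm y v = gherm (gbase i) v -> gsq y = gsq (gbase i) -> y.1.1 \in gbox /\ y.2 \in gbox) ->
  covers l (box_candidates v) -> complete (vC v) l.
Proof.
move=> uv v0 bnd cov; have uv' : gu (gcoord v i1) by case: v uv {v0 bnd cov} => [[? ?] ?].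
apply: (complete_gauss uv' v0) => A uA Av; apply: (covers_has cov uA).
have mc i : gcol A i \in columns v (gherm (gbase i) v) (gsq (gbase i)).
  have [h1 h2] := gcol_data i uA Av; have [b1 b2] := bnd i _ h1 h2; exact: mem_columns.
have [h0 h1 h2] := gherm_base v.
rewrite mem_filter Av eqxx andTb [A]gcolE; apply/allpairsPdep; exists (gcol A i0), (gcol A i1, gcol A i2).
split; [by rewrite -h0; exact: mc| |by []].
by apply: allpairs_f; [rewrite -h1; exact: mc|rewrite -h2; exact: mc].
Qed.

End Complete.

(** * Generators and enumeration at the three rational points *)

Definition ga1 : gm := grefl (-1, 0) ((0, 0), (1, 1), (1, 0)).
Definition gb : gm := grefl (-1, 0) ((1, 0), (0, 0), (1, 0)).
Definition ga2 : gm := grefl (-1, 1) ((0, 0), (1, 0), (0, 0)).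
Definition ga3 : gm := grefl (-1, 1) ((0, 0), (1, 0), (1, 0)).
Definition gA4 : gm := (((0, -1), (-1, -1), (0, 1)), ((-1, 1), (0, 1), (0, 0)), ((-1, 1), (-1, 1), (1, 0))).
Definition gA5 : gm := (((0, 1), (0, 0), (1, 0)), ((0, 0), (-1, 0), (0, 0)), ((1, 0), (0, 0), (0, 0))).

Definition words1 : seq (seq gm) :=
  [:: [::]; [:: ga1]; [:: gb]; [:: ga1; gb]; [:: gb; ga1]; [:: ga1; gb; ga1]].
Definition words2 : seq (seq gm) :=
  [seq nseq i ga2 ++ nseq j gb | i <- iota 0 4, j <- iota 0 2].
(** With a = [ga3] of order 4 and b = [gb], eight right cosets of the powers of a: representatives
    1, b a^k for 0 <= k <= 3, and b a^k b for 1 <= k <= 3. *)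
Definition words3 : seq (seq gm) :=
  [seq nseq i ga3 ++ w | i <- iota 0 4,
    w <- [::] :: [seq gb :: nseq k ga3 | k <- iota 0 4] ++ [seq gb :: rcons (nseq k ga3) gb | k <- iota 1 3]].
Definition words4 : seq (seq gm) := [seq nseq i gA4 | i <- iota 0 8].
Definition words5 : seq (seq gm) := [seq nseq i gA5 | i <- iota 0 12].

Definition gv1 : gv := ((1, 1), (0, -1), (-1, -1)).
Definition gv2 : gv := ((1, 0), (0, 0), (-1, 0)).
Definition gv3 : gv := ((1, 0), (-1, 0), (-1, 0)).

Lemma covers1 : covers (map gword words1) (box_candidates gv1).
Proof. by vm_compute. Qed.

Lemma covers3 : covers (map gword words3) (box_candidates gv3).
Proof. by vm_compute. Qed.

Lemma ok1 : all gunit (map gword words1) && distinct_classes (map gword words1).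
Proof. by vm_compute. Qed.
Lemma ok2 : all gunit (map gword words2) && distinct_classes (map gword words2).
Proof. by vm_compute. Qed.
Lemma ok3 : all gunit (map gword words3) && distinct_classes (map gword words3).
Proof. by vm_compute. Qed.
Lemma ok4 : all gunit (map gword words4) && distinct_classes (map gword words4).
Proof. by vm_compute. Qed.
Lemma ok5 : all gunit (map gword words5) && distinct_classes (map gword words5).
Proof. by vm_compute. Qed.

Lemma sq_ge0 (x : int) : 0 <= x * x.
Proof. by nia. Qed.

(** The product with [gv1] expresses the middle coordinate through a and c. Substituting it in the
    norm and completing squares gives |a|^2 + |c|^2 + |c - a - w|^2 = 2 for each of the three
    columns, with the listed shifts w. *)
Lemma box1 i y : gherm y gv1 = gherm (gbase i) gv1 -> gsq y = gsq (gbase i) -> y.1.1 \in gbox /\ y.2 \in gbox.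
Proof.
case: y => [[[a a'] [b b']] [c c']].
have bnd : a * a + a' * a' + c * c + c' * c' <= 2 -> (a, a') \in gbox /\ (c, c') \in gbox.
  by move=> h; split; apply: mem_gbox; nia.
have [w ew] : exists w : gi, w = nth (0, 0) [:: (-2, 0); (-1, 1); (2, 0)] i by eexists.
have s1 := sq_ge0 (c - a - w.1); have s2 := sq_ge0 (c' - a' - w.2).
elim/ord3P: i ew => ew; rewrite ew /= in s1 s2;
  rewrite /gherm /gsq /gherm /gbase /gdot /gadd /gmul /gconj /gv1 /= => -[h1 h2] h3; apply: bnd.
- have e : b = c - c' - a + a' + 1 by lia.
  have e' : b' = c + c' - a - a' + 1 by lia.
  by subst b b'; lia.
- have e : b = c - c' - a + a' + 1 by lia.
  have e' : b' = c + c' - a - a' by lia.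
  by subst b b'; lia.
- have e : b = c - c' - a + a' - 1 by lia.
  have e' : b' = c + c' - a - a' - 1 by lia.
  by subst b b'; lia.
Qed.

(** Eliminating the middle coordinate leaves |a + w|^2 + |c - w|^2 equal to the norm of the column
    plus 1. *)
Lemma box3 i y : gherm y gv3 = gherm (gbase i) gv3 -> gsq y = gsq (gbase i) -> y.1.1 \in gbox /\ y.2 \in gbox.
Proof.
case: y => [[[a a'] [b b']] [c c']].
have [w ew] : exists w : int, w = nth 0 [:: -1; -1; 1] i by eexists.
have bnd : (a + w) * (a + w) + a' * a' + (c - w) * (c - w) + c' * c' <= 2 -> (a, a') \in gbox /\ (c, c') \in gbox.
  have w1 : w = 1 \/ w = -1 by rewrite ew; elim/ord3P: i {ew}; [right|right|left].
  move=> h; suff [h1 h2] : (-1 <= a + w <= 1 /\ -1 <= a' <= 1) /\ (-1 <= c - w <= 1 /\ -1 <= c' <= 1).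
    by split; apply: mem_gbox; lia.
  have := sq_ge0 (a + w); have := sq_ge0 (c - w); have := sq_ge0 a'; have := sq_ge0 c'.
  move: (a + w) (c - w) h => x z *; split; split; nia.
elim/ord3P: i ew => ew; rewrite /= in ew;
  rewrite /gherm /gsq /gherm /gbase /gdot /gadd /gmul /gconj /gv3 /= => -[h1 h2] h3; apply: bnd.
- have e : b = c - a - w by lia.
  have e' : b' = c' - a' by lia.
  by subst b b' w; lia.
- have e : b = c - a - w by lia.
  have e' : b' = c' - a' by lia.
  by subst b b' w; lia.
- have e : b = c - a - w by lia.
  have e' : b' = c' - a' by lia.
  by subst b b' w; lia.
Qed.

(** The middle coordinate of [gv2] is 0, so the product with [gv2] does not determine that of a
    column and [columns] does not apply; the possible columns are found directly. *)
Definition candidates2 : seq gm :=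
  [seq gtr (a, p.1, p.2) | a <- [:: ((1, 0), (0, 0), (0, 0)); ((0, 0), (0, 0), (-1, 0))],
    p <- [seq (((0, 0), u, (0, 0)), c) | u <- gunits, c <- [:: ((0, 0), (0, 0), (1, 0)); ((-1, 0), (0, 0), (0, 0))]]].

Lemma covers2 : covers (map gword words2) candidates2.
Proof. by vm_compute. Qed.

(** The norm equation of a column whose outer coordinates differ by w; the right-hand side is the
    norm of the basis vector, 1 for the middle one. *)
Lemma columns2 (w a a' b b' : int) : w = 1 \/ w = -1 \/ w = 0 ->
  2 * (a * a + a' * a' + w * a) + b * b + b' * b' = (w == 0) ->
  [/\ a' = 0, a = 0 \/ a = - w, w <> 0 -> b = 0, w <> 0 -> b' = 0 & w = 0 -> gu (b, b')].
Proof.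
rewrite /gu /gnorm /=; have := sq_ge0 a'; have := sq_ge0 b; have := sq_ge0 b'; have := sq_ge0 a.
by move=> h1 h2 h3 h4 [->|[->|->]] /= h; split; try (right; nia); nia.
Qed.

Lemma covers_columns2 A : gunit A -> gapp A gv2 = gv2 -> A \in candidates2.
Proof.
move=> uA Av.
have m0 : gcol A i0 \in [:: ((1, 0), (0, 0), (0, 0)); ((0, 0), (0, 0), (-1, 0))].
  have [] := gcol_data i0 uA Av; case: (gcol A i0) => [[[a a'] [b b']] [c c']].
  rewrite /gherm /gsq /gherm /gbase /gdot /gadd /gmul /gconj /gv2 /= => -[h1 h2] h3.
  have [||p q r t _] := @columns2 (-1) a a' b b'; [by right; left|lia|].
  have ec : c = a - 1 by lia.
  have ec' : c' = a' by lia.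
  by rewrite ec ec' p r// t//; case: q => ->.
have m1 : exists2 u, u \in gunits & gcol A i1 = ((0, 0), u, (0, 0)).
  have [] := gcol_data i1 uA Av; case: (gcol A i1) => [[[a a'] [b b']] [c c']].
  rewrite /gherm /gsq /gherm /gbase /gdot /gadd /gmul /gconj /gv2 /= => -[h1 h2] h3.
  have [||p q r t u] := @columns2 0 a a' b b'; [by right; right|lia|].
  have ec : c = a by lia.
  have ec' : c' = a' by lia.
  exists (b, b'); first exact: mem_gunits (u erefl).
  by rewrite ec ec' p; case: q => ->.
have m2 : gcol A i2 \in [:: ((0, 0), (0, 0), (1, 0)); ((-1, 0), (0, 0), (0, 0))].
  have [] := gcol_data i2 uA Av; case: (gcol A i2) => [[[a a'] [b b']] [c c']].
  rewrite /gherm /gsq /gherm /gbase /gdot /gadd /gmul /gconj /gv2 /= => -[h1 h2] h3.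
  have [||p q r t _] := @columns2 1 a a' b b'; [by left|lia|].
  have ec : c = a + 1 by lia.
  have ec' : c' = a' by lia.
  by rewrite ec ec' p r// t//; case: q => ->.
have [u uu e1] := m1.
rewrite [A]gcolE; apply/allpairsPdep; exists (gcol A i0), (gcol A i1, gcol A i2).
split; [exact: m0| |by []]; apply/allpairsPdep; exists u, (gcol A i2).
by split; [exact: uu|exact: m2|rewrite e1].
Qed.

Section CompleteRational.
Variable R : realType.
Local Notation vC := (gauss_vec R).

Lemma complete1 : complete (vC gv1) (map gword words1).
Proof. exact: (@complete_box R gv1 _ erefl erefl box1 covers1). Qed.

Lemma complete2 : complete (vC gv2) (map gword words2).
Proof.
apply: (@complete_gauss R gv2 i0) => // A uA Av.
exact: (covers_has covers2 uA (covers_columns2 uA Av)).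
Qed.

Lemma complete3 : complete (vC gv3) (map gword words3).
Proof. exact: (@complete_box R gv3 _ erefl erefl box3 covers3). Qed.

Lemma word_eig (v : 'cV[C R]_3) (gens : seq gm) (ws : seq (seq gm)) :
  all (all (fun g => g \in gens)) ws ->
  (forall g, g \in gens -> exists c, gauss_mx R g *m v = c *: v) ->
  forall g, g \in map gword ws -> exists c, gauss_mx R g *m v = c *: v.
Proof.
move=> /allP wsg h _ /mapP[w /wsg ww ->]; elim: w ww => [_|g w IH /= /andP[gg ww]].
  by exists 1; rewrite mC1 mul1mx scale1r.
have [c ec] := h g gg; have [d ed] := IH ww.
by exists (d * c); rewrite mCM -mulmxA ed -scalemxAr ec scalerA.
Qed.

Lemma grefl_stab c w v : gherm v w = (0, 0) -> exists d, gauss_mx R (grefl c w) *m vC v = d *: vC v.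
Proof. by move=> h; exists 1; rewrite grefl_app herm_vC h gC0 mulr0 scale0r addr0 scale1r. Qed.

End CompleteRational.

(** * Enumeration at the two irrational points *)

(** The exponent of p is even on the left and odd on the right. *)
Lemma prime_square_ratio (p : nat) (x y : int) : prime p -> x * x = p%:Z * (y * y) -> y = 0.
Proof.
move=> pp e; have [//|y0] := eqVneq y 0; exfalso.
have x0 : x != 0.
  apply: contra_neq y0 => x0; rewrite x0 mul0r in e.
  have p0 := prime_gt0 pp; nia.
have : (absz x * absz x = p * (absz y * absz y))%N.
  by apply/eqP; rewrite -!abszM -[p in eqbRHS]/(absz p%:Z) -abszM e.
move=> /(congr1 (logn p)).
rewrite !lognM ?muln_gt0 ?absz_gt0 ?x0 ?y0 ?prime_gt0// (@logn_prime p p)//.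
move: (logn p `|x|) (logn p `|y|) => a b; rewrite eqxx; lia.
Qed.

(* the matrices with eigenvalue p + q z (resp. p + q t) at (1, z, z) (resp. (1, 0, t)) and
   eigenvalue u at (1, -1, 0) (resp. (0, 1, 0)), where z^2 = (1 - i) - 2 i z and t^2 = 1 - i t *)
Definition mk4 (p q u : gi) : gm :=
  let r := gmul (1, -1) q in let s := gadd p (gmul (0, -2) q) in
  let sub x y := gadd x (gopp y) in
  gtr ((p, r, r), (sub p u, gadd r u, r), (gadd (sub q p) u, sub (sub s r) u, sub s r)).
Definition mk5 (p q u : gi) : gm :=
  ((p, (0, 0), q), ((0, 0), u, (0, 0)), (q, (0, 0), gadd p (gmul (0, -1) q))).

Definition candidates (mk : gi -> gi -> gi -> gm) : seq gm :=
  [seq mk x.1 x.2 u | x <- [seq (p, q) | p <- gbox, q <- gbox], u <- gunits].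

Lemma covers4 : covers (map gword words4) (candidates mk4).
Proof. by vm_compute. Qed.

Lemma covers5 : covers (map gword words5) (candidates mk5).
Proof. by vm_compute. Qed.

Lemma mem_candidates mk p q u : p \in gbox -> q \in gbox -> gu u -> mk p q u \in candidates mk.
Proof.
move=> pb qb uu; apply/allpairsPdep; exists (p, q), u; split; [|exact: mem_gunits|by []].
by apply/allpairsPdep; exists p, q.
Qed.

Section Irrational.
Variable R : realType.
Local Notation K := (C R).
Local Notation vec := (@vec3 R).
Local Notation mC := (gauss_mx R).
Local Notation vC := (gauss_vec R).
Local Notation gC := (gauss R).

Lemma irrational_indep (s : K) x y : 0 < s -> (forall a b : int, a%:~R + s * b%:~R = 0 -> b = 0) ->
  gC x + s * gC y = 0 -> y = (0, 0).
Proof.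
move=> s0 h e; have [r1 j1] := gC_re_im R x; have [r2 j2] := gC_re_im R y.
have sr : s \is Num.real by exact: gtr0_real.
have er : 'Re (gC x + s * gC y) = 0 by rewrite e raddf0.
have ei : 'Im (gC x + s * gC y) = 0 by rewrite e raddf0.
rewrite raddfD/= (ReMl sr) r1 r2 in er; rewrite raddfD/= (ImMl sr) j1 j2 in ei.
by case: y er ei {e r2 j2} => [y1 y2] /= /h -> /h ->.
Qed.

(** Over Q(i), z is an affine function of the real irrational s with nonzero slope, and for s real
    and imaginary parts can be separated. *)
Lemma gC_indep (z s : K) x y : 0 < s -> (forall a b : int, a%:~R + s * b%:~R = 0 -> b = 0) ->
  (exists m n k, [/\ n != (0, 0), k != (0, 0) & gC k * z = gC m + s * gC n]) ->
  gC x + z * gC y = 0 -> x = (0, 0) /\ y = (0, 0).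
Proof.
move=> s0 h [m [n [k [n0 k0 e]]]] exy.
have nC : gC n != 0 by rewrite gC_eq0.
have yC : gC y = 0.
  have /(irrational_indep s0 h) : gC (gadd (gmul k x) (gmul m y)) + s * gC (gmul n y) = 0.
    rewrite gCD !gCM; transitivity (gC k * gC x + (gC m + s * gC n) * gC y); first by ring.
    by rewrite -e -mulrA -mulrDr exy mulr0.
  move=> /eqP; rewrite -(gC_eq0 R) gCM mulf_eq0 (negPf nC) => /eqP //.
move: exy; rewrite yC mulr0 addr0 => xC.
by split; apply/eqP; rewrite -(gC_eq0 R) ?xC ?yC.
Qed.

Definition z4 : K := 'i * (zeta R 8 - 1).
Definition t5 : K := - zeta R 12.

Lemma z4_indep x y : gC x + z4 * gC y = 0 -> x = (0, 0) /\ y = (0, 0).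
Proof.
rewrite /z4; have [s [s0 s2 ->]] := zeta8E R.
apply: (@gC_indep _ s) => //.
  move=> a b e; apply: (@prime_square_ratio 2 (2 * a)) => //; apply: (@intK_eq R).
  have -> : (2 * a * (2 * a))%:~R = 4 * a%:~R * a%:~R :> K by rewrite !rmorphM /=; ring.
  have -> : a%:~R = - (s * b%:~R) :> K by apply/eqP; rewrite -addr_eq0 e.
  rewrite !rmorphM /=; transitivity (2 * (2 * s * s) * (b%:~R * b%:~R) : K); first by ring.
  by rewrite s2 mulr1.
exists (0, -1), (-1, 1), (1, 0); split=> //.
by rewrite gC1 /gauss /=; have := ii R; move: ('i : K) => I hI; ring: hI.
Qed.

Lemma t5_indep x y : gC x + t5 * gC y = 0 -> x = (0, 0) /\ y = (0, 0).
Proof.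
rewrite /t5; have [s [s0 s2 ->]] := zeta12E R.
apply: (@gC_indep _ s) => //.
  move=> a b e; apply: (@prime_square_ratio 3 (2 * a)) => //; apply: (@intK_eq R).
  have -> : (2 * a * (2 * a))%:~R = 4 * a%:~R * a%:~R :> K by rewrite !rmorphM /=; ring.
  have -> : a%:~R = - (s * b%:~R) :> K by apply/eqP; rewrite -addr_eq0 e.
  rewrite !rmorphM /=; transitivity ((4 * s * s) * (b%:~R * b%:~R) : K); first by ring.
  by rewrite s2.
exists (0, -1), (-2, 0), (2, 0); split=> //.
by rewrite /gauss /=; field.
Qed.

Lemma herm_v4 : herm (vec 1 z4 z4) (vec 1 z4 z4) < 0.
Proof. exact: herm_p4. Qed.

Lemma z4_sq : z4 * z4 = gC (1, -1) + z4 * gC (0, -2).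
Proof.
rewrite /z4; have [s [s0 s2 ->]] := zeta8E R; rewrite /gauss /=.
have := ii R; move: ('i : K) => I hI.
have -> : I * (s * (1 + I) - 1) = s * (I - 1) - I by ring: hI.
have -> : (s * (I - 1) - I) * (s * (I - 1) - I) = - (2 * s * s) * I - 2 * s * I * (I - 1) + I * I.
  by ring: hI.
by rewrite s2; ring: hI.
Qed.

Lemma t5_sq : t5 * t5 = gC (1, 0) + t5 * gC (0, -1).
Proof.
rewrite /t5; have [s [s0 s2 ->]] := zeta12E R; rewrite /gauss /=.
have := ii R; move: ('i : K) => I hI.
have -> : - (s + I / 2) * - (s + I / 2) = (4 * s * s) / 4 + s * I + (I * I) / 4 by field.
rewrite s2 hI; have -> : - (s + I / 2) * (0%:~R + (-1)%:~R * I) = s * I + (I * I) / 2 by field.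
by rewrite hI; field.
Qed.

Lemma gsub_eq0 x y : gadd x (gopp y) = (0, 0) -> x = y.
Proof. case: x y => [a a'] [b b']; rewrite /gadd /gopp /= => -[h1 h2]; congr (_, _); lia. Qed.

(** The eigenvalue a + z b times z is expanded with the quadratic equation of z, and coefficients of
    1 and z are compared. *)
Lemma irrational_stab z x0 x1 c a b d e : (forall x y, gC x + z * gC y = 0 -> x = (0, 0) /\ y = (0, 0)) ->
  z * z = gC x0 + z * gC x1 -> c = gC a + z * gC b ->
  gC d + z * gC e = c * z -> d = gmul x0 b /\ e = gadd a (gmul x1 b).
Proof.
move=> ind zz -> h.
have /ind[/gsub_eq0 h1 /gsub_eq0 h2] // : gC (gadd d (gopp (gmul x0 b))) + z * gC (gadd e (gopp (gadd a (gmul x1 b)))) = 0.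
rewrite !(gCD, gCN, gCM); transitivity ((gC d + z * gC e) - (z * gC a + (gC x0 + z * gC x1) * gC b)); first by ring.
by rewrite h -zz; ring.
Qed.

Lemma lattice_eig z B (a b : gv) c i : mC B *m (vC a + z *: vC b) = c *: (vC a + z *: vC b) ->
  gC (gcoord (gapp B a) i) + z * gC (gcoord (gapp B b) i) = c * (gC (gcoord a i) + z * gC (gcoord b i)).
Proof.
rewrite mulmxDr -scalemxAr -!vC_app => e; rewrite -!vC_coord.
have lc (u w : 'cV[K]_3) : (u + z *: w) i 0 = u i 0 + z * w i 0 by rewrite !mxE.
have sc (u : 'cV[K]_3) : (c *: u) i 0 = c * u i 0 by rewrite !mxE.
have : (vC (gapp B a) + z *: vC (gapp B b)) i 0 = (c *: (vC a + z *: vC b)) i 0 by rewrite e.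
by rewrite lc sc lc.
Qed.

Lemma v4E : vec 1 z4 z4 = vC ((1, 0), (0, 0), (0, 0)) + z4 *: vC ((0, 0), (1, 0), (1, 0)).
Proof. by apply: vecP; rewrite !mxE /= /gauss /=; ring. Qed.

(** Independence of 1 and z4 over Q(i) lets the eigenvalue p + q z4 determine B on the plane of
    (1,0,0) and (0,1,1). The orthogonal vector (1,-1,0) is multiplied by a unit, so B is of the form
    [mk4], and its unitarity bounds p and q. *)
Lemma complete4 : complete (vec 1 z4 z4) (map gword words4).
Proof.
move=> B c uB e; apply: (covers_has covers4 uB).
have q0 : gsq (gapp B ((1, 0), (0, 0), (0, 0))) = 0 by rewrite gsq_unit.
have q1 : gsq (gapp B ((0, 0), (1, 0), (1, 0))) = 1 by rewrite gsq_unit.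
have q2 : gsq (gapp B ((1, 0), (-1, 0), (0, 0))) = 1 by rewrite gsq_unit.
have cc := eig_norm (UJ_mC R uB) e (ltr0_neq0 herm_v4).
have e3 : herm (vC (gapp B ((1, 0), (-1, 0), (0, 0)))) (vec 1 z4 z4) = 0.
  rewrite vC_app; apply: (eig_perp (UJ_mC R uB) e cc); rewrite hermE /gauss_vec !vec3E /gauss /=; ring.
rewrite v4E in e.
have e0 := lattice_eig i0 e; have e1 := lattice_eig i1 e; have e2 := lattice_eig i2 e.
(* The standard basis is expressed by y, f, x, the images of (1,0,0), (0,1,1), (1,-1,0): e2 = e1 -
   (1,-1,0) and e3 = (0,1,1) - e2. *)
have eB : B = let y := gapp B ((1, 0), (0, 0), (0, 0)) in let f := gapp B ((0, 0), (1, 0), (1, 0)) in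
   let x := gapp B ((1, 0), (-1, 0), (0, 0)) in
   gtr (y, gvadd y (gscale (-1, 0) x), gvadd f (gvadd (gscale (-1, 0) y) x)).
  case: (B) => [[[[[a1 a1'] [a2 a2']] [a3 a3']] [[[b1 b1'] [b2 b2']] [b3 b3']]] [[[c1 c1'] [c2 c2']] [c3 c3']]].
  rewrite /gapp /gdot /gvadd /gscale /gadd /gmul /gtr /=.
  by congr ((_, _), (_, _), (_, _), ((_, _), (_, _), (_, _)), ((_, _), (_, _), (_, _))); ring.
rewrite eB; move: e0 e1 e2 e3 q0 q1 q2.
move: (gapp B ((1, 0), (0, 0), (0, 0))) (gapp B ((0, 0), (1, 0), (1, 0))) (gapp B ((1, 0), (-1, 0), (0, 0))).
move=> [[p r] r'] [[q s] s'] [[x1 x2] x3]; rewrite /gcoord /=.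
rewrite gC1 gC0 mulr0 addr0 mulr1 add0r mulr1 => e0 e1 e2.
have [h1 h2] := irrational_stab z4_indep z4_sq (esym e0) e1.
have [h3 h4] := irrational_stab z4_indep z4_sq (esym e0) e2.
rewrite hermE !vec3E rmorph1 mul1r => e3 q0 q1 q2.
have /z4_indep[h5 h6] : gC (gconj x3) + z4 * gC (gconj (gadd x1 x2)) = 0.
  rewrite !gC_conj gCD; apply: (can_inj conjCK); rewrite rmorphD rmorphM /= !conjCK rmorph0 -e3.
  by rewrite mulrDr addrC.
have ex3 : x3 = (0, 0) by case: x3 h5 {e3 q2 eB} => [a b]; rewrite /gconj /= => -[h h']; congr (_, _); lia.
have ex2 : x2 = gopp x1.
  by case: x1 x2 h6 {e3 q2 eB} => [a b] [a' b']; rewrite /gconj /gopp /gadd /= => -[h h']; congr (_, _); lia.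
subst r s r' s' x3 x2.
have eC : (p, gadd p (gmul (-1, 0) x1), gadd q (gadd (gmul (-1, 0) p) x1),
   (gmul (1, -1) q, gadd (gmul (1, -1) q) (gmul (-1, 0) (gopp x1)),
     gadd (gadd p (gmul (0, -2) q)) (gadd (gmul (-1, 0) (gmul (1, -1) q)) (gopp x1))),
   (gmul (1, -1) q, gadd (gmul (1, -1) q) (gmul (-1, 0) (0, 0)),
     gadd (gadd p (gmul (0, -2) q)) (gadd (gmul (-1, 0) (gmul (1, -1) q)) (0, 0)))) = mk4 p q x1.
  case: p q x1 {eB e0 e1 e2 e3 q0 q1 q2 h5 h6} => [a a'] [b b'] [d d'].
  rewrite /mk4 /gtr /gadd /gmul /gopp /=.
  by congr ((_, _), (_, _), (_, _), ((_, _), (_, _), (_, _)), ((_, _), (_, _), (_, _))); ring.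
rewrite eC; move: q0 q1 q2; clear; case: p q x1 => [a a'] [b b'] [d d'].
rewrite /gsq /gherm /gdot /gadd /gmul /gopp /gconj /= => q0 q1 q2.
(* The difference of [q1] and [q0], which reads |q + i p|^2 + |q|^2 = 1. *)
have key : (b - a') * (b - a') + (b' + a) * (b' + a) + b * b + b' * b' = 1 by lia.
have n2 : d * d + d' * d' = 1 by lia.
have s1 := sq_ge0 (b - a'); have s2 := sq_ge0 (b' + a); have s3 := sq_ge0 b; have s4 := sq_ge0 b'.
have [b1 b2] : -1 <= b <= 1 /\ -1 <= b' <= 1 by split; clear -key s1 s2 s3 s4; nia.
have [c1 c2] : -1 <= b - a' <= 1 /\ -1 <= b' + a <= 1.
  by move: (b - a') (b' + a) key s1 s2 => x y; clear -s3 s4 => *; split; nia.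
by apply: mem_candidates; [apply: mem_gbox; lia|apply: mem_gbox; lia|rewrite /gu /gnorm n2].
Qed.

Lemma v5E : vec 1 0 t5 = vC ((1, 0), (0, 0), (0, 0)) + t5 *: vC ((0, 0), (0, 0), (1, 0)).
Proof. by apply: vecP; rewrite !mxE /= /gauss /=; ring. Qed.

Lemma herm_v5 : herm (vec 1 0 t5) (vec 1 0 t5) < 0.
Proof.
rewrite /t5; have [s [s0 s2 ->]] := zeta12E R.
have sc : s^* = s by apply: CrealP; apply: gtr0_real.
have -> : herm (vec 1 0 (- (s + 'i / 2))) (vec 1 0 (- (s + 'i / 2))) = - (2 * s).
  rewrite herm_vec mul1r conjCK mul0r rmorphN rmorphD fmorph_div /= sc conjCi rmorph_nat; by field.
by rewrite oppr_lt0 mulr_gt0 ?ltr0n.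
Qed.

Lemma complete5 : complete (vec 1 0 t5) (map gword words5).
Proof.
move=> B c uB e; apply: (covers_has covers5 uB).
have q0 : gsq (gapp B ((1, 0), (0, 0), (0, 0))) = 0 by rewrite gsq_unit.
have q1 : gherm (gapp B ((0, 0), (0, 0), (1, 0))) (gapp B ((1, 0), (0, 0), (0, 0))) = (1, 0) by rewrite gherm_unit.
have q2 : gsq (gapp B ((0, 0), (1, 0), (0, 0))) = 1 by rewrite gsq_unit.
have cc := eig_norm (UJ_mC R uB) e (ltr0_neq0 herm_v5).
have e3 : herm (vC (gapp B ((0, 0), (1, 0), (0, 0)))) (vec 1 0 t5) = 0.
  rewrite vC_app; apply: (eig_perp (UJ_mC R uB) e cc); rewrite hermE /gauss_vec !vec3E rmorph0 /gauss /=; ring.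
rewrite v5E in e.
have e0 := lattice_eig i0 e; have e1 := lattice_eig i1 e; have e2 := lattice_eig i2 e.
have eB : B = gtr (gapp B ((1, 0), (0, 0), (0, 0)), gapp B ((0, 0), (1, 0), (0, 0)), gapp B ((0, 0), (0, 0), (1, 0))).
  exact: gcolE.
rewrite eB; move: e0 e1 e2 e3 q0 q1 q2.
move: (gapp B ((1, 0), (0, 0), (0, 0))) (gapp B ((0, 0), (0, 0), (1, 0))) (gapp B ((0, 0), (1, 0), (0, 0))).
move=> [[p p'] r] [[q q'] s] [[x1 x2] x3]; rewrite /gcoord /=.
rewrite gC1 gC0 !(mulr0, addr0, add0r, mulr1) => e0 /t5_indep[-> ->] e2.
have [h1 h2] := irrational_stab t5_indep t5_sq (esym e0) e2.
rewrite hermE !vec3E rmorph1 rmorph0 mul1r mul0r addr0 => e3 q0 q1 q2.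
have /t5_indep[h5 h6] : gC (gconj x3) + t5 * gC (gconj x1) = 0.
  by rewrite !gC_conj; apply: (can_inj conjCK); rewrite rmorphD rmorphM /= !conjCK rmorph0 -e3 addrC.
have c0 x : gconj x = (0, 0) -> x = (0, 0) by case: x => [a b] [-> h]; congr (_, _); lia.
rewrite (c0 _ h5) (c0 _ h6) in q2 *; subst r s.
have eC : (p, (0, 0), q, ((0, 0), x2, (0, 0)), (gmul (1, 0) q, (0, 0), gadd p (gmul (0, -1) q))) = mk5 p q x2.
  by rewrite /mk5; congr (_, _, (_, _, _)); case: (q) => a b; rewrite /gmul /=; congr (_, _); ring.
rewrite eC; move: q0 q1 q2; clear; case: p q x2 => [a a'] [b b'] [d d'].
rewrite /gsq /gherm /gdot /gadd /gmul /gopp /gconj /= => q0 -[q1 _] q2.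
(* Twice [q1], written as a sum of squares. *)
have key : (a + b') * (a + b') + (a' - b) * (a' - b) + a * a + a' * a' + b * b + b' * b' = 2 by lia.
have n2 : d * d + d' * d' = 1 by lia.
have s1 := sq_ge0 (a + b'); have s2 := sq_ge0 (a' - b); have s3 := sq_ge0 b; have s4 := sq_ge0 b'.
have s5 := sq_ge0 a; have s6 := sq_ge0 a'.
have le2 : a * a + a' * a' + b * b + b' * b' <= 2 by lia.
apply: mem_candidates; [apply: mem_gbox; clear -le2 s3 s4 s5 s6; nia|apply: mem_gbox; clear -le2 s3 s4 s5 s6; nia|by rewrite /gu /gnorm n2].
Qed.
End Irrational.

(** * The five groups *)

Definition group_list (l : seq gm) : bool :=
  let mem A := has (fun g => gproj g A) l in
  [&& all gunit l, mem gid, all (fun A => all (fun B => mem (gmm A B)) l) l & all (fun A => mem (ginv A)) l].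

Fixpoint galt (A B : gm) (n : nat) : gm := if n is m.+1 then gmm A (galt B A m) else gid.

Definition gbraid (A B : gm) (n : nat) : bool :=
  [&& (1 < n)%N, gunit A, gunit B, gproj (galt A B n) (galt B A n) &
    all (fun m => ~~ gproj (galt A B m) (galt B A m)) (iota 2 (n - 2))].

Definition mirror_list1 : seq (gv * nat) :=
  [:: (((0, 0), (1, 1), (1, 0)), 2%N); (((1, 0), (0, 0), (1, 0)), 2%N); (((1, 0), (-1, -1), (0, 0)), 2%N)].
Definition mirror_list2 : seq (gv * nat) := [:: (((0, 0), (1, 0), (0, 0)), 0%N); (((1, 0), (0, 0), (1, 0)), 2%N)].
Definition mirror_list3 : seq (gv * nat) :=
  [:: (((0, 0), (1, 0), (1, 0)), 1%N); (((1, 0), (-1, 0), (0, 0)), 1%N); (((1, 0), (0, 0), (1, 0)), 2%N);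
      (((1, 0), (-1, -1), (0, -1)), 2%N); (((1, 0), (-2, 0), (-1, 0)), 2%N); (((1, 0), (-1, 1), (0, 1)), 2%N)].
Definition mirror_list4 : seq (gv * nat) := [:: (((1, 0), (-1, 0), (0, 0)), 1%N)].
Definition mirror_list5 : seq (gv * nat) := [:: (((0, 0), (1, 0), (0, 0)), 0%N)].

Definition mirror_check (l : seq gm) (D : seq (gv * nat)) (N : seq gv) : bool :=
  [&& all gunit l, reflections_covered l (map fst D) N & mirror_data l D].

Lemma mirrors1 : mirror_check (map gword words1) mirror_list1 [::].
Proof. by vm_compute. Qed.
Lemma mirrors2 : mirror_check (map gword words2) mirror_list2 [:: gv2].
Proof. by vm_compute. Qed.
Lemma mirrors3 : mirror_check (map gword words3) mirror_list3 [:: gv3].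
Proof. by vm_compute. Qed.
Lemma mirrors4 : mirror_check (map gword words4) mirror_list4 [::].
Proof. by vm_compute. Qed.
Lemma mirrors5 : mirror_check (map gword words5) mirror_list5 [::].
Proof. by vm_compute. Qed.

Definition cyclic_refl (w : gv) : seq gm := map gword [seq nseq i (grefl (-1, 1) w) | i <- iota 0 4].

Definition reflections_cyclic (l : seq gm) (D : seq (gv * nat)) (w : gv) : bool :=
  [&& group_list (cyclic_refl w), distinct_classes (cyclic_refl w), good_refl (-1, 1) w,
   has (fun g => gproj g (grefl (-1, 1) w)) l &
   all (fun A => has (fun d => is_grefl d.1 A) D ==> has (fun g => gproj g A) (cyclic_refl w)) l].

Lemma cyclic4 : reflections_cyclic (map gword words4) mirror_list4 ((1, 0), (-1, 0), (0, 0)).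
Proof. by vm_compute. Qed.
Lemma cyclic5 : reflections_cyclic (map gword words5) mirror_list5 ((0, 0), (1, 0), (0, 0)).
Proof. by vm_compute. Qed.

Section Groups.
Variable R : realType.
Local Notation K := (C R).
Local Notation vec := (@vec3 R).
Local Notation mC := (gauss_mx R).
Local Notation vC := (gauss_vec R).
Local Notation gC := (gauss R).
Local Notation cl := (gauss_class R).

Lemma cls_mem l A : all gunit l -> gunit A -> has (fun g => gproj g A) l -> @cls R l (cl A).
Proof.
move=> /allP ul uA /hasP[g gl gA]; exists g; first exact: gl.
by apply/esym; apply/cl_eqP => //; exact: ul.
Qed.

Lemma subgroup_cls l : group_list l -> is_subgroup (@cls R l).
Proof.
move=> /and4P[ul h1 hM hV]; have /allP ul' := ul; split.
- by move=> _ [g gl ->]; apply: cl_PUJ; exact: ul'.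
- by rewrite -cl1; apply: cls_mem => //; exact: gunit1.
- move=> _ _ [g gl ->] [h hl ->]; rewrite cl_mul; apply: (cls_mem ul).
    by apply: gunitM; exact: ul'.
  exact: (allP (allP hM g gl) h hl).
- move=> _ [g gl ->]; exists (cl (ginv g)); last by apply: cl_mulV; exact: ul'.
  by apply: (cls_mem ul); [apply: gunitV; exact: ul'|exact: (allP hV g gl)].
Qed.

Lemma alternating_cl A B n : alternating (cl A) (cl B) n = cl (galt A B n).
Proof. by elim: n A B => [|n IH] A B /=; rewrite ?cl1// IH cl_mul. Qed.

Lemma gunit_alt A B n : gunit A -> gunit B -> gunit (galt A B n).
Proof. by elim: n A B => [|n IH] A B uA uB /=; rewrite ?gunit1// gunitM// IH. Qed.

Lemma braid_length_cl A B n : gbraid A B n -> braid_length (cl A) (cl B) n.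
Proof.
move=> /and5P[n1 uA uB /(cl_eqP R (gunit_alt n uA uB) (gunit_alt n uB uA)) e /allP h].
split; [exact: n1|by rewrite !alternating_cl|].
move=> m /andP[m2 mn]; rewrite !alternating_cl.
move=> /(cl_eqP R (gunit_alt m uA uB) (gunit_alt m uB uA)); apply/negP; apply: h.
by rewrite mem_iota m2 subnKC.
Qed.

Lemma vC_gwt0 : vC (gwt 0) = vec 0 1 0.
Proof. by apply: vecP; rewrite !vec3E /gauss /=; ring. Qed.
Lemma vC_gwt1 : vC (gwt 1) = vec 1 (-1) 0.
Proof. by apply: vecP; rewrite !vec3E /gauss /=; ring. Qed.
Lemma vC_gwt2 : vC (gwt 2) = vec 1 0 1.
Proof. by apply: vecP; rewrite !vec3E /gauss /=; ring. Qed.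

Lemma mirror_counts_cls (v : 'cV[K]_3) l D N : isotropy <[v]>%VS = @cls R l -> mirror_check l D N ->
  let n j := count (fun d => d.2 == j) D in
  mirror_counts (isotropy <[v]>%VS) (n 0%N) (n 1%N) (n 2%N).
Proof.
move=> eG /and3P[ul cov dat] n.
have h j := @mirrors_in_orbit_card R v l D N j eG ul cov dat.
by split; [rewrite -vC_gwt0|rewrite -vC_gwt1|rewrite -vC_gwt2]; exact: h.
Qed.

Lemma reflection_subgroup_words (v : 'cV[K]_3) (gens : seq gm) (ws : seq (seq gm)) : v != 0 ->
  isotropy <[v]>%VS = @cls R (map gword ws) -> all (all (fun g => g \in gens)) ws ->
  (forall g, g \in gens -> isotropy <[v]>%VS (cl g) /\ complex_reflection (cl g)) ->
  isotropy <[v]>%VS = reflection_subgroup (isotropy <[v]>%VS).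
Proof.
move=> v0 e /allP wg h; apply: (generated_words v0 e); first by move=> g [].
by move=> w g ww gw; apply: h; exact: (allP (wg w ww) g gw).
Qed.

Lemma generated_pair (v : 'cV[K]_3) a b (ws : seq (seq gm)) : v != 0 ->
  isotropy <[v]>%VS = @cls R (map gword ws) -> all (all (fun g => g \in [:: a; b])) ws ->
  (forall g, g \in [:: a; b] -> isotropy <[v]>%VS (cl g)) ->
  isotropy <[v]>%VS = generated [set cl a; cl b].
Proof.
move=> v0 e /allP wg h; apply: (generated_words v0 e).
  by move=> g [->|->]; apply: h; rewrite !inE eqxx ?orbT.
move=> w g ww gw; have := allP (wg w ww) g gw; rewrite !inE => /orP[/eqP ->|/eqP ->]; [by left|by right].
Qed.

Lemma generated_single (v : 'cV[K]_3) a (ws : seq (seq gm)) : v != 0 ->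
  isotropy <[v]>%VS = @cls R (map gword ws) -> all (all (fun g => g \in [:: a])) ws ->
  isotropy <[v]>%VS (cl a) -> isotropy <[v]>%VS = generated [set cl a].
Proof.
move=> v0 e /allP wg h; apply: (generated_words v0 e); first by move=> _ ->.
by move=> w g ww gw; have := allP (wg w ww) g gw; rewrite inE => /eqP ->.
Qed.

Lemma cyclic_words w : all (all (fun g => g \in [:: grefl (-1, 1) w])) [seq nseq i (grefl (-1, 1) w) | i <- iota 0 4].
Proof. by rewrite /= !inE eqxx. Qed.

(** Every reflection of the group is one along an entry of D, and the finite check finds it among
    the four powers of r; conversely r is itself a reflection of the group. *)
Lemma reflection_subgroup_cyclic (v : 'cV[K]_3) l D N w : isotropy <[v]>%VS = @cls R l ->
  mirror_check l D N -> reflections_cyclic l D w ->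
  let RG := reflection_subgroup (isotropy <[v]>%VS) in
  RG #= `I_4 /\ RG = generated [set cl (grefl (-1, 1) w)].
Proof.
move=> eG /and3P[ul cov _] /and5P[gl dl gr ml rl] RG.
have /and4P[uc _ _ _] := gl.
set r := grefl (-1, 1) w in gr ml *.
have ur : gunit r by case/and4P: gr.
have sub H : is_subgroup H -> H (cl r) -> @cls R (cyclic_refl w) `<=` H.
  move=> sH Hr _ [_ /mapP[x xw ->] ->]; apply: subgroup_word => // g gx.
  have /allP := allP (cyclic_words w) x xw => /(_ g gx); rewrite inE => /eqP -> //.
have rc : @cls R (cyclic_refl w) (cl r).
  by exists (gword [:: r]); [apply: map_f; rewrite !inE eqxx ?orbT|rewrite /= gmm1].
have e1 : generated [set cl r] = @cls R (cyclic_refl w).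
  apply/seteqP; split; first by apply: smallest_sub; [exact: subgroup_cls|by move=> _ ->].
  by move=> x cx H [sH rH]; apply: (sub H sH _ x cx); exact: rH.
have e2 : RG = @cls R (cyclic_refl w).
  apply/seteqP; split.
    apply: smallest_sub; first exact: subgroup_cls.
    move=> g []; rewrite eG => -[A Al ->] [M rM].
    have [d dD [_ rA]] := reflection_cases ul cov Al rM.
    have [d' dD' ed] := mapP dD.
    apply: cls_mem => //; first exact: (allP ul).
    have /implyP := allP rl A Al; apply; apply/hasP; exists d'; first exact: dD'.
    by rewrite -ed.
  move=> x cx H [sH rH]; apply: (sub H sH _ x cx); apply: rH; split.
    by rewrite eG; apply: cls_mem.
  exists (mirror (vC w)); exact: grefl_is_reflection.
by rewrite e1 e2; split; first exact: (card_cls R uc dl).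
Qed.

(** Conjugation by the element carrying v to w is a bijection of the isotropy groups. *)
Lemma korb_card (v w : 'cV[K]_3) : v != 0 -> korb v w -> isotropy <[v]>%VS #= isotropy <[w]>%VS.
Proof.
move=> v0 [h [c [uh c0 ew]]].
have w0 : w != 0 by rewrite ew scaler_eq0 (negPf c0) (unit_mx_app (mC_unitmx R uh).1 v0).
have hh : (cl h * cl (ginv h))%VS = 1%VS by exact: cl_mulV.
have hh' : (cl (ginv h) * cl h)%VS = 1%VS by rewrite -{2}[h]ginvK; apply: cl_mulV; exact: gunitV.
pose f (g : mxclass R) : mxclass R := (cl h * g * cl (ginv h))%VS.
have fK g : (cl (ginv h) * f g * cl h)%VS = g.
  by rewrite /f !prodvA hh' prod1v -prodvA hh' prodv1.
have -> : isotropy <[w]>%VS = f @` isotropy <[v]>%VS.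
  apply/seteqP; split=> [_ /(isotropyP _ w0)[B [d [uB -> eB]]]|_ [_ /(isotropyP _ v0)[B [d [uB -> eB]]] <-]].
    exists (cl (gmm (ginv h) (gmm B h))).
      apply/(isotropyP _ v0); exists (gmm (ginv h) (gmm B h)), d; split=> //.
        by apply: gunitM; [exact: gunitV|exact: gunitM].
      apply: (scalerI c0); rewrite !mCM -!mulmxA scalemxAr [X in _ *m X]scalemxAr -ew eB ew.
      by rewrite -!scalemxAr mC_V// !scalerA mulrC.
    by rewrite /f !cl_mul -!gmmA (gunitP _ uh).2 gmm1 gmmA (gunitP _ uh).2 gmm1l.
  apply/(isotropyP _ w0); exists (gmm h (gmm B (ginv h))), d; split.
  - by apply: gunitM => //; apply: gunitM => //; exact: gunitV.
  - by rewrite /f !cl_mul gmmA.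
  - by rewrite ew !mCM -!mulmxA -!scalemxAr mC_V// eB -scalemxAr !scalerA mulrC.
rewrite card_eq_sym; apply: inj_card_eq => x y _ _ e; by rewrite -(fK x) e fK.
Qed.
End Groups.

(** * The data of the five points and the conclusion *)

Lemma polar_data_a1 : polar_data ((0, 0), (1, 1), (1, 0)) (gbase i2) (gbase i0).
Proof. by vm_compute. Qed.
Lemma polar_data_b : polar_data ((1, 0), (0, 0), (1, 0)) (gbase i1) (gbase i0).
Proof. by vm_compute. Qed.
Lemma polar_data_a2 : polar_data ((0, 0), (1, 0), (0, 0)) (gbase i0) (gbase i1).
Proof. by vm_compute. Qed.
Lemma polar_data_a3 : polar_data ((0, 0), (1, 0), (1, 0)) (gbase i2) (gbase i0).
Proof. by vm_compute. Qed.
Lemma polar_data_w4 : polar_data ((1, 0), (-1, 0), (0, 0)) (gbase i0) (gbase i2).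
Proof. by vm_compute. Qed.

Lemma braid1 : gbraid ga1 gb 3. Proof. by vm_compute. Qed.
Lemma braid2 : gbraid ga2 gb 2. Proof. by vm_compute. Qed.
Lemma braid3 : gbraid ga3 gb 4. Proof. by vm_compute. Qed.

Lemma good_a1 : good_refl (-1, 0) ((0, 0), (1, 1), (1, 0)). Proof. by vm_compute. Qed.
Lemma good_b : good_refl (-1, 0) ((1, 0), (0, 0), (1, 0)). Proof. by vm_compute. Qed.
Lemma good_a2 : good_refl (-1, 1) ((0, 0), (1, 0), (0, 0)). Proof. by vm_compute. Qed.
Lemma good_a3 : good_refl (-1, 1) ((0, 0), (1, 0), (1, 0)). Proof. by vm_compute. Qed.

Lemma gens1 : all (all (fun g => g \in [:: ga1; gb])) words1. Proof. by vm_compute. Qed.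
Lemma gens2 : all (all (fun g => g \in [:: ga2; gb])) words2. Proof. by vm_compute. Qed.
Lemma gens3 : all (all (fun g => g \in [:: ga3; gb])) words3. Proof. by vm_compute. Qed.
Lemma gens4 : all (all (fun g => g \in [:: gA4])) words4. Proof. by vm_compute. Qed.
Lemma gens5 : all (all (fun g => g \in [:: gA5])) words5. Proof. by vm_compute. Qed.

Definition orders : seq nat := [:: 6; 8; 32; 8; 12].

Lemma orders_eq a b : (a < 5)%N -> (b < 5)%N -> nth 0%N orders a = nth 0%N orders b ->
  [\/ a = b, a = 3%N /\ b = 1%N | a = 1%N /\ b = 3%N].
Proof.
by case: a b => [|[|[|[|[|//]]]]] [|[|[|[|[|//]]]]] //= _ _ _;
   do [exact: Or31 | exact: Or32 | exact: Or33].
Qed.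

Definition point_vector (R : realType) (k : 'I_5) : 'cV[C R]_3 := nth 0 (points R) k.

Section Points.
Variable R : realType.
Local Notation K := (C R).
Local Notation vec := (@vec3 R).
Local Notation mC := (gauss_mx R).
Local Notation vC := (gauss_vec R).
Local Notation gC := (gauss R).
Local Notation cl := (gauss_class R).

Lemma polar_a1 : polar_reflection (vec 0 (1 + 'i) 1) = cl ga1.
Proof.
have -> : vec 0 (1 + 'i) 1 = vC ((0, 0), (1, 1), (1, 0)) by apply: vecP; rewrite !vec3E /gauss /=; ring.
exact: polar_reflection_cl polar_data_a1.
Qed.

Lemma polar_b : polar_reflection (vec 1 0 1) = cl gb.
Proof. by rewrite -vC_gwt2; exact: polar_reflection_cl polar_data_b. Qed.

Lemma polar_a2 : polar_reflection (vec 0 1 0) = cl ga2.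
Proof. by rewrite -vC_gwt0; exact: polar_reflection_cl polar_data_a2. Qed.

Lemma polar_a3 : polar_reflection (vec 0 1 1) = cl ga3.
Proof.
have -> : vec 0 1 1 = vC ((0, 0), (1, 0), (1, 0)) by apply: vecP; rewrite !vec3E /gauss /=; ring.
exact: polar_reflection_cl polar_data_a3.
Qed.

Lemma polar_w4 : polar_reflection (vec 1 (-1) 0) = cl (grefl (-1, 1) ((1, 0), (-1, 0), (0, 0))).
Proof. by rewrite -vC_gwt1; exact: polar_reflection_cl polar_data_w4. Qed.

Lemma refl_pair_group v c1 w1 c2 w2 ws n D N : gsq v < 0 -> let a := grefl c1 w1 in let b := grefl c2 w2 in
  good_refl c1 w1 -> good_refl c2 w2 -> gherm v w1 = (0, 0) -> gherm v w2 = (0, 0) ->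
  all (all (fun g => g \in [:: a; b])) ws -> complete (vC v) (map gword ws) ->
  all gunit (map gword ws) && distinct_classes (map gword ws) -> gbraid a b n ->
  mirror_check (map gword ws) D N ->
  let G := isotropy <[vC v]>%VS in let m j := count (fun d => d.2 == j) D in
  [/\ G = reflection_subgroup G, G #= `I_(size (map gword ws)), G = generated [set cl a; cl b],
     braid_length (cl a) (cl b) n & mirror_counts G (m 0%N) (m 1%N) (m 2%N)].
Proof.
move=> v0 a b gr1 gr2 h1 h2 wg cv /andP[ul dl] br mc G m.
have vn : vC v != 0 by apply: neg_neq0; rewrite herm_vCs ltrz0.
have st g : g \in [:: a; b] -> exists c, mC g *m vC v = c *: vC v.
  by rewrite !inE => /orP[/eqP ->|/eqP ->]; exact: grefl_stab.
have eG : G = @cls R (map gword ws).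
  by apply: (isotropy_cls vn ul _ cv); exact: word_eig wg st.
have ug g : g \in [:: a; b] -> gunit g.
  by rewrite !inE => /orP[/eqP ->|/eqP ->]; [case/and4P: gr1|case/and4P: gr2].
have iso g : g \in [:: a; b] -> G (cl g).
  move=> gab; apply/(isotropyP _ vn); have [c ec] := st g gab; exists g, c.
  by split; [exact: ug|by []|exact: ec].
split; last exact: mirror_counts_cls eG mc.
- apply: (reflection_subgroup_words vn eG wg) => g gab; split; first exact: iso.
  move: gab; rewrite !inE => /orP[/eqP ->|/eqP ->].
    by exists (mirror (vC w1)); exact: grefl_is_reflection.
  by exists (mirror (vC w2)); exact: grefl_is_reflection.
- by rewrite eG; exact: card_cls.
- exact: generated_pair vn eG wg iso.
- exact: braid_length_cl.
Qed.

Definition group1 := @refl_pair_group gv1 _ _ _ _ _ _ _ _ erefl good_a1 good_b erefl erefl gens1 (@complete1 R) ok1 braid1 mirrors1.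
Definition group2 := @refl_pair_group gv2 _ _ _ _ _ _ _ _ erefl good_a2 good_b erefl erefl gens2 (@complete2 R) ok2 braid2 mirrors2.
Definition group3 := @refl_pair_group gv3 _ _ _ _ _ _ _ _ erefl good_a3 good_b erefl erefl gens3 (@complete3 R) ok3 braid3 mirrors3.

Lemma cyclic_group (v : 'cV[K]_3) A ws D N w : v != 0 -> gunit A -> (exists c, mC A *m v = c *: v) ->
  all (all (fun g => g \in [:: A])) ws -> complete v (map gword ws) ->
  all gunit (map gword ws) && distinct_classes (map gword ws) ->
  mirror_check (map gword ws) D N -> reflections_cyclic (map gword ws) D w ->
  let G := isotropy <[v]>%VS in let RG := reflection_subgroup G in let m j := count (fun d => d.2 == j) D in
  [/\ G #= `I_(size (map gword ws)), G = generated [set cl A], RG #= `I_4,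
     RG = generated [set cl (grefl (-1, 1) w)] & mirror_counts G (m 0%N) (m 1%N) (m 2%N)].
Proof.
move=> vn uA stA wg cv /andP[ul dl] mc rc G RG m.
have st g : g \in [:: A] -> exists c, mC g *m v = c *: v by rewrite inE => /eqP ->.
have eG : G = @cls R (map gword ws).
  by apply: (isotropy_cls vn ul _ cv); exact: word_eig wg st.
have [r1 r2] := reflection_subgroup_cyclic eG mc rc.
split; [| |exact: r1|exact: r2|exact: mirror_counts_cls eG mc].
  by rewrite eG; exact: card_cls.
apply: (generated_single vn eG wg); have [c ec] := stA; apply/(isotropyP _ vn); exists A, c.
by split; [exact: uA|by []|exact: ec].
Qed.

Lemma stab4 : exists c, mC gA4 *m vec 1 (z4 R) (z4 R) = c *: vec 1 (z4 R) (z4 R).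
Proof.
(* The eigenvalue is read off the first row; the other rows use the quadratic equation of [z4]. *)
exists (- 'i - z4 R); apply: vecP; rewrite appE mxE !vec3E /gauss_mx /mx3 !mxE /gauss /=.
- ring.
- rewrite mulrBl z4_sq /gauss /=; ring.
- rewrite mulrBl z4_sq /gauss /=; ring.
Qed.

Lemma stab5 : exists c, mC gA5 *m vec 1 0 (t5 R) = c *: vec 1 0 (t5 R).
Proof.
exists ('i + t5 R); apply: vecP; rewrite appE mxE !vec3E /gauss_mx /mx3 !mxE /gauss /=.
- ring.
- ring.
- rewrite [RHS]mulrDl t5_sq /gauss /=; ring.
Qed.

Definition group4 := cyclic_group (neg_neq0 (herm_v4 R)) (erefl : gunit gA4) stab4 gens4 (@complete4 R) ok4 mirrors4 cyclic4.
Definition group5 := cyclic_group (neg_neq0 (herm_v5 R)) (erefl : gunit gA5) stab5 gens5 (@complete5 R) ok5 mirrors5 cyclic5.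

Lemma points_negative (k : 'I_5) : herm (point_vector R k) (point_vector R k) < 0.
Proof.
case: k => [[|[|[|[|[|//]]]]] h] //; rewrite /point_vector /=.
- by rewrite -vC_p1 herm_vCs ltrz0.
- by rewrite -vC_p2 herm_vCs ltrz0.
- by rewrite -vC_p3 herm_vCs ltrz0.
- exact: herm_p4.
- exact: herm_v5.
Qed.

Lemma points_order (k : 'I_5) : isotropy <[point_vector R k]>%VS #= `I_(nth 0%N orders k).
Proof.
case: k => [[|[|[|[|[|//]]]]] h] //; rewrite /point_vector /=.
- by rewrite -vC_p1; case: group1.
- by rewrite -vC_p2; case: group2.
- by rewrite -vC_p3; case: group3.
- by case: group4.
- by case: group5.
Qed.

(** The ratio of the first two coordinates survives scaling. It lies in Q(i) for a Gaussian vector,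
    but equals [z4] at the other point. *)
Lemma rational_korb_z4 v : ~ korb (vC v) (vec 1 (z4 R) (z4 R)).
Proof.
move=> [A [c [uA c0]]]; rewrite -vC_app => e.
have e0 : vec 1 (z4 R) (z4 R) i0 0 = (c *: vC (gapp A v)) i0 0 by rewrite e.
have e1 : vec 1 (z4 R) (z4 R) i1 0 = (c *: vC (gapp A v)) i1 0 by rewrite e.
have sc (u : 'cV[K]_3) i : (c *: u) i 0 = c * u i 0 by rewrite !mxE.
move: e0 e1; rewrite !sc !vC_coord !vec3E.
move: (gcoord _ i0) (gcoord _ i1) => x y e0 e1.
have /z4_indep[_ /(congr1 gopp) h] : gC y + z4 R * gC (gopp x) = 0.
  apply: (mulfI c0); rewrite mulr0 mulrDr -e1 gCN mulrN mulrN mulrCA -e0 mulr1 subrr //.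
move: e0; have -> : x = (0, 0) by move: h; rewrite /gopp /= !opprK; case: (x).
by rewrite gC0 mulr0 => /eqP; rewrite oner_eq0.
Qed.

Lemma points_distinct (k k' : 'I_5) : korb (point_vector R k) (point_vector R k') -> k = k'.
Proof.
move=> h; have h' := korb_sym h.
have := korb_card (neg_neq0 (points_negative k)) h.
rewrite (card_eql (points_order k)) (card_eqr (points_order k')) => /card_eq_II e.
apply: val_inj; move: h h'; rewrite /point_vector.
have n24 : korb (vec 1 0 (-1)) (vec 1 (z4 R) (z4 R)) -> False by rewrite -vC_p2; exact: rational_korb_z4.
have [//|[[-> ->] _ h]|[[-> ->] h _]] := orders_eq (ltn_ord k) (ltn_ord k') e.
  by case: (n24 h).
by case: (n24 h).
Qed.

Lemma isolated_unique x : H2C x -> isolated_fixed_point (isotropy x) x ->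
  exists! k : 'I_5, Gamma1_orbit <[point_vector R k]>%VS x.
Proof.
move=> [v v0 <-] /(isolated_korb v0)[k h].
have nz j := neg_neq0 (points_negative j).
exists k; split; first by apply/(korb_orbit _ (nz k)); exact: korb_sym.
by move=> k' /(korb_orbit _ (nz k')) h'; apply: points_distinct; exact: korb_sym (korb_trans h' h).
Qed.

Lemma mC_A4 : mC gA4 = mx3 [:: [:: - 'i; - 'i - 1; 'i]; [:: 'i - 1; 'i; 0]; [:: 'i - 1; 'i - 1; 1]].
Proof.
by rewrite /gauss_mx /=; congr (mx3 [:: [:: _; _; _]; [:: _; _; _]; [:: _; _; _]]); rewrite /gauss /=; ring.
Qed.

Lemma mC_A5 : mC gA5 = mx3 [:: [:: 'i; 0; 1]; [:: 0; -1; 0]; [:: 1; 0; 0]].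
Proof.
by rewrite /gauss_mx /=; congr (mx3 [:: [:: _; _; _]; [:: _; _; _]; [:: _; _; _]]); rewrite /gauss /=; ring.
Qed.
End Points.

Theorem mainTheorem6 (R : realType) :
  let p1 : point R := <[vec3 (1 + 'i) (- 'i) (- 1 - 'i)]>%VS in
  let p2 : point R := <[vec3 1 0 (- 1)]>%VS in
  let p3 : point R := <[vec3 1 (- 1) (- 1)]>%VS in
  let p4 : point R :=
    <[vec3 1 ('i * (zeta R 8 - 1)) ('i * (zeta R 8 - 1))]>%VS in
  let p5 : point R := <[vec3 1 0 (- zeta R 12)]>%VS in
  let p (k : 'I_5) : point R := nth p1 [:: p1; p2; p3; p4; p5] k in
  (forall k, H2C (p k)) /\
  (forall x, H2C x -> isolated_fixed_point (isotropy x) x ->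
     exists! k, Gamma1_orbit (p k) x) /\
  [/\ (let G := isotropy p1 in
       let a := polar_reflection (vec3 0 (1 + 'i) 1) in
       let b := polar_reflection (vec3 1 0 1) in
       [/\ G = reflection_subgroup G, G #= `I_6,
           G = generated [set a; b], braid_length a b 3
         & mirror_counts G 0 0 3]),
      (let G := isotropy p2 in
       let a := polar_reflection (vec3 0 1 0) in
       let b := polar_reflection (vec3 1 0 1) in
       [/\ G = reflection_subgroup G, G #= `I_8,
           G = generated [set a; b], braid_length a b 2
         & mirror_counts G 1 0 1]),
      (let G := isotropy p3 in
       let a := polar_reflection (vec3 0 1 1) in
       let b := polar_reflection (vec3 1 0 1) in
       [/\ G = reflection_subgroup G, G #= `I_32,
           G = generated [set a; b], braid_length a b 4
         & mirror_counts G 0 2 4]),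
      (let G := isotropy p4 in
       let A : 'M[C R]_3 :=
         mx3 [:: [:: - 'i;   - 'i - 1; 'i];
                 [:: 'i - 1; 'i;       0 ];
                 [:: 'i - 1; 'i - 1;   1 ]] in
       let RG := reflection_subgroup G in
       [/\ G #= `I_8, G = generated [set <[A]>%VS], RG #= `I_4,
           RG = generated [set polar_reflection (vec3 1 (- 1) 0)]
         & mirror_counts G 0 1 0])
    & (let G := isotropy p5 in
       let A : 'M[C R]_3 :=
         mx3 [:: [:: 'i; 0;   1];
                 [:: 0;  - 1; 0];
                 [:: 1;  0;   0]] in
       let RG := reflection_subgroup G in
       [/\ G #= `I_12, G = generated [set <[A]>%VS], RG #= `I_4,
           RG = generated [set polar_reflection (vec3 0 1 0)]
         & mirror_counts G 1 0 0])].
Proof.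
move=> p1 p2 p3 p4 p5 p.
have pE k : p k = <[point_vector R k]>%VS.
  by case: k => [[|[|[|[|[|//]]]]] h].
have g1 := group1 R; rewrite vC_p1 -polar_a1 -polar_b in g1.
have g2 := group2 R; rewrite vC_p2 -polar_a2 -polar_b in g2.
have g3 := group3 R; rewrite vC_p3 -polar_a3 -polar_b in g3.
have g4 := group4 R; rewrite /gauss_class mC_A4 -/(gauss_class R _) -polar_w4 in g4.
have g5 := group5 R; rewrite /gauss_class mC_A5 -/(gauss_class R _) -[gauss_class R _]polar_a2 in g5.
split; first by move=> k; rewrite pE; apply/H2CP; exact: points_negative.
split; last by split; [exact: g1|exact: g2|exact: g3|exact: g4|exact: g5].
move=> x hx ix; have [k [h1 h2]] := isolated_unique hx ix.
exists k; split; first by rewrite pE; exact: h1.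
by move=> k'; rewrite pE; exact: h2.
Qed.
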